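(* For $k\in\{1,\dots,K\}$ and $i\in\{1,\dots,n\}$ let $x_i^k=r_i^kAu_i^k\in\mathbb{R}^p$ be i.i.d., where $u_i^k$ is uniformly distributed on the unit sphere $S^{p-1}$ and independent of the positive random radius $r_i^k$, and let the scatter matrix $\Sigma=AA^\top$ have eigenvalues $0\le\lambda_p=\dots=\lambda_{r+1}<\lambda_r\le\dots\le\lambda_1<\infty$. Assume that for sufficiently large $K,n,p$ we have $Kn\le C_4p^2\log p$ and $n\ge C_5p\log p$ for some constants $C_4,C_5>0$, and that $\lambda_r\ge\lambda_{r+1}+d$ and $\lambda_1/\lambda_p\le C_6p^{\alpha}$ for some constants $d,C_6>0$ and some fixed $0<\alpha<1/2$. Let $U\in\mathbb{R}^{p\times r}$ be the matrix of leading $r$ eigenvectors of $\Sigma$. Then for any $\hat U_\tau^{(1)}\in\mathbb{R}^{p\times r}$ with orthonormal columns such that $\|\hat U_\tau^{(1)}(\hat U_\tau^{(1)})^\top-UU^\top\|_2<1$, the estimator $\hat U_\tau^{(3)}$ obtained from $\hat U_\tau^{(1)}$ by two steps of distributed shifted subspace iteration on the local sample multivariate Kendall's $\tau$ matrices satisfies $$\left\|\hat U_\tau^{(3)}\big(\hat U_\tau^{(3)}\big)^\top-UU^\top\right\|_F=O_p\left(\sqrt{\frac{r\,p\log p}{Kn}}\right).$$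
   Context: Data are stored on $K$ machines; machine $k$ holds $x_1^k,\dots,x_n^k$. The rank $r$ and the leading eigenvalues $\lambda_1,\dots,\lambda_r$ are treated as constants. $\|\cdot\|_2$ is the operator norm; $O_p$ is stochastic boundedness as $K,n,p$ grow. Local sample multivariate Kendall's $\tau$ matrix: $\tilde\Sigma_k^\tau=\frac{2}{n(n-1)}\sum_{1\le i<j\le n}\frac{(x_i^k-x_j^k)(x_i^k-x_j^k)^\top}{\|x_i^k-x_j^k\|^2}$. Distributed shifted subspace iteration: given $\hat U_\tau^{(t)}$, $t\ge1$, set $(\tilde\sigma_k^{(t)})^2=\frac{1}{p-r}\operatorname{tr}\big(\tilde\Sigma_k^\tau(I_p-\hat U_\tau^{(t)}(\hat U_\tau^{(t)})^\top)\big)$ and $\tilde G_k^{(t)}=\tilde\Sigma_k^\tau\hat U_\tau^{(t)}-(\tilde\sigma_k^{(t)})^2\hat U_\tau^{(t)}$; then $\hat U_\tau^{(t+1)}\in\mathbb{R}^{p\times r}$ is the matrix with orthonormal columns obtained from the QR factorization of $\frac1K\sum_{k=1}^K\tilde G_k^{(t)}$.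
   Formalization: The initial distance is assumed to be at most a fixed constant c < 1 as K, n, p grow, not merely < 1; with only < 1 the claim fails, e.g. for r = 1 when the initial vector is a non-leading eigenvector of the averaged Kendall matrix, which the iteration leaves fixed. *)

(* Defs.v *)
From HB Require Import structures.
From mathcomp Require Export all_boot all_order all_algebra.
From mathcomp Require Export all_classical all_reals all_analysis.
Export numFieldNormedType.Exports.
Export Order.TTheory GRing.Theory Num.Theory.

Set Implicit Arguments.
Unset Strict Implicit.
Unset Printing Implicit Defensive.

Local Open Scope classical_set_scope.
Local Open Scope ring_scope.

Section Linear_algebra.
Context {R : realType}.

(* The library norm on matrices is the sup norm of the entries, hence the two
   definitions below; on column vectors [frobenius] is the Euclidean norm. *)
Definition frobenius {m n : nat} (M : 'M[R]_(m, n)) : R :=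
  Num.sqrt (\sum_i \sum_j M i j ^+ 2).

Definition opnorm {m n : nat} (M : 'M[R]_(m, n)) : R :=
  sup [set frobenius (M *m v) | v in [set v : 'cV[R]_n | frobenius v <= 1]].

Definition orthonormal_cols {m n : nat} (M : 'M[R]_(m, n)) : Prop :=
  M^T *m M = 1%:M.

(* [s] lists the eigenvalues of [M], repeated with algebraic multiplicity. *)
Definition has_spectrum {p : nat} (M : 'M[R]_p) (s : seq R) : Prop :=
  char_poly M = \prod_(a <- s) ('X - a%:P).

(* [is_trig_mx] means lower triangular. No sign convention is imposed on the
   diagonal of the triangular factor, and [G] may be rank deficient. *)
Definition is_qr_factor {p r : nat} (G Q : 'M[R]_(p, r)) : Prop :=
  orthonormal_cols Q /\ exists S : 'M[R]_r, is_trig_mx S^T /\ G = Q *m S.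

End Linear_algebra.

Section Kendall_subspace_iteration.
Context {R : realType}.

(* A summand with [x i = x j] is 0, since [0^-1 = 0]. *)
Definition kendall {n p : nat} (x : 'I_n -> 'cV[R]_p) : 'M[R]_p :=
  (2 / (n%:R * (n%:R - 1))) *:
    \sum_(i < n) \sum_(j < n | (i < j)%N)
      (frobenius (x i - x j) ^- 2) *: ((x i - x j) *m (x i - x j)^T).

Definition local_shift {n p r : nat} (x : 'I_n -> 'cV[R]_p)
    (V : 'M[R]_(p, r)) : R :=
  (p%:R - r%:R)^-1 * \tr (kendall x *m (1%:M - V *m V^T)).

Definition local_update {n p r : nat} (x : 'I_n -> 'cV[R]_p)
    (V : 'M[R]_(p, r)) : 'M[R]_(p, r) :=
  kendall x *m V - local_shift x V *: V.

(* [V'] is a possible result of one iteration started at [V]. *)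
Definition iteration_step {K n p r : nat} (x : 'I_K -> 'I_n -> 'cV[R]_p)
    (V V' : 'M[R]_(p, r)) : Prop :=
  is_qr_factor (K%:R^-1 *: \sum_(k < K) local_update (x k) V) V'.

End Kendall_subspace_iteration.

Section Random_vectors.
Context {d : measure_display} {T : measurableType d} {R : realType}.
Variable P : probability T R.

Definition random_matrix {m n : nat} (X : T -> 'M[R]_(m, n)) : Prop :=
  forall i j, measurable_fun [set: T] (fun w => X w i j).

Definition borel_cV (p : nat) : set (set 'cV[R]_p) :=
  <<s [set B : set 'cV[R]_p | open B] >>.

(* Taking some [B i] to be the whole space gives the product rule for every
   subfamily. *)
Definition mutually_independent {I : finType} {p : nat}
    (X : I -> T -> 'cV[R]_p) : Prop :=
  forall B : I -> set 'cV[R]_p, (forall i, borel_cV (B i)) ->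
    P (\bigcap_(i in [set: I]) (X i @^-1` B i)) = (\prod_i P (X i @^-1` B i))%E.

Definition identically_distributed {I : finType} {p : nat}
    (X : I -> T -> 'cV[R]_p) : Prop :=
  forall (i j : I) (B : set 'cV[R]_p), borel_cV B ->
    P (X i @^-1` B) = P (X j @^-1` B).

(* The uniform law on the unit sphere is the rotation invariant probability
   carried by the sphere. *)
Definition uniform_on_sphere {p : nat} (u : T -> 'cV[R]_p) : Prop :=
  [/\ random_matrix u,
      {ae P, forall w, frobenius (u w) = 1} &
      forall O : 'M[R]_p, orthonormal_cols O ->
      forall B : set 'cV[R]_p, borel_cV B ->
        P (u @^-1` B) = P ((fun w => O *m u w) @^-1` B)].

Definition independent_radius {p : nat} (u : T -> 'cV[R]_p) (rho : T -> R)
    : Prop :=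
  forall (B : set 'cV[R]_p) (C : set R), borel_cV B -> measurable C ->
    P (u @^-1` B `&` rho @^-1` C) = (P (u @^-1` B) * P (rho @^-1` C))%E.

Definition elliptical_obs {K n p : nat} (A : 'M[R]_p)
    (rho : 'I_K -> 'I_n -> T -> R) (u : 'I_K -> 'I_n -> T -> 'cV[R]_p)
    (k : 'I_K) (i : 'I_n) (w : T) : 'cV[R]_p :=
  rho k i w *: (A *m u k i w).

Record elliptical_sample {K n p : nat} (A : 'M[R]_p)
    (rho : 'I_K -> 'I_n -> T -> R) (u : 'I_K -> 'I_n -> T -> 'cV[R]_p)
    : Prop := EllipticalSample {
  es_radius_measurable : forall k i, measurable_fun [set: T] (rho k i);
  es_radius_pos : forall k i, {ae P, forall w, 0 < rho k i w};
  es_uniform : forall k i, uniform_on_sphere (u k i);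
  es_radius_indep : forall k i, independent_radius (u k i) (rho k i);
  es_indep : mutually_independent
    (fun ki : 'I_K * 'I_n => elliptical_obs A rho u ki.1 ki.2);
  es_ident : identically_distributed
    (fun ki : 'I_K * 'I_n => elliptical_obs A rho u ki.1 ki.2) }.

End Random_vectors.

(* [Sigma] has the eigenvalues of [lam], in nonincreasing order, followed by
   [p - r] copies of the strictly smaller [mu]; the columns of [U] are
   orthonormal eigenvectors for [lam]. *)
Record spiked_scatter {R : realType} {p r : nat} (Sigma : 'M[R]_p)
    (lam : r.-tuple R) (mu : R) (U : 'M[R]_(p, r)) : Prop := SpikedScatter {
  ss_rank_lt : (r < p)%N;
  ss_spectrum : has_spectrum Sigma (lam ++ nseq (p - r) mu);
  ss_sorted : sorted >=%R lam;
  ss_bulk_ge0 : 0 <= mu;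
  ss_bulk_lt : mu < last 0 lam;
  ss_orthonormal : orthonormal_cols U;
  ss_eigenvectors : Sigma *m U = U *m diag_mx (\row_j tnth lam j) }.

(* [X m = O_p(a m)] as [m] tends to infinity; the random variables may live on
   different probability spaces. *)
Definition is_Op {R : realType} {disp : nat -> measure_display}
    {T : forall m, measurableType (disp m)} (P : forall m, probability (T m) R)
    (X : forall m, T m -> R) (a : nat -> R) : Prop :=
  forall eps : R, 0 < eps -> exists2 M : R, 0 < M &
    \forall m \near \oo,
      (P m [set w | (M * a m < `|X m w|)%R] <= eps%:E)%E.

(* Main.v *)
(* Averaging over machines is linear, so one iteration is a power step with the
   averaged Kendall matrix [M], shifted by its mean outside the current subspace.
   Rescaled by [p mu], [M] equals [g Sigma + E] with [1/2 <= g <= 1]; such a step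
   expands the directions of [U] by at least [g d] while their orthogonal
   complement only sees [E] and an error [O(1/p)] of the shift.  After the first
   step the sine of the angle to [U] is at most [1/3], whatever [c < 1]; after the
   second it is [O(|E| + 1/p)], and [1/p] is below the rate because
   [K n <= C4 p^2 ln p].

   To bound [E], write [x_i = A z_i] with [z_i] rotation invariant and let [w] be
   the direction of [x_i - x_j].  Then [(v.w)^2] is at most [|A^T v|^2 / mu] times
   the square of one coordinate of a random direction, which is sub-exponential at
   scale [1/p]: rotate that coordinate to a uniformly random sign vector.  The same
   computation gives its mean up to the relative error [p^(alpha-1)].  The pairs
   [i < j] split into matchings according to [i + j] modulo [n]; within a matching
   they are independent, so convexity of [exp] gives a Chernoff bound for the
   quadratic form of [M], and a union over a lattice net of [exp(O(p))] points
   gives [|E| = O_p(sqrt (p / (K n)) + p^(alpha-1))]. *)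
Require Import Defs.
From HB Require Import structures.
From mathcomp Require Import measurable_realfun.
From mathcomp Require Import ring lra zify.

Set Implicit Arguments.
Unset Strict Implicit.
Unset Printing Implicit Defensive.

Local Open Scope classical_set_scope.
Local Open Scope ring_scope.

(** * Euclidean geometry of column vectors *)

Section Dot.
Context {R : realType}.

(** The law of the direction of a difference is never computed: all that enters is that two radial
    parts may be rotated separately without changing the law of their difference. Ties between
    radial parts are not excluded. As the difference and the sum have the same law, a tie has
    probability at most 1/2, and this is where the factor [g] between 1/2 and 1 comes from; a lower
    bound on [g] suffices, since it only scales the gap. Applying [A] distorts the direction and
    biases the mean of the quadratic form. Only the [r] spike directions contribute to this bias,
    which makes it of relative order L / (mu p), that is p^(alpha-1). The condition alpha < 1/2 puts
    it below p^(-1/2), and K n <= C4 p^2 ln p puts p^(-1/2) below a multiple of the rate. The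
    condition n >= C5 p ln p forces the rate to 0 as K grows, so the perturbation eventually falls
    below the threshold, depending on [c], at which the first step contracts. The deviation level 2
    sqrt (p / (K n)) is chosen so that the tail exp(-64 p) beats the cardinality of the net, which
    is at most exp(38 p). *)

Definition dot {p : nat} (u v : 'cV[R]_p) : R := \sum_i u i 0 * v i 0.

Definition nsq {p : nat} (v : 'cV[R]_p) : R := dot v v.

Lemma dotE p (u v : 'cV[R]_p) : dot u v = (u^T *m v) 0 0.
Proof. by rewrite mxE; apply: eq_bigr => i _; rewrite mxE. Qed.

Lemma dotC p (u v : 'cV[R]_p) : dot u v = dot v u.
Proof. by apply: eq_bigr => i _; rewrite mulrC. Qed.

Lemma dotDl p (u u' v : 'cV[R]_p) : dot (u + u') v = dot u v + dot u' v.
Proof. by rewrite !dotE linearD mulmxDl mxE. Qed.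

Lemma dotDr p (u v v' : 'cV[R]_p) : dot u (v + v') = dot u v + dot u v'.
Proof. by rewrite dotC dotDl !(dotC u). Qed.

Lemma dotZl p a (u v : 'cV[R]_p) : dot (a *: u) v = a * dot u v.
Proof. by rewrite !dotE linearZ -scalemxAl mxE. Qed.

Lemma dotZr p a (u v : 'cV[R]_p) : dot u (a *: v) = a * dot u v.
Proof. by rewrite dotC dotZl dotC. Qed.

Lemma dotNl p (u v : 'cV[R]_p) : dot (- u) v = - dot u v.
Proof. by rewrite -scaleN1r dotZl mulN1r. Qed.

Lemma dotNr p (u v : 'cV[R]_p) : dot u (- v) = - dot u v.
Proof. by rewrite dotC dotNl dotC. Qed.

Lemma dotBl p (u u' v : 'cV[R]_p) : dot (u - u') v = dot u v - dot u' v.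
Proof. by rewrite dotDl dotNl. Qed.

Lemma dotBr p (u v v' : 'cV[R]_p) : dot u (v - v') = dot u v - dot u v'.
Proof. by rewrite dotDr dotNr. Qed.

Lemma dot0l p (v : 'cV[R]_p) : dot 0 v = 0.
Proof. by rewrite -(scale0r v) dotZl mul0r. Qed.

Lemma dot0r p (v : 'cV[R]_p) : dot v 0 = 0.
Proof. by rewrite dotC dot0l. Qed.

Lemma dot_sumr p (I : finType) (v : 'cV[R]_p) (F : I -> 'cV[R]_p) (P : pred I) :
  dot v (\sum_(i | P i) F i) = \sum_(i | P i) dot v (F i).
Proof. by apply: (big_morph (dot v)); [exact: dotDr|exact: dot0r]. Qed.

Lemma dot_mulmxr p q (u : 'cV[R]_p) (M : 'M[R]_(p, q)) (v : 'cV[R]_q) :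
  dot u (M *m v) = dot (M^T *m u) v.
Proof. by rewrite !dotE trmx_mul trmxK mulmxA. Qed.

Lemma dot_mulmxl p q (u : 'cV[R]_q) (M : 'M[R]_(p, q)) (v : 'cV[R]_p) :
  dot (M *m u) v = dot u (M^T *m v).
Proof. by rewrite dotC dot_mulmxr dotC. Qed.

Lemma nsqE p (v : 'cV[R]_p) : nsq v = \sum_i v i 0 ^+ 2.
Proof. by apply: eq_bigr => i _; rewrite expr2. Qed.

Lemma nsq_ge0 p (v : 'cV[R]_p) : 0 <= nsq v.
Proof. by rewrite nsqE; apply: sumr_ge0 => i _; exact: sqr_ge0. Qed.

Lemma nsq_eq0 p (v : 'cV[R]_p) : nsq v = 0 -> v = 0.
Proof.
rewrite nsqE => /eqP; rewrite psumr_eq0; last by move=> i _; exact: sqr_ge0.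
move=> /allP h; apply/matrixP => i j; rewrite ord1 mxE; apply/eqP.
by have := h i (mem_index_enum _); rewrite sqrf_eq0.
Qed.

Lemma nsq0 p : nsq (0 : 'cV[R]_p) = 0.
Proof. exact: dot0l. Qed.

Lemma nsq_gt0 p (v : 'cV[R]_p) : v != 0 -> 0 < nsq v.
Proof.
move=> v0; rewrite lt_neqAle nsq_ge0 andbT eq_sym.
by apply: contra v0 => /eqP/nsq_eq0 ->.
Qed.

Lemma nsqZ p a (v : 'cV[R]_p) : nsq (a *: v) = a ^+ 2 * nsq v.
Proof. by rewrite /nsq dotZl dotZr mulrA expr2. Qed.

Lemma nsqN p (v : 'cV[R]_p) : nsq (- v) = nsq v.
Proof. by rewrite /nsq dotNl dotNr opprK. Qed.

Lemma nsqD p (u v : 'cV[R]_p) : nsq (u + v) = nsq u + 2 * dot u v + nsq v.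
Proof. by rewrite /nsq dotDl !dotDr (dotC v u); ring. Qed.

Lemma nsqB p (u v : 'cV[R]_p) : nsq (u - v) = nsq u - 2 * dot u v + nsq v.
Proof. by rewrite nsqD dotNr nsqN; ring. Qed.

Lemma nsq_mulmx p q (M : 'M[R]_(p, q)) (v : 'cV[R]_q) :
  nsq (M *m v) = dot v (M^T *m M *m v).
Proof. by rewrite /nsq dot_mulmxl mulmxA. Qed.

Lemma nsq_orthonormal p q (M : 'M[R]_(p, q)) (v : 'cV[R]_q) :
  orthonormal_cols M -> nsq (M *m v) = nsq v.
Proof. by move=> h; rewrite nsq_mulmx h mul1mx. Qed.

Lemma cauchy_schwarz p (u v : 'cV[R]_p) : dot u v ^+ 2 <= nsq u * nsq v.
Proof.
have [->|v0] := eqVneq v 0; first by rewrite dot0r nsq0 mulr0 expr0n.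
have := nsq_ge0 (nsq v *: u - dot u v *: v).
rewrite nsqB !nsqZ dotZl dotZr => h.
rewrite -(ler_pM2l (nsq_gt0 v0)); nra.
Qed.

Lemma frobenius_ge0 m n (M : 'M[R]_(m, n)) : 0 <= frobenius M.
Proof. exact: sqrtr_ge0. Qed.

Lemma frobenius_sqr m n (M : 'M[R]_(m, n)) :
  frobenius M ^+ 2 = \sum_i \sum_j M i j ^+ 2.
Proof.
rewrite sqr_sqrtr//; apply: sumr_ge0 => i _; apply: sumr_ge0 => j _.
exact: sqr_ge0.
Qed.

Lemma frobenius_col m n (M : 'M[R]_(m, n)) :
  frobenius M ^+ 2 = \sum_j nsq (col j M).
Proof.
rewrite frobenius_sqr exchange_big; apply: eq_bigr => j _.
by rewrite nsqE; apply: eq_bigr => i _; rewrite mxE.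
Qed.

Lemma frobenius_cV p (v : 'cV[R]_p) : frobenius v ^+ 2 = nsq v.
Proof.
by rewrite frobenius_sqr nsqE; apply: eq_bigr => i _; rewrite big_ord1.
Qed.

Lemma frobenius_tr m n (M : 'M[R]_(m, n)) :
  frobenius M ^+ 2 = \tr (M^T *m M).
Proof.
rewrite frobenius_col; apply: eq_bigr => j _.
rewrite mxE nsqE; apply: eq_bigr => i _.
by rewrite !mxE expr2.
Qed.

Lemma frobenius_le p (v : 'cV[R]_p) a :
  0 <= a -> (frobenius v <= a) = (nsq v <= a ^+ 2).
Proof.
by move=> a0; rewrite -frobenius_cV ler_sqr// nnegrE// frobenius_ge0.
Qed.

Lemma le_frobenius p (v : 'cV[R]_p) a :
  0 <= a -> (a <= frobenius v) = (a ^+ 2 <= nsq v).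
Proof.
by move=> a0; rewrite -frobenius_cV ler_sqr// nnegrE// frobenius_ge0.
Qed.

Lemma dot_le_frobenius p (u v : 'cV[R]_p) :
  `|dot u v| <= frobenius u * frobenius v.
Proof.
rewrite -ler_sqr ?nnegrE ?mulr_ge0 ?frobenius_ge0//.
by rewrite real_normK ?num_real// exprMn !frobenius_cV cauchy_schwarz.
Qed.

Lemma frobeniusD p (u v : 'cV[R]_p) :
  frobenius (u + v) <= frobenius u + frobenius v.
Proof.
rewrite frobenius_le ?addr_ge0 ?frobenius_ge0//.
rewrite nsqD sqrrD !frobenius_cV lerD2r lerD2l mulr_natl lerMn2r/=.
exact: le_trans (ler_norm _) (dot_le_frobenius _ _).
Qed.

Lemma frobeniusN p (v : 'cV[R]_p) : frobenius (- v) = frobenius v.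
Proof.
by apply/eqP; rewrite -(@eqrXn2 _ 2)// ?frobenius_ge0// !frobenius_cV nsqN.
Qed.

Lemma frobeniusZ p a (v : 'cV[R]_p) : frobenius (a *: v) = `|a| * frobenius v.
Proof.
apply/eqP; rewrite -(@eqrXn2 _ 2)// ?mulr_ge0 ?frobenius_ge0//.
by rewrite exprMn !frobenius_cV nsqZ real_normK// num_real.
Qed.

Lemma frobenius_orthonormal p q (M : 'M[R]_(p, q)) (v : 'cV[R]_q) :
  orthonormal_cols M -> frobenius (M *m v) = frobenius v.
Proof.
move=> h; apply/eqP; rewrite -(@eqrXn2 _ 2)// ?frobenius_ge0//.
by rewrite !frobenius_cV nsq_orthonormal.
Qed.

Lemma frobenius_cV_eq0 p (v : 'cV[R]_p) : frobenius v = 0 -> v = 0.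
Proof. by move=> h; apply: nsq_eq0; rewrite -frobenius_cV h expr0n. Qed.

Lemma frobenius_cV0 p : frobenius (0 : 'cV[R]_p) = 0.
Proof. by apply/eqP; rewrite -sqrf_eq0 frobenius_cV nsq0. Qed.

Lemma frobenius_gt0 p (v : 'cV[R]_p) : v != 0 -> 0 < frobenius v.
Proof.
move=> v0; rewrite lt_neqAle frobenius_ge0 andbT eq_sym.
by apply: contra v0 => /eqP/frobenius_cV_eq0 ->.
Qed.

(* Polarization turns a bound on the quadratic form into one on the operator
   norm, without diagonalizing. *)
Lemma sym_form_bilinear p (E : 'M[R]_p) (e : R) (x y : 'cV[R]_p) :
    E^T = E -> (forall v, `|dot v (E *m v)| <= e * nsq v) ->
  `|dot x (E *m y)| <= e * (frobenius x * frobenius y).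
Proof.
move=> Es Eq.
have key (a b : 'cV[R]_p) : `|dot a (E *m b)| <= e / 2 * (nsq a + nsq b).
  have h1 := Eq (a + b); have h2 := Eq (a - b).
  have Eab : dot b (E *m a) = dot a (E *m b) by rewrite dot_mulmxr Es dotC.
  rewrite nsqD mulmxDr dotDl !dotDr Eab in h1.
  rewrite nsqB mulmxBr dotBl !dotBr Eab in h2.
  move: h1 h2; rewrite !ler_norml => /andP[h1 h2] /andP[h3 h4].
  by apply/andP; split; lra.
have [->|x0] := eqVneq x 0; first by rewrite dot0l normr0 frobenius_cV0 mul0r mulr0.
have [->|y0] := eqVneq y 0; first by rewrite mulmx0 dot0r normr0 frobenius_cV0 !mulr0.
have [fx fy] := (frobenius_gt0 x0, frobenius_gt0 y0).
have := key ((frobenius x)^-1 *: x) ((frobenius y)^-1 *: y).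
rewrite !nsqZ -!frobenius_cV -!exprMn !mulVf ?gt_eqF// expr1n.
rewrite -scalemxAr dotZl dotZr mulrA normrM.
rewrite (ger0_norm (x := _ * _)) ?mulr_ge0 ?invr_ge0 ?frobenius_ge0//.
rewrite -invfM mulrC ler_pdivrMr ?mulr_gt0// => h.
by apply: (le_trans h); rewrite -subr_ge0 le_eqVlt; apply/orP; left; apply/eqP; field.
Qed.

Lemma sym_form_frobenius p (E : 'M[R]_p) (e : R) (y : 'cV[R]_p) :
    E^T = E -> 0 <= e -> (forall v, `|dot v (E *m v)| <= e * nsq v) ->
  frobenius (E *m y) <= e * frobenius y.
Proof.
move=> Es e0 Eq; have := @sym_form_bilinear p E e (E *m y) y Es Eq.
rewrite -/(nsq _) ger0_norm ?nsq_ge0// -frobenius_cV expr2.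
have [->|f0] := eqVneq (frobenius (E *m y)) 0.
  by rewrite mulr_ge0 ?frobenius_ge0.
rewrite mulrCA ler_pM2l//; by rewrite lt_neqAle frobenius_ge0 eq_sym f0.
Qed.

End Dot.

(** * Spectral decomposition of a spiked matrix *)

Section Spectral.
Context {R : realType}.

Lemma mulmx_trmx_eq0 p q (X : 'M[R]_(p, q)) : X^T *m X = 0 -> X = 0.
Proof.
move=> h; apply/matrixP => i j; rewrite mxE.
have c0 : nsq (col j X) = 0.
  have -> : nsq (col j X) = (X^T *m X) j j.
    by rewrite mxE; apply: eq_bigr => k _; rewrite !mxE.
  by rewrite h mxE.
by have /(congr1 (fun v : 'cV[R]_p => v i 0)) := nsq_eq0 c0; rewrite !mxE.
Qed.

(** A symmetric matrix has no nilpotent part: the Gram matrix of S^(k+1) B equals B^T S^k S^(k+2) B,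
    so one power can be removed at a time. This strips the multiplicities from the Cayley-Hamilton
    identity. *)
Lemma sym_exp_ker p (S : 'M[R]_p.+1) (k : nat) q (B : 'M[R]_(p.+1, q)) :
  S^T = S -> S ^+ k.+1 *m B = 0 -> S *m B = 0.
Proof.
move=> Ss; elim: k => [|k IH]; first by rewrite expr1.
rewrite exprSr => h; apply: IH; apply: mulmx_trmx_eq0.
have SkT : (S ^+ k.+1)^T = S ^+ k.+1.
  elim: (k.+1) => [|j IHj]; first by rewrite !expr0 trmx1.
  by rewrite exprS trmx_mul IHj Ss -exprS exprSr.
have e : S ^+ k.+1 * S ^+ k.+1 = S ^+ k * (S ^+ k.+1 * S).
  by rewrite -exprSr -!exprD addSnnS.
rewrite trmx_mul SkT mulmxA -(mulmxA B^T) (e : _ *m _ = _ *m (_ *m _)).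
by rewrite -!mulmxA (mulmxA (S ^+ k.+1)) h !mulmx0.
Qed.

(* Two evaluations of the determinant of the block matrix [B] by Schur
   complements. *)
Lemma char_poly_deflate p r (Sigma : 'M[R]_p) (L : 'rV[R]_r) (U : 'M[R]_(p, r)) :
    Sigma^T = Sigma -> orthonormal_cols U -> Sigma *m U = U *m diag_mx L ->
  'X^r * char_poly Sigma =
  char_poly (Sigma - U *m diag_mx L *m U^T) * \prod_i ('X - (L 0 i)%:P).
Proof.
move=> Ss UU SU; set M := Sigma - _.
pose cp m n (A : 'M[R]_(m, n)) : 'M[{poly R}]_(m, n) := map_mx polyC A.
have cpM m n k (A : 'M[R]_(m, n)) (B : 'M[R]_(n, k)) : cp _ _ (A *m B) = cp _ _ A *m cp _ _ B.
  by rewrite /cp map_mxM.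
set Up := cp _ _ U; set Lp := cp _ _ (diag_mx L).
have MS : 'X%:M - cp _ _ Sigma = ('X%:M - cp _ _ M) - Up *m (Lp *m Up^T).
  by rewrite /M /cp map_mxB -/(cp _ _ Sigma) !map_mxM -map_trmx mulmxA -/Up -/Lp
       opprB addrAC addrA addrNK.
have UM : Up^T *m ('X%:M - cp _ _ M) = 'X *: Up^T.
  rewrite mulmxBr mul_mx_scalar [Up^T]map_trmx -cpM.
  suff -> : U^T *m M = 0 by rewrite /cp map_mx0 subr0.
  rewrite /M mulmxBr !mulmxA UU mul1mx -[X in X - _]trmxK trmx_mul trmxK Ss SU.
  by rewrite trmx_mul tr_diag_mx subrr.
have UUp : Up^T *m Up = 1%:M by rewrite [Up^T]map_trmx -cpM UU /cp map_mx1.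
have dX : \det ('X%:M - Lp) = \prod_i ('X - (L 0 i)%:P).
  have -> : 'X%:M - Lp = diag_mx (\row_i ('X - (L 0 i)%:P)).
    apply/matrixP => i j; rewrite !mxE; case: eqP => [->|]; rewrite ?mulr1n ?mulr0n//.
    by rewrite polyC0 subr0.
  by rewrite det_diag; apply: eq_bigr => i _; rewrite mxE.
pose B := block_mx ('X%:M - cp _ _ M) Up (Lp *m Up^T) (1%:M : 'M[{poly R}]_r).
have detB : \det B = char_poly Sigma.
  rewrite /char_poly /char_poly_mx -/(cp _ _ Sigma) MS.
  have -> : B = block_mx (1%:M) Up 0 1%:M *m
      block_mx ('X%:M - cp _ _ M - Up *m (Lp *m Up^T)) 0 (Lp *m Up^T) 1%:M.
    by rewrite mulmx_block !mul0mx !mulmx0 !mul1mx !mulmx1 !add0r subrK.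
  by rewrite det_mulmx det_ublock det_lblock !det1 !mulr1 mul1r.
have h : block_mx (1%:M : 'M[{poly R}]_p) 0 (- (Lp *m Up^T)) 'X%:M *m B =
         block_mx ('X%:M - cp _ _ M) Up 0 ('X%:M - Lp).
  rewrite /B mulmx_block !mul0mx !mul1mx !addr0 !mulNmx -!mulmxA UM UUp !mulmx1.
  congr (block_mx _ _ _ _); last by rewrite addrC.
  by rewrite mul_scalar_mx -!scalemxAr addNr.
have := congr1 determinant h; rewrite det_mulmx detB det_lblock det1 mul1r.
by rewrite det_scalar det_ublock dX => ->.
Qed.

Lemma trace_has_spectrum p (Sigma : 'M[R]_p) (s : seq R) :
  (0 < p)%N -> size s = p -> has_spectrum Sigma s -> \tr Sigma = \sum_(a <- s) a.
Proof.
move=> p0 ss h; apply: oppr_inj; rewrite -char_poly_trace// h.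
by rewrite -coefPn_prod_XsubC ?ss//; case: (p) p0.
Qed.

(** Subtracting the [r] known eigendirections leaves a symmetric [M] with characteristic polynomial
    X^r (X - mu)^(p-r). Hence M^2 = mu M, and a trace comparison identifies [M] with [mu] times the
    projection orthogonal to [U]. *)
Lemma spiked_decomposition p r (Sigma : 'M[R]_p) (lam : r.-tuple R) (mu : R)
    (U : 'M[R]_(p, r)) :
    Sigma^T = Sigma -> spiked_scatter Sigma lam mu U ->
  Sigma = mu%:M + U *m diag_mx (\row_j (tnth lam j - mu)) *m U^T.
Proof.
move=> Ss [rp spec _ _ _ UU SU].
set L := \row_j tnth lam j in SU.
have p0 : (0 < p)%N by exact: leq_ltn_trans rp.
have lamE : \prod_(a <- lam) ('X - a%:P) = \prod_i ('X - (L 0 i)%:P) :> {poly R}.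
  by rewrite big_tuple; apply: eq_bigr => i _; rewrite mxE.
have [M ME] : exists M, M = Sigma - U *m diag_mx L *m U^T by eexists.
have Ms : M^T = M.
  by rewrite ME linearB/= Ss !trmx_mul trmxK tr_diag_mx mulmxA.
have cM : char_poly M = 'X^r * ('X - mu%:P) ^+ (p - r).
  have := char_poly_deflate Ss UU SU; rewrite -ME.
  rewrite spec big_cat/= big_nseq -lamE -Monoid.iteropE/= mulrCA [LHS]mulrC => /mulIf ->//.
  by rewrite prodf_seq_neq0; apply/allP => a _ /=; rewrite polyXsubC_eq0.
have trM : \tr M = (p - r)%:R * mu.
  have ss : size (lam ++ nseq (p - r) mu) = p.
    by rewrite size_cat size_tuple size_nseq subnKC// ltnW.
  rewrite ME linearB/= (trace_has_spectrum p0 ss spec) -mulmxA mxtrace_mulC -mulmxA UU mulmx1.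
  have sL : \sum_(a <- lam) a = \sum_i L 0 i.
    by rewrite big_tuple; apply: eq_bigr => i _; rewrite mxE.
  rewrite mxtrace_diag big_cat/= sL addrAC subrr add0r big_nseq.
  by rewrite iter_addr_0 mulr_natl.
have M2 : M *m M = mu *: M.
  case: p p0 rp Sigma Ss spec U UU SU M ME Ms cM trM => // p _ rp Sigma Ss _ U _ _ M _ Ms cM _.
  have := Cayley_Hamilton M; rewrite cM rmorphM !rmorphXn/= rmorphB/= horner_mx_X horner_mx_C.
  have -> : (p.+1 - r)%N = (p - r).+1 by lia.
  move=> CH.
  have h1 : (M - mu%:M) ^+ (p - r).+1 *m M = 0.
    have c : GRing.comm M ((M - mu%:M) ^+ (p - r).+1).
      by apply: commrX; apply: commrB => //; apply: scalar_mxC.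
    (* For r = 0 Cayley-Hamilton already annihilates the power of M - mu; for r > 0 the factor M^r
       is reduced to [M]. *)
    rewrite -[_ *m M]c; case: (r) CH => [|k].
      by rewrite expr0 mul1r => ->; rewrite mulr0.
    exact: sym_exp_ker.
  have h2 : (M - mu%:M) *m M = 0.
    by apply: sym_exp_ker h1; rewrite linearB/= Ms tr_scalar_mx.
  by move: h2; rewrite mulmxBl mul_scalar_mx => /eqP; rewrite subr_eq0 => /eqP.
have [Q QE] : exists Q, Q = 1%:M - U *m U^T by eexists.
have UMT : U^T *m M = 0.
  rewrite ME mulmxBr !mulmxA UU mul1mx -[X in X - _]trmxK trmx_mul trmxK Ss SU.
  by rewrite trmx_mul tr_diag_mx subrr.
have QM : Q *m M = M by rewrite QE mulmxBl mul1mx -mulmxA UMT mulmx0 subr0.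
have MU : M *m U = 0 by rewrite -[LHS]trmxK trmx_mul Ms UMT trmx0.
have MQ : M *m Q = M by rewrite QE mulmxBr mulmx1 mulmxA MU mul0mx subr0.
have QQ : Q *m Q = Q.
  rewrite {1}QE mulmxBl mul1mx QE !mulmxBr !mulmx1 -mulmxA (mulmxA _ U) UU mul1mx.
  by rewrite subrr subr0.
(* [N] is symmetric with N^2 = mu N, so its squared Frobenius norm is mu tr N, which is 0 because mu
   Q and M both have trace (p - r) mu. *)
pose N := mu *: Q - M.
have NT : N^T = N.
  by rewrite /N linearB/= linearZ/= Ms QE linearB/= trmx1 trmx_mul trmxK.
have NN : N *m N = mu *: N.
  rewrite /N mulmxBl !mulmxBr -!scalemxAl -!scalemxAr QQ QM MQ M2.
  by rewrite subrr subr0 scalerBr.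
have N0 : N = 0.
  have t0 : \tr (N^T *m N) = 0.
    rewrite NT NN mxtraceZ /N linearB/= mxtraceZ trM QE linearB/= mxtrace1.
    rewrite mxtrace_mulC UU mxtrace1 natrB ?(ltnW rp)//.
    by ring.
  apply/matrixP => a b; rewrite mxE.
  move: t0; rewrite -frobenius_tr frobenius_col => /eqP.
  rewrite psumr_eq0; last by move=> *; exact: nsq_ge0.
  move=> /allP/(_ b (mem_index_enum _))/eqP/nsq_eq0/(congr1 (fun v : 'cV[R]_p => v a 0)).
  by rewrite !mxE.
have dE : diag_mx (\row_j (tnth lam j - mu)) = diag_mx L - mu%:M.
  apply/matrixP => i j; rewrite !mxE; case: (i == j); rewrite ?mulr1n ?mulr0n ?subr0//.
move/eqP: N0; rewrite subr_eq0 => /eqP; rewrite ME => h.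
rewrite -[LHS](subrK (U *m diag_mx L *m U^T)) -h dE mulmxBr mulmxBl mul_mx_scalar -scalemxAl.
by rewrite QE scalerBr scalemx1 -addrA [- _ + _]addrC.
Qed.

End Spectral.

(** * The perturbed shifted power step *)

Section Subspace_step.
Context {R : realType}.

Definition coproj {p r : nat} (U : 'M[R]_(p, r)) : 'M[R]_p := 1%:M - U *m U^T.

Lemma coproj_tr p r (U : 'M[R]_(p, r)) : (coproj U)^T = coproj U.
Proof. by rewrite /coproj linearB/= trmx1 trmx_mul trmxK. Qed.

Lemma coproj_mulU p r (U : 'M[R]_(p, r)) : orthonormal_cols U -> coproj U *m U = 0.
Proof. by move=> h; rewrite /coproj mulmxBl mul1mx -mulmxA h mulmx1 subrr. Qed.

Lemma coproj_idem p r (U : 'M[R]_(p, r)) :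
  orthonormal_cols U -> coproj U *m coproj U = coproj U.
Proof.
by move=> h; rewrite {2}/coproj mulmxBr mulmx1 mulmxA coproj_mulU// mul0mx subr0.
Qed.

Lemma nsq_coproj p r (U : 'M[R]_(p, r)) (y : 'cV[R]_p) : orthonormal_cols U ->
  nsq y = nsq (U^T *m y) + nsq (coproj U *m y).
Proof.
move=> h; rewrite (nsq_mulmx (coproj U)) coproj_tr coproj_idem// nsq_mulmx trmxK.
by rewrite -dotDr -mulmxDl /coproj addrC subrK mul1mx.
Qed.

Lemma frobenius_coproj p r (U : 'M[R]_(p, r)) (y : 'cV[R]_p) :
  orthonormal_cols U -> frobenius (coproj U *m y) <= frobenius y.
Proof.
move=> h; rewrite frobenius_le ?frobenius_ge0// frobenius_cV (nsq_coproj y h).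
by rewrite lerDr nsq_ge0.
Qed.

Lemma frobenius_trmul p r (U : 'M[R]_(p, r)) (y : 'cV[R]_p) :
  orthonormal_cols U -> frobenius (U^T *m y) <= frobenius y.
Proof.
move=> h; rewrite frobenius_le ?frobenius_ge0// frobenius_cV (nsq_coproj y h).
by rewrite lerDl nsq_ge0.
Qed.

Lemma trace_coproj p r (V : 'M[R]_(p, r)) : orthonormal_cols V ->
  \tr (coproj V) = p%:R - r%:R.
Proof. by move=> h; rewrite /coproj linearB/= mxtrace1 mxtrace_mulC h mxtrace1. Qed.

Lemma dot_delta p (M : 'M[R]_p) j :
  dot (delta_mx j 0) (M *m delta_mx j 0) = M j j.
Proof.
rewrite -colE /dot (bigD1 j)//= big1 ?addr0; first by rewrite !mxE !eqxx mul1r.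
by move=> i ij; rewrite mxE (negbTE ij) mul0r.
Qed.

Lemma nsq_colE p r (M : 'M[R]_(p, r)) j : nsq (col j M) = (M^T *m M) j j.
Proof. by rewrite mxE nsqE; apply: eq_bigr => i _; rewrite !mxE expr2. Qed.

(** The trace is the sum of the form of [E] over the columns of the projection, whose squared norms
    add up to its rank p - r. Averaging over p - r therefore costs no dimension factor in the
    shift. *)
Lemma trace_mul_coproj p r (V : 'M[R]_(p, r)) (E : 'M[R]_p) (e : R) :
    orthonormal_cols V -> (forall v, `|dot v (E *m v)| <= e * nsq v) ->
  `|\tr (E *m coproj V)| <= e * (p%:R - r%:R).
Proof.
move=> h Eq; have CC := coproj_idem h; have CT := coproj_tr V.
rewrite -(trace_coproj h); move: (coproj V) CC CT => C CC CT.
have -> : \tr (E *m C) = \sum_j dot (col j C) (E *m col j C).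
  rewrite -{1}CC mulmxA mxtrace_mulC mulmxA.
  by apply: eq_bigr => j _; rewrite colE dot_mulmxl CT !mulmxA dot_delta.
have -> : \tr C = frobenius C ^+ 2 by rewrite frobenius_tr CT CC.
rewrite frobenius_col mulr_sumr.
by apply: (le_trans (ler_norm_sum _ _ _)); apply: ler_sum => j _.
Qed.

(** The trace equals the sum of D_j |C u_j|^2 with C the projection, and each |C u_j| is at most 1.
    The bound is free of p, so division by p - r leaves an O(1/p) effect on the shift. *)
Lemma trace_spike_coproj p r (U V : 'M[R]_(p, r)) (D : 'rV[R]_r) (L : R) :
    orthonormal_cols U -> orthonormal_cols V -> (forall j, 0 <= D 0 j <= L) ->
  0 <= \tr (U *m diag_mx D *m U^T *m coproj V) <= r%:R * L.
Proof.
move=> hU hV DL; have CC := coproj_idem hV; have CT := coproj_tr V.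
have Cle := fun y => frobenius_coproj y hV; move: (coproj V) CC CT Cle => C CC CT Cle.
have -> : \tr (U *m diag_mx D *m U^T *m C) = \sum_j D 0 j * nsq (col j (C *m U)).
  rewrite -{1}CC -!mulmxA mxtrace_mulC -!mulmxA.
  apply: eq_bigr => j _; rewrite mul_diag_mx mxE.
  by rewrite nsq_colE trmx_mul CT !mulmxA.
have cU j : nsq (col j (C *m U)) <= 1.
  rewrite colE -mulmxA -colE -frobenius_cV expr_le1 ?frobenius_ge0//.
  apply: (le_trans (Cle _)); rewrite -(@expr_le1 _ 2) ?frobenius_ge0//.
  by rewrite frobenius_cV nsq_colE hU mxE eqxx.
apply/andP; split.
  by apply: sumr_ge0 => j _; rewrite mulr_ge0 ?nsq_ge0//; case/andP: (DL j).
apply: (@le_trans _ _ (\sum_(j < r) L)); last by rewrite sumr_const card_ord mulr_natl.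
apply: ler_sum => j _; have /andP[d0 dL] := DL j.
by rewrite (le_trans _ dL)// ler_piMr.
Qed.

(* The orthogonal complement of [U] sees only the perturbation [e'], while the
   signal directions are expanded by [eta]. *)
Lemma subspace_step p r (U V Q : 'M[R]_(p, r)) (D : 'rV[R]_r) (E : 'M[R]_p)
    (g mu L dl e c e' eta : R) :
    (r < p)%N -> orthonormal_cols U -> orthonormal_cols V ->
    E^T = E -> 0 <= e -> (forall v, `|dot v (E *m v)| <= e * nsq v) ->
    0 <= g <= 1 -> 0 <= dl -> (forall j, dl <= D 0 j <= L) ->
    0 <= c <= 1 ->
    (forall x : 'cV[R]_r, frobenius (coproj U *m (V *m x)) <= c * frobenius x) ->
    e' = 2 * e + r%:R * L / (p%:R - r%:R) ->
    eta = g * dl * Num.sqrt (1 - c ^+ 2) - e' -> 0 < eta ->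
    let H := g *: (mu%:M + U *m diag_mx D *m U^T) + E in
    is_qr_factor (H *m V - ((p%:R - r%:R)^-1 * \tr (H *m coproj V)) *: V) Q ->
  forall y : 'cV[R]_r, frobenius (coproj U *m (Q *m y)) <= e' / eta * frobenius y.
Proof.
move=> rp hU hV Es e0 Eq /andP[g0 g1] dl0 DL /andP[c0 c1] VU e'E etaE eta0 H [hQ [S [_ GE]]] y.
have pr0 : 0 < (p%:R - r%:R : R) by rewrite subr_gt0 ltr_nat.
set T := U *m diag_mx D *m U^T in H GE.
set s := (_ * \tr (H *m _)) in GE.
(* The part g mu of the shift cancels the isotropic part of the signal exactly. What remains is g T
   V + (E - b) V, and [T] is invisible to [coproj U]. *)
pose b := s - g * mu.
have b_le : `|b| <= e + r%:R * L / (p%:R - r%:R).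
  have D0L j : 0 <= D 0 j <= L.
    by have /andP[h1 ->] := DL j; rewrite (le_trans dl0 h1).
  have /andP[t0 t1] := trace_spike_coproj hU hV D0L.
  have t2 := trace_mul_coproj hV Eq.
  have bE : b = (p%:R - r%:R)^-1 * (g * \tr (T *m coproj V) + \tr (E *m coproj V)).
    rewrite /b /s /H mulmxDl linearD/= -scalemxAl mxtraceZ mulmxDl linearD/=.
    rewrite mul_scalar_mx mxtraceZ trace_coproj//; field.
    by rewrite gt_eqF.
  rewrite bE normrM gtr0_norm ?invr_gt0// mulrC ler_pdivrMr//.
  rewrite mulrDl divfK ?gt_eqF//.
  apply: (le_trans (ler_normD _ _)); rewrite addrC lerD//.
  rewrite ger0_norm; last exact: mulr_ge0.
  by apply: le_trans t1; rewrite ler_piMl.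
pose F := E - b%:M.
have F_le (z : 'cV[R]_p) : frobenius (F *m z) <= e' * frobenius z.
  rewrite /F mulmxBl mul_scalar_mx; apply: (le_trans (frobeniusD _ _)).
  rewrite frobeniusN frobeniusZ e'E.
  have := sym_form_frobenius z Es e0 Eq.
  have := ler_wpM2r (frobenius_ge0 z) b_le; lra.
have rL0 : 0 <= r%:R * L.
  case: (posnP r) => [->|r0]; first by rewrite mul0r.
  have /andP[h1 h2] := DL (Ordinal r0).
  by rewrite mulr_ge0// (le_trans dl0 (le_trans h1 h2)).
have e'0 : 0 <= e'.
  by rewrite e'E addr_ge0 ?divr_ge0 ?(ltW pr0)// mulr_ge0.
have GF : H *m V - s *: V = g *: (T *m V) + F *m V.
  rewrite /H /F /b mulmxDl mulmxBl -scalemxAl mulmxDl !mul_scalar_mx.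
  rewrite scalerDr scalerA scalerBl opprB -!addrA addrC -!addrA; congr (_ + _).
  by rewrite [RHS]addrCA addrA addrC.
have UVx (x : 'cV[R]_r) : Num.sqrt (1 - c ^+ 2) * frobenius x <= frobenius (U^T *m (V *m x)).
  rewrite le_frobenius ?mulr_ge0 ?sqrtr_ge0 ?frobenius_ge0//.
  rewrite exprMn sqr_sqrtr; last by rewrite subr_ge0 expr_le1.
  rewrite mulrBl mul1r frobenius_cV -[X in X - _](nsq_orthonormal x hV).
  rewrite (nsq_coproj _ hU) lerBlDr lerD2l -frobenius_cV.
  rewrite -[leRHS]mulr1 -frobenius_cV -exprMn mulr1.
  by rewrite ler_sqr ?nnegrE ?mulr_ge0 ?frobenius_ge0.
have DU (z : 'cV[R]_r) : dl * frobenius z <= frobenius (diag_mx D *m z).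
  rewrite le_frobenius ?mulr_ge0 ?frobenius_ge0// exprMn frobenius_cV !nsqE mulr_sumr.
  apply: ler_sum => j _; rewrite mul_diag_mx mxE exprMn ler_wpM2r ?sqr_ge0//.
  have /andP[h1 _] := DL j.
  by rewrite ler_sqr ?nnegrE// (le_trans dl0 h1).
(* As [Q] is an isometry, the triangular factor inherits the expansion of the step. With eta > 0
   this makes [S] invertible, so full rank of the factored matrix is a consequence. *)
have Sx (x : 'cV[R]_r) : eta * frobenius x <= frobenius (S *m x).
  rewrite -(frobenius_orthonormal (S *m x) hQ) mulmxA -GE GF.
  apply: le_trans (frobenius_trmul _ hU).
  rewrite mulmxDl mulmxDr -scalemxAl -scalemxAr /T !mulmxA hU mul1mx.
  set z1 := g *: _; set z2 := _ *m x.
  have : frobenius z1 <= frobenius (z1 + z2) + frobenius z2.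
    by have := frobeniusD (z1 + z2) (- z2); rewrite addrK frobeniusN.
  have : frobenius z2 <= e' * frobenius x.
    rewrite /z2 -!mulmxA; apply: (le_trans (frobenius_trmul _ hU)).
    by rewrite -(frobenius_orthonormal x hV).
  have : g * dl * Num.sqrt (1 - c ^+ 2) * frobenius x <= frobenius z1.
    rewrite /z1 frobeniusZ ger0_norm// -!mulrA ler_wpM2l//.
    rewrite -!mulmxA; apply: le_trans (DU _).
    by rewrite ler_wpM2l.
  rewrite etaE; lra.
have Su : S \in unitmx.
  rewrite -unitmx_tr -row_free_unit -kermx_eq0; apply/eqP/row_matrixP => i.
  rewrite row0; set k := row i _.
  have kS : k *m S^T = 0 by apply/sub_kermxP; exact: row_sub.
  have := Sx k^T; rewrite -[S]trmxK -trmx_mul kS trmx0 frobenius_cV0.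
  rewrite pmulr_rle0// => h; apply: trmx_inj; rewrite trmx0.
  by apply: frobenius_cV_eq0; apply/eqP; rewrite eq_le h frobenius_ge0.
pose x := invmx S *m y.
have xE : S *m x = y by rewrite /x mulKVmx.
have hx : frobenius x <= frobenius y / eta.
  by rewrite ler_pdivlMr// mulrC -xE.
have -> : Q *m y = (Q *m S) *m x by rewrite -mulmxA xE.
rewrite -GE GF (mulmxDl _ _ x) mulmxDr -scalemxAl -scalemxAr /T.
rewrite -!mulmxA (mulmxA (coproj U) U) coproj_mulU// mul0mx scaler0 add0r.
apply: (le_trans (frobenius_coproj _ hU)); apply: (le_trans (F_le _)).
by rewrite frobenius_orthonormal// -mulrA ler_wpM2l// mulrC.
Qed.

(* Both projections have rank [r], so their distance is carried entirely by the
   part of [Q] orthogonal to [U]. *)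
Lemma projection_distance p r (U Q : 'M[R]_(p, r)) (t : R) :
    orthonormal_cols U -> orthonormal_cols Q -> 0 <= t ->
    (forall y : 'cV[R]_r, frobenius (coproj U *m (Q *m y)) <= t * frobenius y) ->
  frobenius (Q *m Q^T - U *m U^T) <= Num.sqrt (2 * r%:R) * t.
Proof.
move=> hU hQ t0 h.
rewrite -ler_sqr ?nnegrE ?mulr_ge0 ?frobenius_ge0 ?sqrtr_ge0//.
rewrite frobenius_tr exprMn sqr_sqrtr ?mulr_ge0 ?ler0n//.
have -> : \tr ((Q *m Q^T - U *m U^T)^T *m (Q *m Q^T - U *m U^T)) =
   2 * \tr ((coproj U *m Q)^T *m (coproj U *m Q)).
  have e1 : \tr (Q *m Q^T *m (Q *m Q^T)) = r%:R.
    by rewrite mulmxA -(mulmxA Q) hQ mulmx1 mxtrace_mulC hQ mxtrace1.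
  have e2 : \tr (U *m U^T *m (U *m U^T)) = r%:R.
    by rewrite mulmxA -(mulmxA U) hU mulmx1 mxtrace_mulC hU mxtrace1.
  have e3 : \tr (Q *m Q^T *m (U *m U^T)) = \tr (U *m U^T *m (Q *m Q^T)).
    by rewrite mxtrace_mulC.
  rewrite trmx_mul coproj_tr -mulmxA (mulmxA (coproj U)) coproj_idem//.
  rewrite (mxtrace_mulC Q^T) -mulmxA {1}/coproj (mulmxBl 1%:M) mul1mx.
  rewrite [in RHS]linearB/= (mxtrace_mulC Q Q^T) hQ mxtrace1.
have trB (X Y : 'M[R]_p) : \tr (X - Y) = \tr X - \tr Y by exact: linearB.
  have hT : (Q *m Q^T - U *m U^T)^T = Q *m Q^T - U *m U^T by rewrite linearB/= !trmx_mul !trmxK.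
  rewrite hT mulmxBr !mulmxBl !trB e1 e2 e3.
  ring.
rewrite -frobenius_tr -mulrA ler_pM2l// frobenius_col.
apply: (@le_trans _ _ (\sum_(j < r) t ^+ 2)); last by rewrite sumr_const card_ord mulr_natl.
apply: ler_sum => j _; rewrite -frobenius_cV ler_sqr ?nnegrE ?frobenius_ge0//.
have -> : col j (coproj U *m Q) = coproj U *m (Q *m delta_mx j 0).
  by rewrite mulmxA -colE.
apply: (le_trans (h _)); rewrite ler_piMr// -(@expr_le1 _ 2) ?frobenius_ge0// frobenius_cV.
rewrite nsqE (bigD1 j)//= big1 ?addr0; first by rewrite mxE !eqxx expr1n.
by move=> i ij; rewrite mxE (negbTE ij) expr0n.
Qed.

(** The supremum defining [opnorm] is informative only once its set is known to be bounded; the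
    Frobenius norm provides the bound, by Cauchy-Schwarz on each row. *)
Lemma opnorm_ub1 p q (M : 'M[R]_(p, q)) (v : 'cV[R]_q) :
  frobenius v <= 1 -> frobenius (M *m v) <= opnorm M.
Proof.
have bnd (u : 'cV[R]_q) : frobenius (M *m u) <= frobenius M * frobenius u.
  rewrite frobenius_le ?mulr_ge0 ?frobenius_ge0// exprMn frobenius_sqr frobenius_cV.
  rewrite nsqE mulr_suml; apply: ler_sum => i _.
  have -> : (M *m u) i 0 = dot (row i M)^T u.
    by rewrite mxE; apply: eq_bigr => j _; rewrite !mxE.
  apply: (le_trans (cauchy_schwarz _ _)); rewrite le_eqVlt; apply/orP; left.
  apply/eqP; congr (_ * _); rewrite nsqE; apply: eq_bigr => j _; by rewrite !mxE.
move=> v1; apply: ub_le_sup; last by exists v.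
exists (frobenius M) => _ [z /= z1 <-]; apply: (le_trans (bnd z)).
by rewrite ler_piMr ?frobenius_ge0.
Qed.

Lemma opnorm_ub p q (M : 'M[R]_(p, q)) (v : 'cV[R]_q) :
  frobenius (M *m v) <= opnorm M * frobenius v.
Proof.
have [->|v0] := eqVneq v 0; first by rewrite mulmx0 !frobenius_cV0 mulr0.
have f0 := frobenius_gt0 v0.
have := @opnorm_ub1 p q M ((frobenius v)^-1 *: v).
rewrite -scalemxAr !frobeniusZ ger0_norm ?invr_ge0 ?frobenius_ge0//.
rewrite mulVf ?gt_eqF// => /(_ (lexx _)).
by rewrite mulrC ler_pdivrMr.
Qed.

Lemma opnorm_ge0 p q (M : 'M[R]_(p, q)) : 0 <= opnorm M.
Proof.
have v1 : frobenius (0 : 'cV[R]_q) <= 1 by rewrite frobenius_cV0.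
exact: le_trans (frobenius_ge0 _) (opnorm_ub1 M v1).
Qed.

End Subspace_step.

(** * A lattice net of the unit ball *)

Section Net.
Context {R : realType}.

(* Lattice of mesh [(5 sqrt p)^-1]: rounding moves a vector by at most [1/5]. *)
Definition lattice_point {p : nat} (k : {ffun 'I_p -> 'I_(12 * p).+1}) : 'cV[R]_p :=
  \col_i (((k i)%:R - (6 * p)%:R) / (5 * Num.sqrt p%:R)).

(** With integer offsets m_i = k_i - 6 p the points are m_i / (5 sqrt p), so the cutoff 36 p = 25 p
    (6/5)^2 selects the ball of radius 6/5: the unit ball enlarged by the rounding error. The range
    |m_i| <= 6 p is enough because 5 sqrt p + 1 <= 6 p. *)
Definition lattice_net (p : nat) : {set {ffun 'I_p -> 'I_(12 * p).+1}} :=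
  [set k : {ffun 'I_p -> 'I_(12 * p).+1} | (\sum_i `|(k i : nat) - (6 * p)%N|%N ^ 2 <= 36 * p)%N]%SET.

Lemma natr_absz_sqr (m : int) : (`|m|%N%:R : R) ^+ 2 = m%:~R ^+ 2.
Proof. by rewrite natr_absz intr_norm real_normK// num_real. Qed.

Lemma sum_half_lt m : \sum_(0 <= j < m) (2^-1 : R) ^+ (m - j) <= 1.
Proof.
have -> : \sum_(0 <= j < m) (2^-1 : R) ^+ (m - j) = 1 - 2^-1 ^+ m.
  elim: m => [|m IH]; first by rewrite big_nil expr0 subrr.
  rewrite big_nat_recl// subn0.
  under eq_bigr do rewrite subSS.
  by rewrite IH exprS; lra.
by rewrite gerBl exprn_ge0.
Qed.

Lemma sum_half_ge m n : \sum_(m <= j < m + n) (2^-1 : R) ^+ (j - m) <= 2.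
Proof.
have -> : \sum_(m <= j < m + n) (2^-1 : R) ^+ (j - m) = 2 - 2 * 2^-1 ^+ n.
  elim: n => [|n IH]; first by rewrite addn0 big_geq// expr0 mulr1 subrr.
  by rewrite addnS big_nat_recr ?leq_addr//= IH addKn exprS; lra.
by rewrite gerBl mulr_ge0// exprn_ge0.
Qed.

(** Exponential counting: |m| <= m^2 for integers, so each net point has weight 2^(- sum |m_i|) at
    least 2^(-36 p), while the total weight factors into p geometric sums, each at most 3. *)
Lemma card_lattice_net p : (#|lattice_net p|%:R : R) <= 2 ^+ (36 * p) * 3 ^+ p.
Proof.
pose d (j : 'I_(12 * p).+1) := `|(j : nat) - (6 * p)%N|%N.
pose F (j : 'I_(12 * p).+1) : R := 2^-1 ^+ d j.
have F0 j : 0 <= F j by rewrite exprn_ge0.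
have key : \sum_(k in lattice_net p) (1 : R) <=
    2 ^+ (36 * p) * \prod_(i < p) \sum_j F j.
  rewrite bigA_distr_bigA/= mulr_sumr [leLHS]big_mkcond/=.
  apply: ler_sum => k _; case: ifPn => [|_]; last first.
    by rewrite mulr_ge0 ?exprn_ge0// prodr_ge0.
  rewrite inE => hk.
  have -> : \prod_i F (k i) = 2^-1 ^+ (\sum_i d (k i)).
    by rewrite (big_morph (fun n => (2^-1 : R) ^+ n) (exprD _) (expr0 _)).
  rewrite exprVn ler_pdivlMr ?exprn_gt0// mul1r ler_weXn2l ?ler1n//.
  apply: leq_trans hk; apply: leq_sum => i _; rewrite /d.
  by case: (absz _) => // n; rewrite expnS expn1 leq_pmulr.
have F3 : \sum_j F j <= 3.
  rewrite /F /d -(big_mkord predT (fun j : nat => (2^-1 : R) ^+ `|j - (6 * p)%N|%N)).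
  rewrite (@big_cat_nat _ _ _ (6 * p))//=; last by lia.
  have -> : (12 * p).+1 = (6 * p + (6 * p).+1)%N by lia.
  have h1 := sum_half_lt (6 * p); have h2 := sum_half_ge (6 * p) (6 * p).+1.
  rewrite (_ : 3 = 1 + 2); last by ring.
  apply: lerD.
    apply: le_trans h1; rewrite le_eqVlt; apply/orP; left; apply/eqP.
    by apply: eq_big_nat => j hj; congr (_ ^+ _); lia.
  apply: le_trans h2; rewrite le_eqVlt; apply/orP; left; apply/eqP.
  by apply: eq_big_nat => j hj; congr (_ ^+ _); lia.
rewrite sumr_const in key; apply: (le_trans key); rewrite ler_wpM2l ?exprn_ge0//.
rewrite prodr_const card_ord; apply: lerXn2r; rewrite ?nnegrE//.
by apply: sumr_ge0.
Qed.

Lemma nsq_le_coord p (v : 'cV[R]_p) (h : R) :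
  (forall i, `|v i 0| <= h) -> nsq v <= p%:R * h ^+ 2.
Proof.
move=> hv; rewrite nsqE; apply: (@le_trans _ _ (\sum_(i < p) h ^+ 2)).
  apply: ler_sum => i _; rewrite -(real_normK (num_real _)).
  by rewrite lerXn2r ?nnegrE// (le_trans (normr_ge0 _) (hv i)).
by rewrite sumr_const card_ord mulr_natl.
Qed.

(** Rounding each coordinate down moves it by at most the mesh, hence the vector by at most sqrt p /
    (5 sqrt p) = 1/5. *)
Lemma lattice_round p (v : 'cV[R]_p) : (0 < p)%N -> frobenius v <= 1 ->
  exists2 k, k \in lattice_net p & frobenius (v - lattice_point k) <= 5^-1.
Proof.
move=> p0 v1; set q : R := 5 * Num.sqrt p%:R.
have sp1 : 1 <= Num.sqrt p%:R :> R by rewrite -{1}(sqrtr1 R) ler_wsqrtr// ler1n.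
have spp : Num.sqrt p%:R <= p%:R :> R.
  have := sqr_sqrtr (ler0n R p); set s := Num.sqrt _ in sp1 * => <-.
  by rewrite expr2 ler_peMl// (le_trans ler01).
have sps : Num.sqrt p%:R ^+ 2 = p%:R :> R by rewrite sqr_sqrtr.
have q0 : 0 < q by rewrite /q; lra.
have vi i : `|v i 0| <= 1.
  rewrite -(@expr_le1 _ 2)// real_normK ?num_real//.
  apply: (@le_trans _ _ (nsq v)); last by rewrite -frobenius_cV expr_le1 ?frobenius_ge0.
  by rewrite nsqE (bigD1 i)//= lerDl sumr_ge0// => *; exact: sqr_ge0.
pose a i : int := Num.floor (q * v i 0).
have a1 i : (a i)%:~R <= q * v i 0 :> R by exact: floor_le_tmp.
have a2 i : q * v i 0 < (a i)%:~R + 1 :> R by rewrite -intrD1 floorD1_gt.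
have ab i : - (6 * p)%:R <= ((a i)%:~R : R) <= (6 * p)%:R.
  have := vi i; rewrite ler_norml => /andP[v1' v2'].
  have := a1 i; have := a2 i; rewrite natrM.
  have : q * v i 0 <= q by rewrite ler_piMr// ltW.
  have : - q <= q * v i 0 by rewrite -mulrN1 ler_wpM2l// ltW.
  by move: spp sp1; rewrite /q => *; apply/andP; split; lra.
have ab' i : (- (6 * p)%N%:Z <= a i <= (6 * p)%N%:Z).
  by have := ab i; rewrite -!(ler_int R) intrN.
have kb i : (absz (a i + (6 * p)%N%:Z)%R < (12 * p).+1)%N by have := ab' i; lia.
pose k : {ffun 'I_p -> 'I_(12 * p).+1} := [ffun i => Ordinal (kb i)].
have kE i : (k i : nat)%:Z - (6 * p)%N%:Z = a i.
  by rewrite ffunE /=; have := ab' i; lia.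
have kER i : (k i)%:R - (6 * p)%:R = (a i)%:~R :> R.
  by rewrite -kE intrB.
have close : frobenius (v - lattice_point k) <= 5^-1.
  rewrite frobenius_le//.
  apply: (le_trans (@nsq_le_coord _ _ q^-1 _)).
    move=> i; rewrite !mxE kER -/q -[v i 0](mulfK (lt0r_neq0 q0)) -mulrBl normrM.
    rewrite [X in _ * X]ger0_norm ?invr_ge0 ?(ltW q0)// ler_piMl ?invr_ge0 ?(ltW q0)//.
    by have := a1 i; have := a2 i; rewrite mulrC ler_norml => *; apply/andP; split; lra.
  rewrite /q exprVn exprMn sps invfM mulrCA divff ?pnatr_eq0 -?lt0n// mulr1.
  by rewrite exprVn.
exists k => //; rewrite inE -(ler_nat R) natr_sum.
have x1 : frobenius (lattice_point k) <= 6 / 5.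
  have := frobeniusD v (lattice_point k - v).
  by rewrite addrC subrK -opprB frobeniusN; lra.
have -> : (36 * p)%:R = q ^+ 2 * (6 / 5) ^+ 2 :> R.
  by rewrite /q exprMn sps natrM; field.
apply: (@le_trans _ _ (q ^+ 2 * nsq (lattice_point k))); last first.
  by rewrite ler_wpM2l ?sqr_ge0// -frobenius_le//; lra.
rewrite nsqE mulr_sumr; apply: ler_sum => i _.
rewrite mxE -/q -exprMn mulrC divfK ?gt_eqF// kER -kE.
by rewrite natrX natr_absz_sqr.
Qed.

(** For a net point x near v, symmetry gives v.Ev = x.Ex + (v - x).E(v + x) with |v - x| <= 1/5 and
    |v + x| <= 11/5. The supremum B over the unit ball thus satisfies B <= dl + 11/25 B, whence B <=
    25/14 dl <= 2 dl. *)
Lemma lattice_net_form p (E : 'M[R]_p) (dl : R) : (0 < p)%N -> E^T = E ->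
    (forall k, k \in lattice_net p ->
       `|dot (lattice_point k) (E *m lattice_point k)| <= dl) ->
  forall v : 'cV[R]_p, `|dot v (E *m v)| <= 2 * dl * nsq v.
Proof.
move=> p0 Es hk.
pose S := [set `|dot v (E *m v)| | v in [set v : 'cV[R]_p | frobenius v <= 1]].
have ubS : has_ubound S.
  exists (opnorm E) => _ [v /= v1 <-]; apply: (le_trans (dot_le_frobenius _ _)).
  apply: le_trans (opnorm_ub1 E v1).
  by rewrite ler_piMl ?frobenius_ge0.
have Sb (v : 'cV[R]_p) : frobenius v <= 1 -> `|dot v (E *m v)| <= sup S.
  by move=> v1; apply: ub_le_sup => //; exists v.
have homog e : (forall v : 'cV[R]_p, frobenius v <= 1 -> `|dot v (E *m v)| <= e) ->
    forall v : 'cV[R]_p, `|dot v (E *m v)| <= e * nsq v.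
  move=> he v; have [->|v0] := eqVneq v 0; first by rewrite dot0l normr0 nsq0 mulr0.
  have f0 := frobenius_gt0 v0.
  have := he ((frobenius v)^-1 *: v).
  rewrite frobeniusZ ger0_norm ?invr_ge0 ?frobenius_ge0// mulVf ?gt_eqF//.
  move=> /(_ (lexx _)); rewrite -scalemxAr dotZl dotZr mulrA -expr2 normrM.
  rewrite ger0_norm ?sqr_ge0// exprVn mulrC ler_pdivrMr ?exprn_gt0//.
  by rewrite frobenius_cV.
have step (v : 'cV[R]_p) : frobenius v <= 1 -> `|dot v (E *m v)| <= dl + 11 / 25 * sup S.
  move=> v1; have [k kN] := lattice_round p0 v1; have := hk _ kN.
  set x := lattice_point k => xE xv.
  have -> : dot v (E *m v) = dot x (E *m x) + dot (v - x) (E *m (v + x)).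
    rewrite mulmxDr dotBl !dotDr.
    have -> : dot v (E *m x) = dot x (E *m v) by rewrite dot_mulmxr Es dotC.
    ring.
  apply: (le_trans (ler_normD _ _)); apply: lerD => //.
  apply: (le_trans (sym_form_bilinear _ _ Es (homog _ Sb))).
  have B0 : 0 <= sup S.
    apply: le_trans (Sb 0 _); first exact: normr_ge0.
    by rewrite frobenius_cV0.
  rewrite mulrC ler_wpM2r//.
  have vx : frobenius (v + x) <= 11 / 5.
    have := frobeniusD (v + v) (x - v); rewrite -opprB frobeniusN.
    have := frobeniusD v v.
    have -> : v + v - (v - x) = v + x by rewrite opprB addrCA addrK addrC.
    by lra.
  have -> : 11 / 25 = 5^-1 * (11 / 5) :> R by field.
  by rewrite ler_pM ?frobenius_ge0.
have Sle : sup S <= dl + 11 / 25 * sup S.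
  apply: ge_sup; first by exists `|dot (0 : 'cV[R]_p) (E *m 0)|; exists 0 => //=; rewrite frobenius_cV0.
  by move=> _ [v v1 <-]; exact: step.
have dl0 : 0 <= dl.
  have [k kN _] := @lattice_round p 0 p0 (eq_ind_r (fun z => z <= 1) ler01 (frobenius_cV0 p)).
  exact: le_trans (normr_ge0 _) (hk _ kN).
apply: homog => v v1; apply: (le_trans (Sb v v1)); lra.
Qed.

(** The radius 6/5 gives 36/25; the rounder 2 is what the constants below are built on. *)
Lemma nsq_lattice_net p k : (0 < p)%N -> k \in lattice_net p ->
  nsq (lattice_point k) <= 2.
Proof.
move=> p0; rewrite inE => hk.
have hk' : \sum_i ((k i)%:R - (6 * p)%:R : R) ^+ 2 <= (36 * p)%:R.
  move: hk; rewrite -(ler_nat R) natr_sum; apply: le_trans; apply: ler_sum => i _.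
  have -> : (k i)%:R - (6 * p)%:R = ((k i : nat)%:Z - (6 * p)%N%:Z)%:~R :> R by rewrite intrB.
  by rewrite natrX natr_absz_sqr.
rewrite nsqE.
have -> : \sum_i (lattice_point k) i 0 ^+ 2 =
    (25 * p%:R)^-1 * \sum_i ((k i)%:R - (6 * p)%:R : R) ^+ 2.
  rewrite mulr_sumr; apply: eq_bigr => i _.
  by rewrite mxE exprMn exprVn exprMn sqr_sqrtr ?ler0n// mulrC; congr (_^-1 * _); ring.
have p0' : 0 < p%:R :> R by rewrite ltr0n.
rewrite mulrC ler_pdivrMr ?mulr_gt0//; apply: (le_trans hk'); rewrite natrM; lra.
Qed.

End Net.

(** * Borel vectors, bounded expectations and joint laws *)

Section Borel.
Context {R : realType}.

(** An open set is the union of the countably many rational boxes inside it, and the preimage of a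
    box is a finite intersection of coordinate conditions. *)
Lemma random_matrix_borel p d (T : measurableType d) (X : T -> 'cV[R]_p) :
    (forall i, measurable_fun [set: T] (fun w => X w i 0)) ->
  forall B, borel_cV B -> measurable (X @^-1` B).
Proof.
move=> mX; suff h : borel_cV (R:=R) (p:=p) `<=` [set B | measurable (X @^-1` B)] by move=> B /h.
apply: smallest_sub.
  split => [|A /= mA|F mF] /=.
  - by rewrite preimage_set0.
  - by rewrite setTD preimage_setC; exact: measurableC.
  - by rewrite preimage_bigcup; exact: bigcupT_measurable.
move=> B oB /=.
pose box (ce : 'cV[rat]_p * rat) : set 'cV[R]_p :=
  [set x | forall i, `|x i 0 - ratr (ce.1 i 0)| < ratr ce.2].
pose F ce := if pselect (box ce `<=` B) then X @^-1` (box ce) else set0.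
have -> : X @^-1` B = \bigcup_ce F ce.
  apply/seteqP; split=> [w /= Bw|w [ce _]]; last first.
    by rewrite /F; case: pselect => // h /h.
  have /nbhs_ballP[e /= e0 eB] := open_nbhs_nbhs (conj oB Bw).
  have [q /andP[q0 qe]] : exists q : rat, (0 < ratr q :> R) && (ratr q < e / 2).
    have [|q] := @rat_in_itvoo R 0 (e / 2); first by rewrite divr_gt0.
    by rewrite in_itv/= => ?; exists q.
  have hc i : exists c : rat, `|X w i 0 - ratr c| < ratr q.
    have [|c] := @rat_in_itvoo R (X w i 0 - ratr q) (X w i 0 + ratr q).
      by rewrite ltrD2l gtrN.
    rewrite in_itv/= => /andP[c1 c2]; exists c; rewrite distrC ltr_distl.
    by rewrite c1 c2.
  have [c hc'] := choice hc.
  exists (\col_i c i, q) => //; rewrite /F; case: pselect => [_ i|[]].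
    by rewrite mxE.
  move=> x hx; apply: eB; split => // i j; rewrite ord1.
  have := hx i; have := hc' i; rewrite mxE /= /ball/=.
  move=> h1 h2; rewrite -(subrKA (ratr (c i))).
  rewrite -[X in _ + X]opprB (le_lt_trans (ler_normB _ _))//.
  by apply: (lt_le_trans (ltrD h1 h2)); rewrite -mulr2n -(mulr_natr _ 2); move: qe; lra.
apply: countable_bigcupT_measurable; first exact: countableP.
move=> ce; rewrite /F; case: (pselect _) => hB /=; last exact: measurable0.
have -> : X @^-1` box ce =
    \bigcap_(i in [set: 'I_p]) [set w | `|X w i 0 - ratr (ce.1 i 0)| < ratr ce.2].
  by apply/seteqP; split => w /= h i; [move=> _|]; exact: h.
apply: fin_bigcap_measurable => // i _.
have mg : measurable_fun [set: T] (fun w => `|X w i 0 - ratr (ce.1 i 0)|).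
  by apply: measurableT_comp => //; apply: measurable_funB.
have mc : measurable_fun [set: T] (fun=> ratr ce.2 : R) by exact: measurable_cst.
have := measurable_fun_ltr mg mc measurableT (I : measurable [set true]).
by rewrite setTI.
Qed.

(** The column vectors as a measurable type whose measurable sets are those of [borel_cV]; this
    makes laws, products and measurable functions of random vectors available. *)
Definition borel_type (p : nat) := g_sigma_algebraType [set B : set 'cV[R]_p | open B].

Lemma measurable_borel_coord p (i : 'I_p) :
  measurable_fun [set: borel_type p] (fun x : borel_type p => (x : 'cV[R]_p) i 0).
Proof.
apply: (@measurability _ _ (borel_type p) R _ _ _ (RGenOInfty.measurableE R)) => _ [_ [x ->] <-].
rewrite setTI; apply: sub_sigma_algebra => /=.
by apply: open_comp => [y _|]; [exact: coord_continuous|exact: interval_open].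
Qed.

Lemma measurable_to_borel p d (T : measurableType d) (X : T -> 'cV[R]_p) :
    (forall i, measurable_fun [set: T] (fun w => X w i 0)) ->
  measurable_fun [set: T] (X : T -> borel_type p).
Proof. by move=> mX _ B mB; rewrite setTI; exact: random_matrix_borel. Qed.

End Borel.

Section Bounded_measurable.
Context {d : measure_display} {T : measurableType d} {R : realType}.
Variable P : probability T R.

(** The statistics of the proof are normalized, hence bounded, and so are their exponentials. This
    class is stable under all the operations applied to them and makes integrability automatic. *)
Definition bmf (f : T -> R) : Prop :=
  measurable_fun [set: T] f /\ exists M, forall w, `|f w| <= M.

Definition Ex (f : T -> R) : R := \int[P]_w f w.

Lemma bmf_integrable f : bmf f -> P.-integrable [set: T] (EFin \o f).
Proof.
move=> [mf [M hM]]; apply: measurable_bounded_integrable => //.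
  by apply: le_lt_trans (probability_le1 P measurableT) _; rewrite ltry.
by exists M; split; [exact: num_real|move=> N MN w _; exact: le_trans (hM w) (ltW MN)].
Qed.

Lemma bmf_cst c : bmf (fun=> c).
Proof. by split; [exact: measurable_cst|exists `|c|]. Qed.

Lemma bmfD f g : bmf f -> bmf g -> bmf (fun w => f w + g w).
Proof.
move=> [mf [M hM]] [mg [N hN]]; split; first exact: measurable_funD.
by exists (M + N) => w; apply: (le_trans (ler_normD _ _)); exact: lerD.
Qed.

Lemma bmfM f g : bmf f -> bmf g -> bmf (fun w => f w * g w).
Proof.
move=> [mf [M hM]] [mg [N hN]]; split; first exact: measurable_funM.
by exists (M * N) => w; rewrite normrM ler_pM.
Qed.

Lemma bmfZ c f : bmf f -> bmf (fun w => c * f w).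
Proof. by move=> bf; apply: bmfM => //; exact: bmf_cst. Qed.

Lemma bmfB f g : bmf f -> bmf g -> bmf (fun w => f w - g w).
Proof.
move=> bf bg; rewrite (_ : (fun w => _) = (fun w => f w + (-1) * g w)).
  by apply: bmfD => //; exact: bmfZ.
by apply/funext => w; rewrite mulN1r.
Qed.

Lemma bmf_expR f : bmf f -> bmf (fun w => expR (f w)).
Proof.
move=> [mf [M hM]]; split; first exact: measurableT_comp.
exists (expR M) => w; rewrite ger0_norm ?expR_ge0// ler_expR.
exact: le_trans (ler_norm _) (hM w).
Qed.

Lemma bmf_sum (I : Type) (s : seq I) (Q : pred I) (F : I -> T -> R) :
  (forall i, Q i -> bmf (F i)) -> bmf (fun w => \sum_(i <- s | Q i) F i w).
Proof.
move=> bF; elim: s => [|i s IH].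
  by under eq_fun do rewrite big_nil; exact: bmf_cst.
case: (boolP (Q i)) => Qi; last by under eq_fun do rewrite big_cons (negbTE Qi).
under eq_fun do rewrite big_cons Qi.
by apply: bmfD => //; exact: bF.
Qed.

Lemma bmf_prod (I : Type) (s : seq I) (Q : pred I) (F : I -> T -> R) :
  (forall i, Q i -> bmf (F i)) -> bmf (fun w => \prod_(i <- s | Q i) F i w).
Proof.
move=> bF; elim: s => [|i s IH].
  by under eq_fun do rewrite big_nil; exact: bmf_cst.
case: (boolP (Q i)) => Qi; last by under eq_fun do rewrite big_cons (negbTE Qi).
under eq_fun do rewrite big_cons Qi.
by apply: bmfM => //; exact: bF.
Qed.

Lemma bmf_indic A : measurable A -> bmf (\1_A : T -> R).
Proof.
move=> mA; split; first exact: measurable_indic.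
by exists 1 => w; rewrite indicE ger0_norm ?ler0n// lern1 leq_b1.
Qed.

Lemma eq_Ex f g : f =1 g -> Ex f = Ex g.
Proof. by move=> fg; apply: eq_Rintegral. Qed.

Lemma Ex_cst c : Ex (fun=> c) = c.
Proof. by rewrite /Ex Rintegral_cst// [X in fine X]probability_setT mulr1. Qed.

Lemma ExD f g : bmf f -> bmf g -> Ex (fun w => f w + g w) = Ex f + Ex g.
Proof. by move=> bf bg; rewrite /Ex RintegralD//; exact: bmf_integrable. Qed.

Lemma ExZ c f : bmf f -> Ex (fun w => c * f w) = c * Ex f.
Proof. by move=> bf; rewrite /Ex RintegralZl//; exact: bmf_integrable. Qed.

Lemma ExB f g : bmf f -> bmf g -> Ex (fun w => f w - g w) = Ex f - Ex g.
Proof. by move=> bf bg; rewrite /Ex RintegralB//; exact: bmf_integrable. Qed.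

Lemma Ex_sum (I : Type) (s : seq I) (Q : pred I) (F : I -> T -> R) :
    (forall i, Q i -> bmf (F i)) ->
  Ex (fun w => \sum_(i <- s | Q i) F i w) = \sum_(i <- s | Q i) Ex (F i).
Proof.
move=> bF; elim: s => [|i s IH].
  by rewrite big_nil -[RHS]Ex_cst; apply: eq_Ex => w; rewrite big_nil.
rewrite big_cons; case: ifPn => Qi; last first.
  by rewrite -IH; apply: eq_Ex => w; rewrite big_cons (negbTE Qi).
rewrite -IH -ExD; [|exact: bF|exact: bmf_sum].
by apply: eq_Ex => w; rewrite big_cons Qi.
Qed.

Lemma le_Ex f g : bmf f -> bmf g -> (forall w, f w <= g w) -> Ex f <= Ex g.
Proof. by move=> bf bg fg; apply: le_Rintegral => //; exact: bmf_integrable. Qed.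

Lemma Ex_ge0 f : (forall w, 0 <= f w) -> 0 <= Ex f.
Proof. by move=> f0; apply: Rintegral_ge0. Qed.

Lemma Ex_indic A : measurable A -> Ex \1_A = fine (P A).
Proof. by move=> mA; rewrite /Ex /Rintegral integral_indic// setIT. Qed.

(** Adding the correction 1_N (f - g), with [N] the exceptional null set, makes the inequality hold
    everywhere; its expectation is at most M P(N) = 0. *)
Lemma Ex_ae f g : bmf f -> bmf g -> {ae P, forall w, f w <= g w} -> Ex f <= Ex g.
Proof.
move=> bf bg fg.
have [N [mN N0 hN]] := fg.
have h : Ex f <= Ex (fun w => g w + (\1_N w) * (f w - g w)).
  apply: le_Ex => //.
    by apply: bmfD => //; apply: bmfM; [exact: bmf_indic|exact: bmfB].
  move=> w; rewrite indicE; case: (boolP (w \in N)) => wN.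
    by rewrite mul1r addrC subrK.
  rewrite mul0r addr0; apply: contrapT => hw; move/negP: wN; apply.
  by rewrite inE; apply: hN.
apply: (le_trans h); rewrite ExD//; last first.
  by apply: bmfM; [exact: bmf_indic|exact: bmfB].
rewrite gerDl.
have [_ [M hM]] := bmfB bf bg.
apply: (@le_trans _ _ (Ex (fun w => M * \1_N w))).
  apply: le_Ex; [by apply: bmfM; [exact: bmf_indic|exact: bmfB]|by apply: bmfZ; exact: bmf_indic|].
  move=> w; rewrite mulrC; apply: ler_wpM2r; first by rewrite indicE ler0n.
  exact: le_trans (ler_norm _) (hM w).
rewrite ExZ; last exact: bmf_indic.
by rewrite Ex_indic// N0 mulr0.
Qed.

(** Markov's inequality in the form that serves both the Chernoff bound and the union over the
    net. *)
Lemma prob_le_Ex A f : measurable A -> bmf f -> (forall w, 0 <= f w) ->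
  (forall w, A w -> 1 <= f w) -> (P A <= (Ex f)%:E)%E.
Proof.
move=> mA bf f0 Af; rewrite -[P A]fineK; last exact: fin_num_measure.
rewrite lee_fin -Ex_indic//; apply: le_Ex => //; first exact: bmf_indic.
move=> w; rewrite indicE; case: (boolP (w \in A)) => [|_]; last exact: f0.
by rewrite inE => /Af.
Qed.

End Bounded_measurable.

Section Joint_law.
Context {d d1 d2 : measure_display} {T : measurableType d}
  {T1 : measurableType d1} {T2 : measurableType d2} {R : realType}.
Variable P : probability T R.

(** Measurable rectangles form a generating family stable under intersection, so the two pairs have
    the same law. Nonnegativity of [F] suffices, as equal extended integrals have equal real
    parts. *)
Lemma joint_law_eq (X X' : T -> T1) (Y Y' : T -> T2) (F : T1 * T2 -> R) :
    measurable_fun [set: T] X -> measurable_fun [set: T] X' ->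
    measurable_fun [set: T] Y -> measurable_fun [set: T] Y' ->
    (forall A B, measurable A -> measurable B ->
      P (X @^-1` A `&` Y @^-1` B) = P (X' @^-1` A `&` Y' @^-1` B)) ->
    measurable_fun [set: T1 * T2] F -> (forall z, 0 <= F z) ->
  Ex P (fun w => F (X w, Y w)) = Ex P (fun w => F (X' w, Y' w)).
Proof.
move=> mX mX' mY mY' XY mF F0.
have mZ := measurable_fun_pair mX mY; have mZ' := measurable_fun_pair mX' mY'.
pose Z : {mfun T >-> (T1 * T2)%type} := HB.pack (fun w => (X w, Y w)) (isMeasurableFun.Build _ _ _ _ _ mZ).
pose Z' : {mfun T >-> (T1 * T2)%type} := HB.pack (fun w => (X' w, Y' w)) (isMeasurableFun.Build _ _ _ _ _ mZ').
rewrite /Ex /Rintegral; congr fine.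
have mFE : measurable_fun [set: T1 * T2] (fun z => (F z)%:E) by exact/measurable_EFinP.
have FE0 z : (0 <= (F z)%:E)%E by rewrite lee_fin.
rewrite -[LHS](@ge0_integral_distribution _ _ _ _ _ P Z _ mFE FE0).
rewrite -[RHS](@ge0_integral_distribution _ _ _ _ _ P Z' _ mFE FE0).
apply: eq_measure_integral => S mS _.
pose G : set (set (T1 * T2)) := [set A `*` B | A in measurable & B in measurable].
apply: (@measure_unique _ R _ G (fun=> setT)) => //.
- exact: measurable_prod_measurableType.
- move=> _ _ [A1 mA1 [B1 mB1 <-]] [A2 mA2 [B2 mB2 <-]].
  exists (A1 `&` A2); first exact: measurableI.
  by exists (B1 `&` B2); [exact: measurableI|rewrite setXI].
- by move=> _; exists setT => //; exists setT => //; rewrite setXTT.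
- by rewrite bigcup_const//; exists 0%N.
- by move=> _ [A mA [B mB <-]]; exact: XY.
- by move=> _; rewrite /= probability_setT ltry.
Qed.

(** Independence identifies the joint law with the product of the marginal laws, and Tonelli's
    theorem separates the integrals. *)
Lemma indep_ExM (X : T -> T1) (Y : T -> T2) (f : T1 -> R) (g : T2 -> R) :
    measurable_fun [set: T] X -> measurable_fun [set: T] Y ->
    (forall A B, measurable A -> measurable B ->
      P (X @^-1` A `&` Y @^-1` B) = (P (X @^-1` A) * P (Y @^-1` B))%E) ->
    bmf f -> (forall x, 0 <= f x) -> bmf g -> (forall y, 0 <= g y) ->
  Ex P (fun w => f (X w) * g (Y w)) = Ex P (fun w => f (X w)) * Ex P (fun w => g (Y w)).
Proof.
move=> mX mY XY bf f0 bg g0.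
have [mf _] := bf; have [mg _] := bg.
pose X1 : {mfun T >-> T1} := HB.pack X (isMeasurableFun.Build _ _ _ _ _ mX).
pose Y1 : {mfun T >-> T2} := HB.pack Y (isMeasurableFun.Build _ _ _ _ _ mY).
have mZ := measurable_fun_pair mX mY.
pose Z : {mfun T >-> (T1 * T2)%type} := HB.pack (fun w => (X w, Y w)) (isMeasurableFun.Build _ _ _ _ _ mZ).
have bfX : bmf (fun w => f (X w)).
  split; first exact: measurableT_comp.
  by case: bf => _ [M hM]; exists M.
have bgY : bmf (fun w => g (Y w)).
  split; first exact: measurableT_comp.
  by case: bg => _ [M hM]; exists M.
rewrite /Ex /Rintegral -fineM; [|exact: integrable_fin_num (bmf_integrable P bfX)|
  exact: integrable_fin_num (bmf_integrable P bgY)].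
congr fine.
pose F (z : T1 * T2) : \bar R := ((f z.1)%:E * (g z.2)%:E)%E.
have mF : measurable_fun setT F.
  by apply: emeasurable_funM; apply/measurable_EFinP; exact: measurableT_comp.
have F0 z : (0 <= F z)%E by rewrite mule_ge0// lee_fin.
have fE0 x : (0 <= (f x)%:E)%E by rewrite lee_fin.
have gE0 x : (0 <= (g x)%:E)%E by rewrite lee_fin.
have mfE : measurable_fun setT (fun x => (f x)%:E) by exact/measurable_EFinP.
have mgE : measurable_fun setT (fun x => (g x)%:E) by exact/measurable_EFinP.
transitivity (\int[distribution P Z]_z F z)%E.
  by rewrite ge0_integral_distribution.
transitivity (\int[(distribution P X1) \x (distribution P Y1)]_z F z)%E.
  apply: eq_measure_integral => S mS _; apply/esym.
  by apply: product_measure_unique => // A B mA mB; exact: XY.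
rewrite fubini_tonelli1//.
transitivity (\int[distribution P X1]_x ((f x)%:E * \int[distribution P Y1]_y (g y)%:E))%E.
  apply: eq_integral => x _; rewrite /fubini_F /F/=.
  by apply: ge0_integralZl_EFin => //; exact/measurable_EFinP.
rewrite ge0_integralZr//; last exact: integral_ge0.
by rewrite !ge0_integral_distribution.
Qed.

End Joint_law.

(** * Independence of cylinder sigma-algebras *)

Section Pi_system.
Context {d : measure_display} {T : measurableType d} {R : realType}.
Variable P : probability T R.

(** As functions of [A], the two sides are finite measures, a restriction and a rescaling of [P],
    that agree on a pi-system containing the whole space. *)
Lemma pi_system_indep1 (G : set (set T)) (B : set T) :
    setI_closed G -> G `<=` measurable -> G setT -> measurable B ->
    (forall A, G A -> P (A `&` B) = (P A * P B)%E) ->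
  forall A, <<s G >> A -> P (A `&` B) = (P A * P B)%E.
Proof.
move=> GI Gm GT mB GB A sA.
have PB0 : 0 <= fine (P B) by apply: fine_ge0; exact: measure_ge0.
have PBE : P B = (fine (P B))%:E by rewrite fineK//; exact: fin_num_measure.
have h := @g_sigma_algebra_measure_unique d R T G Gm (fun=> setT) (fun=> GT) _
  (mrestr P mB) (mscale (NngNum PB0) P) GI.
have e C : mscale (NngNum PB0) P C = (P C * P B)%E.
  by rewrite /mscale/= -PBE muleC.
rewrite -e; apply: h => //.
- by rewrite bigcup_const//; exists 0%N.
- by move=> C GC; transitivity (P C * P B)%E; [exact: GB|exact/esym/e].
- move=> _; apply: (@le_lt_trans _ _ 1%E); last by rewrite ltry.
  by apply: probability_le1; exact: measurableI.
Qed.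

Lemma pi_system_indep (G1 G2 : set (set T)) :
    setI_closed G1 -> G1 `<=` measurable -> G1 setT ->
    setI_closed G2 -> G2 `<=` measurable -> G2 setT ->
    (forall A B, G1 A -> G2 B -> P (A `&` B) = (P A * P B)%E) ->
  forall A B, <<s G1 >> A -> <<s G2 >> B -> P (A `&` B) = (P A * P B)%E.
Proof.
move=> I1 m1 T1 I2 m2 T2 h A B sA sB.
have sm2 : <<s G2 >> `<=` measurable.
  by apply: smallest_sub => //; exact: sigma_algebra_measurable.
have sm1 : <<s G1 >> `<=` measurable.
  by apply: smallest_sub => //; exact: sigma_algebra_measurable.
apply: (pi_system_indep1 I1 m1 T1 (sm2 _ sB)) => // C GC.
rewrite setIC muleC; apply: (pi_system_indep1 I2 m2 T2 (m1 _ GC)) => // D GD.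
by rewrite setIC muleC; exact: h.
Qed.

(** The identity of [T], read with values in [T] equipped with a smaller sigma-algebra, is a random
    element; this reduces the claim to the product formula for two independent random elements. *)
Lemma sigma_indep_ExM (G1 G2 : set (set T)) (f g : T -> R) :
    G1 `<=` measurable -> G2 `<=` measurable ->
    (forall A B, <<s G1 >> A -> <<s G2 >> B -> P (A `&` B) = (P A * P B)%E) ->
    measurable_fun [set: g_sigma_algebraType G1] (f : g_sigma_algebraType G1 -> R) ->
    measurable_fun [set: g_sigma_algebraType G2] (g : g_sigma_algebraType G2 -> R) ->
    bmf f -> bmf g -> (forall w, 0 <= f w) -> (forall w, 0 <= g w) ->
  Ex P (fun w => f w * g w) = Ex P f * Ex P g.
Proof.
move=> G1m G2m ind mf mg [_ [M hM]] [_ [N hN]] f0 g0.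
have mid G : G `<=` measurable ->
    measurable_fun [set: T] (id : T -> g_sigma_algebraType G).
  move=> Gm _ A sA; rewrite setTI.
  by apply: (smallest_sub (@sigma_algebra_measurable _ T) Gm).
apply: (indep_ExM (mid _ G1m) (mid _ G2m)) => //.
- by split => //; exists M.
- by split => //; exists N.
Qed.

End Pi_system.

Section Cylinders.
Context {d : measure_display} {T : measurableType d} {R : realType}.
Variable P : probability T R.
Context {I : finType} {p : nat}.
Variable X : I -> T -> 'cV[R]_p.
Hypothesis mX : forall i a, measurable_fun [set: T] (fun w => X i w a 0).
Hypothesis indX : mutually_independent P X.

(** Events about the indices in [J], kept as intersections over all of [I] with trivial factors
    outside [J], so that the product rule of the independence assumption applies to them
    directly. *)
Definition cylinders (J : {set I}) : set (set T) :=
  [set A | exists B : I -> set 'cV[R]_p, [/\ forall i, borel_cV (B i),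
     forall i, i \notin J -> B i = setT &
     A = \bigcap_(i in [set: I]) X i @^-1` B i] ].

Lemma borel_setT : borel_cV (R := R) (p := p) setT.
Proof. by apply: sub_sigma_algebra; exact: openT. Qed.

Lemma borel_setI (A B : set 'cV[R]_p) : borel_cV A -> borel_cV B -> borel_cV (A `&` B).
Proof. exact: (@measurableI _ (borel_type p)). Qed.

Lemma cylinders_setI J : setI_closed (cylinders J).
Proof.
move=> _ _ [B [mB BT ->]] [C [mC CT ->]]; exists (fun i => B i `&` C i); split.
- by move=> i; exact: borel_setI.
- by move=> i iJ; rewrite BT// CT// setIT.
- by rewrite -bigcapI; apply: eq_bigcapr => i _; rewrite preimage_setI.
Qed.

Lemma cylinders_setT J : cylinders J setT.
Proof.
exists (fun=> setT); split => //; first by move=> _; exact: borel_setT.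
by rewrite bigcapT// => i _; rewrite preimage_setT.
Qed.

Lemma cylinders_measurable J : cylinders J `<=` measurable.
Proof.
move=> _ [B [mB _ ->]]; apply: fin_bigcap_measurable => // i _.
by apply: random_matrix_borel => // a; exact: mX.
Qed.

Lemma cylinders_indep (J J' : {set I}) : (forall i, i \in J -> i \notin J') ->
  forall A B, cylinders J A -> cylinders J' B -> P (A `&` B) = (P A * P B)%E.
Proof.
move=> dJ _ _ [B [mB BT ->]] [C [mC CT ->]].
rewrite -bigcapI.
have -> : \bigcap_(i in [set: I]) (X i @^-1` B i `&` X i @^-1` C i) =
    \bigcap_(i in [set: I]) X i @^-1` (B i `&` C i).
  by apply: eq_bigcapr => i _; rewrite preimage_setI.
rewrite !indX// ?[in RHS]indX//; last by move=> i; exact: borel_setI.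
rewrite -big_split/=; apply: eq_bigr => i _.
case: (boolP (i \in J)) => iJ.
  have iJ' := dJ _ iJ.
  by rewrite (CT _ iJ') setIT preimage_setT [X in (_ * X)%E]probability_setT mule1.
by rewrite (BT _ iJ) setTI preimage_setT [X in (X * _)%E]probability_setT mul1e.
Qed.

Lemma cylinders_preimage (J : {set I}) i B :
  i \in J -> borel_cV B -> cylinders J (X i @^-1` B).
Proof.
move=> iJ mB; exists (fun j => if j == i then B else setT); split.
- by move=> j; case: eqP => // _; exact: borel_setT.
- by move=> j; case: eqP => // -> /negP.
- apply/seteqP; split => [w Bw j _|w /(_ i Logic.I)]; rewrite /= ?eqxx; last exact.
  by case: eqP => // ->.
Qed.

Lemma pair_indep i j B C : i != j -> borel_cV B -> borel_cV C ->
  P (X i @^-1` B `&` X j @^-1` C) = (P (X i @^-1` B) * P (X j @^-1` C))%E.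
Proof.
move=> ij mB mC; apply: (@cylinders_indep [set i]%SET [set j]%SET).
- by move=> k; rewrite !inE => /eqP ->.
- by apply: cylinders_preimage; rewrite ?inE.
- by apply: cylinders_preimage; rewrite ?inE.
Qed.

Lemma cylinders_coord (J : {set I}) i a : i \in J ->
  measurable_fun [set: g_sigma_algebraType (cylinders J)]
    (fun w : g_sigma_algebraType (cylinders J) => X i w a 0).
Proof.
move=> iJ.
suff mXi : measurable_fun [set: g_sigma_algebraType (cylinders J)]
    (X i : g_sigma_algebraType (cylinders J) -> borel_type p).
  exact: (measurableT_comp (measurable_borel_coord a) mXi).
move=> _ B mB; rewrite setTI; apply: sub_sigma_algebra.
exact: cylinders_preimage.
Qed.

(** The factor of the head pair depends on its two indices, the remaining product on the indices of
    the tail, and uniqueness of the flattened list makes these index sets disjoint. *)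
Lemma Ex_prod_pairs (l : seq (I * I)) (phi : I * I -> 'cV[R]_p -> R) :
    (forall x, bmf (phi x : borel_type p -> R)) -> (forall x v, 0 <= phi x v) ->
    uniq (flatten [seq [:: x.1; x.2] | x <- l]) ->
  Ex P (fun w => \prod_(x <- l) phi x (X x.1 w - X x.2 w)) =
  \prod_(x <- l) Ex P (fun w => phi x (X x.1 w - X x.2 w)).
Proof.
move=> bphi phi0.
have mphi (J : {set I}) x : x.1 \in J -> x.2 \in J ->
    measurable_fun [set: g_sigma_algebraType (cylinders J)]
    (fun w : g_sigma_algebraType (cylinders J) => phi x (X x.1 w - X x.2 w)).
  move=> x1 x2; have [mp _] := bphi x.
  apply: (measurableT_comp mp); apply: measurable_to_borel => a.
  by under eq_fun do rewrite !mxE; apply: measurable_funB; exact: cylinders_coord.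
have bX x : bmf (fun w => phi x (X x.1 w - X x.2 w)).
  have [mp [M hM]] := bphi x; split; last by exists M.
  apply: (measurableT_comp mp); apply: measurable_to_borel => a.
  by under eq_fun do rewrite !mxE; apply: measurable_funB; exact: mX.
elim: l => [_|x l IH]; first by rewrite big_nil; under eq_Ex do rewrite big_nil; exact: Ex_cst.
rewrite [flatten _]/= [uniq _]/= => /and3P[x1 x2 ul].
rewrite big_cons -IH//; under eq_Ex do rewrite big_cons.
pose J := [set x.1; x.2]%SET.
pose J' := [set i in flatten [seq [:: y.1; y.2] | y <- l]]%SET.
have dJ i : i \in J -> i \notin J'.
  rewrite !inE.
  move: x1; rewrite inE negb_or => /andP[_ x1].
  by case/orP => /eqP ->.
apply: (@sigma_indep_ExM _ _ _ P (cylinders J) (cylinders J')).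
- exact: cylinders_measurable.
- exact: cylinders_measurable.
- apply: pi_system_indep; [exact: cylinders_setI|exact: cylinders_measurable|
    exact: cylinders_setT|exact: cylinders_setI|exact: cylinders_measurable|
    exact: cylinders_setT|exact: cylinders_indep].
- by apply: mphi; rewrite !inE eqxx ?orbT.
(* The sigma-algebra of the whole tail stays fixed while the product runs over an arbitrary list
   contained in it. *)
- have : {subset l <= l} by [].
  move: {1 3}l => s; elim: s => [_|y s IHs sl].
    by under eq_fun do rewrite big_nil; exact: measurable_cst.
  under eq_fun do rewrite big_cons; apply: measurable_funM.
    have yl : y \in l by apply: sl; rewrite mem_head.
    by apply: mphi; rewrite inE; apply/flatten_mapP; exists y => //; rewrite !inE eqxx ?orbT.
  by apply: IHs => z zs; apply: sl; rewrite inE zs orbT.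
- exact: bX.
- by apply: bmf_prod => y _; exact: bX.
- by [].
- by move=> w; apply: prodr_ge0.
Qed.

End Cylinders.

(** * Random signs and reflections *)

Section Scalar.
Context {R : realType}.
Implicit Types x y s t : R.

Lemma expR_le_quadratic x : expR x <= 1 + x + x ^+ 2 * expR `|x|.
Proof.
have h1 : expR x * (1 - x) <= 1.
  by rewrite -[leRHS](expRxMexpNx_1 x) ler_wpM2l ?expR_ge0//; exact: (expR_ge1Dx (- _)).
have h : expR x - 1 <= x * expR x by lra.
have [x0|x0] := leP 0 x.
  have : x * (expR x - 1) <= x * (x * expR x) by rewrite ler_wpM2l.
  by rewrite (ger0_norm x0); nra.
have e1 : 1 <= expR `|x| by rewrite -expR0 ler_expR.
have e2 := expR_ge1Dx x.
nra.
Qed.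

Lemma sqr_le_expR x : 0 <= x -> x ^+ 2 <= 2 * expR x.
Proof.
move=> x0; have := expR_ge1Dxn 1 x0; rewrite (_ : 2`! = 2)%N//; lra.
Qed.

(** A crude form of cosh t <= exp(t^2 / 2). For |t| <= 1 the quadratic bound on exp and exp 1 <= 3
    give the constant 3; for |t| > 1 already |t| <= 3 t^2. *)
Lemma cosh_le t : expR t + expR (- t) <= 2 * expR (3 * t ^+ 2).
Proof.
have [t1|t1] := leP `|t| 1.
  have h1 := expR_le_quadratic t; have h2 := expR_le_quadratic (- t).
  rewrite normrN sqrrN in h2.
  have e3 : expR `|t| <= 3.
    apply: (@le_trans _ _ (expR 1)); first by rewrite ler_expR.
    have h : expR (2^-1) * 2^-1 <= 1 :> R.
      by rewrite -[leRHS](expRxMexpNx_1 2^-1) ler_wpM2l ?expR_ge0//; have := expR_ge1Dx (- (2^-1 : R)); lra.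
    have h4 : expR (4^-1) <= 4 / 3 :> R.
      have : expR (4^-1) * (1 - 4^-1) <= 1 :> R.
        by rewrite -[leRHS](expRxMexpNx_1 4^-1) ler_wpM2l ?expR_ge0//; exact: (expR_ge1Dx (- _)).
      lra.
    have h6 : expR (6^-1) <= 6 / 5 :> R.
      have : expR (6^-1) * (1 - 6^-1) <= 1 :> R.
        by rewrite -[leRHS](expRxMexpNx_1 6^-1) ler_wpM2l ?expR_ge0//; exact: (expR_ge1Dx (- _)).
      lra.
    (* exp(1/6) <= 6/5 and (6/5)^6 < 3. *)
    have -> : 1 = 6%:R * 6^-1 :> R by rewrite divff.
    rewrite expRM_natl; apply: (@le_trans _ _ ((6 / 5) ^+ 6)); last by lra.
    by rewrite lerXn2r ?nnegrE ?expR_ge0//; lra.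
  have h3 : 1 + 3 * t ^+ 2 <= expR (3 * t ^+ 2) by exact: expR_ge1Dx.
  have t20 : 0 <= t ^+ 2 by exact: sqr_ge0.
  nra.
have tt : `|t| <= 3 * t ^+ 2.
  rewrite -real_normK ?num_real//; nra.
have : expR t <= expR (3 * t ^+ 2) by rewrite ler_expR (le_trans (ler_norm t)).
have : expR (- t) <= expR (3 * t ^+ 2) by rewrite ler_expR (le_trans (ler_norm (- t)))// normrN.
lra.
Qed.

End Scalar.

(** * Second and exponential moments over uniformly random sign vectors *)

Section Signs.
Context {R : realType} {p : nat}.
Implicit Types (e : {ffun 'I_p -> bool}) (xi : 'cV[R]_p).

Definition sign_vector e : 'cV[R]_p := \col_i (-1) ^+ e i.

Lemma nsq_sign_vector e : nsq (sign_vector e) = p%:R.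
Proof.
rewrite nsqE (eq_bigr (fun=> 1)); first by rewrite sumr_const card_ord.
by move=> i _; rewrite mxE sqrr_sign.
Qed.

Let flip (i : 'I_p) e : {ffun 'I_p -> bool} := [ffun j => (j == i) (+) e j].

Let flipK i : involutive (flip i).
Proof. by move=> e; apply/ffunP => j; rewrite !ffunE addbA addbb. Qed.

(* Pairing each sign pattern with the one flipped at [i] integrates out the sign
   of the coordinate [i]. *)
Lemma sum_signs_flip (i : 'I_p) (F : {ffun 'I_p -> bool} -> R) :
  2 * \sum_e F e = \sum_e (F e + F (flip i e)).
Proof.
rewrite big_split/= mulr_natl mulr2n; congr (_ + _).
by rewrite (reindex_inj (inv_inj (flipK i))).
Qed.

Let S (l : seq 'I_p) xi e : R := \sum_(i <- l) (-1) ^+ e i * xi i 0.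

Let S_flip i l xi e : i \notin l -> S l xi (flip i e) = S l xi e.
Proof.
move=> il; apply: eq_big_seq => j jl; rewrite ffunE.
by case: eqP => // ji; rewrite -ji jl in il.
Qed.

Let S_flip_cons i l xi e : i \notin l ->
  S (i :: l) xi (flip i e) = S l xi e - (-1) ^+ e i * xi i 0.
Proof.
move=> il; rewrite /S big_cons -/(S l xi (flip i e)) S_flip// ffunE eqxx/= signrN.
by rewrite mulNr addrC.
Qed.

Let sum_sq l xi : uniq l ->
  \sum_e S l xi e ^+ 2 = 2 ^+ p * \sum_(i <- l) xi i 0 ^+ 2.
Proof.
elim: l => [_|i l IH /= /andP[il ul]].
  rewrite big_nil mulr0 big1// => e _; by rewrite /S big_nil expr0n.
apply: (@mulfI _ 2) => //; rewrite (sum_signs_flip i) big_cons.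
rewrite (eq_bigr (fun e => 2 * (S l xi e ^+ 2 + xi i 0 ^+ 2))); last first.
  move=> e _; rewrite S_flip_cons// /S big_cons -/(S l xi e).
  have := sqrr_sign R (e i); set c := (-1) ^+ e i => c2.
  transitivity (2 * (S l xi e ^+ 2 + c ^+ 2 * xi i 0 ^+ 2)); first by ring.
  by rewrite c2 mul1r.
rewrite -mulr_sumr big_split/= IH// sumr_const card_ffun card_bool card_ord.
by rewrite -[_ *+ (_ ^ _)%N]mulr_natl natrX; ring.
Qed.

(** Averaging over the sign of one coordinate x leaves a factor exp(s x^2) and, by the cosh bound at
    2 s x y, raises [s] to s' = s + 12 s^2 x^2. The constraint 1/24 keeps 12 (s x^2)(s V) below s
    x^2 / 2: it is therefore inherited by s', and the accumulated increments fit into the factor 2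
    of the exponent. *)
Let sum_exp l xi (s : R) : uniq l -> 0 <= s ->
    s * (\sum_(i <- l) xi i 0 ^+ 2) <= 24^-1 ->
  \sum_e expR (s * S l xi e ^+ 2) <=
  2 ^+ p * expR (2 * s * \sum_(i <- l) xi i 0 ^+ 2).
Proof.
elim: l s => [s _ s0 _|i l IH s /= /andP[il ul] s0].
  rewrite big_nil mulr0 expR0 mulr1 (eq_bigr (fun=> 1)); last first.
    by move=> e _; rewrite /S big_nil expr0n/= mulr0 expR0.
  by rewrite sumr_const card_ffun card_bool card_ord natrX.
rewrite big_cons; set x := xi i 0; set V := \sum_(j <- l) _ => hs.
have V0 : 0 <= V by apply: sumr_ge0 => j _; exact: sqr_ge0.
have x0 : 0 <= x ^+ 2 by exact: sqr_ge0.
pose s' := s + 12 * s ^+ 2 * x ^+ 2.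
have sV : 0 <= s * V by rewrite mulr_ge0.
have sx : 0 <= s * x ^+ 2 by rewrite mulr_ge0.
have s'0 : 0 <= s' by rewrite /s' addr_ge0// mulr_ge0// mulr_ge0// sqr_ge0.
have hprod : 12 * (s * x ^+ 2) * (s * V) <= 2^-1 * (s * x ^+ 2).
  have sV1 : s * V <= 24^-1 by move: hs; rewrite mulrDr; lra.
  have := ler_wpM2l sx sV1; lra.
have s'V : s' * V <= 24^-1.
  have -> : s' * V = s * V + 12 * (s * x ^+ 2) * (s * V) by rewrite /s'; ring.
  by move: hs; rewrite mulrDr; lra.
rewrite -(ler_pM2l (ltr0Sn R 1)) (sum_signs_flip i).
apply: (@le_trans _ _ (\sum_e 2 * expR (s * x ^+ 2) * expR (s' * S l xi e ^+ 2))).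
  apply: ler_sum => e _; rewrite S_flip_cons// /S big_cons -/(S l xi e) -/x.
  have := sqrr_sign R (e i); set c := (-1) ^+ e i => c2; set y := S l xi e.
  have e1 : s * (c * x + y) ^+ 2 = s * x ^+ 2 + s * y ^+ 2 + 2 * s * c * x * y.
    by transitivity (s * (c ^+ 2 * x ^+ 2) + s * y ^+ 2 + 2 * s * c * x * y); [ring|rewrite c2 mul1r].
  have e2 : s * (y - c * x) ^+ 2 = s * x ^+ 2 + s * y ^+ 2 + - (2 * s * c * x * y).
    by transitivity (s * (c ^+ 2 * x ^+ 2) + s * y ^+ 2 + - (2 * s * c * x * y)); [ring|rewrite c2 mul1r].
  rewrite e1 e2 !(expRD (s * x ^+ 2 + _)) -mulrDr.
  have h := cosh_le (2 * s * c * x * y).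
  apply: (le_trans (ler_wpM2l (expR_ge0 _) h)).
  rewrite mulrCA -[leRHS]mulrA ler_pM2l// -!expRD ler_expR le_eqVlt; apply/orP; left.
  apply/eqP; rewrite /s'; transitivity (s * x ^+ 2 + s * y ^+ 2 + c ^+ 2 * (12 * s ^+ 2 * x ^+ 2 * y ^+ 2)).
    by ring.
  by rewrite c2; ring.
rewrite -mulr_sumr -mulrA ler_pM2l//.
apply: (le_trans (ler_wpM2l (expR_ge0 _) (IH _ ul s'0 s'V))).
rewrite mulrCA ler_wpM2l ?exprn_ge0// -expRD ler_expR -/V.
have -> : s * x ^+ 2 + 2 * s' * V = s * x ^+ 2 + 2 * (s * V) + 2 * (12 * (s * x ^+ 2) * (s * V)).
  by rewrite /s'; ring.
rewrite mulrDr; lra.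
Qed.

Let dot_signE e xi : dot (sign_vector e) xi = S (enum 'I_p) xi e.
Proof. by rewrite /dot /S big_enum; apply: eq_bigr => i _; rewrite mxE. Qed.

Lemma sum_sign_sqr xi : \sum_e dot (sign_vector e) xi ^+ 2 = 2 ^+ p * nsq xi.
Proof.
rewrite (eq_bigr (fun e => S (enum 'I_p) xi e ^+ 2)); last by move=> e _; rewrite dot_signE.
by rewrite sum_sq ?enum_uniq// big_enum nsqE.
Qed.

Lemma sum_sign_expR (s : R) xi : 0 <= s -> s * nsq xi <= 24^-1 ->
  \sum_e expR (s * dot (sign_vector e) xi ^+ 2) <= 2 ^+ p * expR (2 * s * nsq xi).
Proof.
move=> s0 hs.
rewrite (eq_bigr (fun e => expR (s * S (enum 'I_p) xi e ^+ 2))); last by move=> e _; rewrite dot_signE.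
have -> : nsq xi = \sum_(i <- enum 'I_p) xi i 0 ^+ 2 by rewrite big_enum nsqE.
by apply: sum_exp => //; [exact: enum_uniq|rewrite big_enum -nsqE].
Qed.

End Signs.

Section Householder.
Context {R : realType}.

(** The reflection along h = a - b: equal norms give |h|^2 = 2 h.a, so [a] is sent to a - h = b. *)
Lemma orthonormal_exchange p (a b : 'cV[R]_p) : nsq a = nsq b ->
  exists O : 'M[R]_p, [/\ orthonormal_cols O, O^T = O & O *m a = b].
Proof.
move=> ab; have [<-|neq] := eqVneq a b.
  exists 1%:M; split; [|by rewrite trmx1|by rewrite mul1mx].
  by rewrite /orthonormal_cols trmx1 mul1mx.
set h := a - b; have h0 : nsq h != 0.
  by rewrite gt_eqF// nsq_gt0// subr_eq0.
have hE : nsq h = 2 * dot h a.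
  by rewrite nsqB dotBl -/(nsq a) -ab (dotC b a); ring.
have mulE x : h *m h^T *m x = dot h x *: h.
  rewrite -mulmxA; have -> : h^T *m x = (dot h x)%:M.
    by rewrite [LHS]mx11_scalar -dotE.
  by rewrite mul_mx_scalar.
pose O := 1%:M - (2 / nsq h) *: (h *m h^T).
have OT : O^T = O by rewrite /O linearB/= trmx1 linearZ/= trmx_mul trmxK.
have hh : h *m h^T *m (h *m h^T) = nsq h *: (h *m h^T).
  by rewrite mulmxA mulE -scalemxAl.
exists O; split => //.
  rewrite /orthonormal_cols OT /O mulmxBl mul1mx mulmxBr mulmx1 -!scalemxAl -scalemxAr hh.
  rewrite !scalerA; have -> : 2 / nsq h * (2 / nsq h) * nsq h = 2 / nsq h + 2 / nsq h by field.
  by rewrite scalerDl opprB addrK subrK.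
rewrite /O mulmxBl mul1mx -scalemxAl mulE scalerA hE.
have d0 : dot h a != 0 by move: h0; rewrite hE mulf_eq0 negb_or => /andP[].
have -> : 2 / (2 * dot h a) * dot h a = 1 by field.
by rewrite scale1r /h opprB addrC subrK.
Qed.

End Householder.

(** * Normalized differences of rotation invariant vectors *)

Section Kendall_form.
Context {R : realType} {p : nat}.
Implicit Types a v : 'cV[R]_p.

(* Equal to 0 at [v = 0]. *)
Definition dirsq a v : R := dot a v ^+ 2 / nsq v.

Lemma dirsq_ge0 a v : 0 <= dirsq a v.
Proof. by rewrite divr_ge0 ?sqr_ge0 ?nsq_ge0. Qed.

Lemma dirsq_le a v : dirsq a v <= nsq a.
Proof.
rewrite /dirsq; have [->|v0] := eqVneq v 0.
  by rewrite nsq0 invr0 mulr0 nsq_ge0.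
by rewrite ler_pdivrMr ?nsq_gt0// cauchy_schwarz.
Qed.

Lemma dirsqZ c a v : dirsq (c *: a) v = c ^+ 2 * dirsq a v.
Proof. by rewrite /dirsq dotZl exprMn mulrA. Qed.

Lemma dirsq_orth (O : 'M[R]_p) a v : orthonormal_cols O ->
  dirsq a (O *m v) = dirsq (O^T *m a) v.
Proof. by move=> hO; rewrite /dirsq dot_mulmxr nsq_orthonormal. Qed.

Lemma measurable_inv_nneg d (T : measurableType d) (f : T -> R) :
  (forall w, 0 <= f w) -> measurable_fun [set: T] f ->
  measurable_fun [set: T] (fun w => (f w)^-1).
Proof.
(* The power with exponent -1 agrees with the inverse on all of [0, oo), both being 0 at 0. *)
move=> f0 mf; under eq_fun do rewrite -powR_inv1//.
by apply: (measurableT_comp (measurable_powR (-1)) mf).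
Qed.

Section Measurability.
Context {d : measure_display} {T : measurableType d}.
Variable Z : T -> 'cV[R]_p.
Hypothesis mZ : forall i, measurable_fun [set: T] (fun w => Z w i 0).

Lemma measurable_dot a : measurable_fun [set: T] (fun w => dot a (Z w)).
Proof.
apply: measurable_sum => i; apply: measurable_funM => //; exact: measurable_cst.
Qed.

Lemma measurable_nsq : measurable_fun [set: T] (fun w => nsq (Z w)).
Proof. by apply: measurable_sum => i; exact: measurable_funM. Qed.

Lemma bmf_dirsq a : bmf (fun w => dirsq a (Z w)).
Proof.
split; last by exists (nsq a) => w; rewrite ger0_norm ?dirsq_ge0 ?dirsq_le.
apply: measurable_funM; first by apply: measurable_funX; exact: measurable_dot.
by apply: measurable_inv_nneg; [move=> w; exact: nsq_ge0|exact: measurable_nsq].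
Qed.

(** The quotient is the indicator of [Z w != 0], because 0 / 0 = 0. *)
Lemma bmf_nonzero : bmf (fun w => nsq (Z w) / nsq (Z w)).
Proof.
split.
  apply: measurable_funM; first exact: measurable_nsq.
  by apply: measurable_inv_nneg; [move=> w; exact: nsq_ge0|exact: measurable_nsq].
exists 1 => w; have [->|h] := eqVneq (nsq (Z w)) 0; first by rewrite mul0r normr0.
by rewrite divff// normr1.
Qed.

Lemma measurable_mulmx q (M : 'M[R]_(q, p)) i :
  measurable_fun [set: T] (fun w => (M *m Z w) i 0).
Proof.
under eq_fun do rewrite mxE.
apply: measurable_sum => j; apply: measurable_funM => //; exact: measurable_cst.
Qed.

End Measurability.

Lemma measurable_subv d (T : measurableType d) (Z1 Z2 : T -> 'cV[R]_p) :
    (forall i, measurable_fun [set: T] (fun w => Z1 w i 0)) ->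
    (forall i, measurable_fun [set: T] (fun w => Z2 w i 0)) ->
  forall i, measurable_fun [set: T] (fun w => (Z1 w - Z2 w) i 0).
Proof. by move=> m1 m2 i; under eq_fun do rewrite !mxE; exact: measurable_funB. Qed.

End Kendall_form.

Section Rotation_invariant_pair.
Context {d : measure_display} {T : measurableType d} {R : realType}.
Variable P : probability T R.
Context {p : nat}.
Hypothesis p_gt0 : (0 < p)%N.
Variables Z1 Z2 : T -> 'cV[R]_p.
Hypothesis mZ1 : forall i, measurable_fun [set: T] (fun w => Z1 w i 0).
Hypothesis mZ2 : forall i, measurable_fun [set: T] (fun w => Z2 w i 0).
(** The two rotations are unrelated, which independence of the two vectors allows. Equal rotations
    give isotropy of the difference; opposite signs give the bound on ties. *)
Hypothesis rot : forall (O1 O2 : 'M[R]_p), orthonormal_cols O1 -> orthonormal_cols O2 ->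
  forall phi : 'cV[R]_p -> R, measurable_fun [set: borel_type p] (phi : borel_type p -> R) ->
    (forall v, 0 <= phi v) ->
  Ex P (fun w => phi (Z1 w - Z2 w)) = Ex P (fun w => phi (O1 *m Z1 w - O2 *m Z2 w)).
Hypothesis Z1_neq0 : {ae P, forall w, Z1 w <> 0}.

Let D w := Z1 w - Z2 w.
Let mD i : measurable_fun [set: T] (fun w => D w i 0).
Proof. exact: measurable_subv. Qed.

Let mid i : measurable_fun [set: borel_type p] (fun v : borel_type p => (v : 'cV[R]_p) i 0).
Proof. exact: measurable_borel_coord. Qed.

Lemma Ex_dirsq_norm (psi : R -> R) (a b : 'cV[R]_p) :
    measurable_fun [set: R] psi -> (forall x, 0 <= psi x) -> nsq a = nsq b ->
  Ex P (fun w => psi (dirsq a (D w))) = Ex P (fun w => psi (dirsq b (D w))).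
Proof.
move=> mpsi psi0 ab; have [Q [hO OT Oab]] := orthonormal_exchange ab.
have m : measurable_fun [set: borel_type p] (fun v : borel_type p => psi (dirsq b v)).
  have [mb _] := @bmf_dirsq R p _ (borel_type p) _ mid b.
  exact: (measurableT_comp mpsi mb).
have := rot hO hO m (fun v => psi0 _); rewrite -/D => ->.
apply: eq_Ex => w; congr psi; rewrite -mulmxBr dirsq_orth// OT.
have Osq : Q *m Q = 1%:M by rewrite -{1}OT.
by rewrite -Oab mulmxA Osq mul1mx.
Qed.

(** The probability of [Z1 <> Z2], written as the expectation of a 0-1 quotient. *)
Definition no_tie := Ex P (fun w => nsq (D w) / nsq (D w)).

Lemma no_tie_le1 : no_tie <= 1.
Proof.
rewrite -[leRHS](Ex_cst P); apply: le_Ex; [exact: bmf_nonzero|exact: bmf_cst|].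
move=> w; have [->|h] := eqVneq (nsq (D w)) 0; first by rewrite mul0r.
by rewrite divff.
Qed.

(* [Z1 - Z2] and [Z1 + Z2] have the same law and cannot both vanish. *)
Lemma no_tie_ge : 2^-1 <= no_tie.
Proof.
have h1 : orthonormal_cols (1%:M : 'M[R]_p) by rewrite /orthonormal_cols trmx1 mul1mx.
have hN : orthonormal_cols (- 1%:M : 'M[R]_p).
  rewrite /orthonormal_cols (_ : (- _)^T = - 1%:M); last first.
    by apply/matrixP => i j; rewrite !mxE eq_sym.
  by rewrite mulNmx mulmxN opprK mul1mx.
have [m _] := @bmf_nonzero R p _ (borel_type p) _ mid.
have n0 (v : 'cV[R]_p) : 0 <= nsq v / nsq v by rewrite divr_ge0 ?nsq_ge0.
have := rot h1 hN m n0; rewrite -/D -/no_tie => e.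
have mS i : measurable_fun [set: T] (fun w => (1%:M *m Z1 w - - 1%:M *m Z2 w) i 0).
  by apply: measurable_subv => j; exact: measurable_mulmx.
suff : 1 <= no_tie + no_tie by lra.
rewrite {2}e /no_tie -ExD; [|exact: bmf_nonzero|exact: bmf_nonzero].
rewrite -[leLHS](Ex_cst P); apply: Ex_ae.
- exact: bmf_cst.
- by apply: bmfD; exact: bmf_nonzero.
- apply: filterS Z1_neq0 => w /= z0.
  rewrite mul1mx mulNmx mul1mx opprK.
  have [dw|dw] := eqVneq (nsq (D w)) 0; last first.
    by rewrite divff// lerDl.
  rewrite dw mul0r add0r divff// gt_eqF// nsq_gt0//.
  have /eqP := nsq_eq0 dw; rewrite subr_eq0 => /eqP <-.
  apply/eqP => /(congr1 (fun v : 'cV[R]_p => 2^-1 *: v)).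
  by rewrite scalerDr scaler0 -scalerDl -[_ + _]/(2^-1 + 2^-1) (_ : 2^-1 + 2^-1 = 1 :> R) ?scale1r//; lra.
Qed.

Let signs := {ffun 'I_p -> bool}.

Let card_signs : #|signs|%:R = 2 ^+ p :> R.
Proof. by rewrite card_ffun card_bool card_ord natrX. Qed.

Let p0 : 0 < p%:R :> R. Proof. by rewrite ltr0n. Qed.

Let nsq_scaled_sign (a : 'cV[R]_p) (e : signs) :
  nsq a = nsq (Num.sqrt (nsq a / p%:R) *: sign_vector e).
Proof.
rewrite nsqZ nsq_sign_vector sqr_sqrtr ?divr_ge0 ?nsq_ge0//.
by rewrite divfK// gt_eqF.
Qed.

(** By isotropy [a] may be replaced by each sign vector scaled to the same length. Summing under the
    expectation leaves, for each outcome, a deterministic sum over signs. *)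
Let sign_average (psi : R -> R) (a : 'cV[R]_p) :
    measurable_fun [set: R] psi -> (forall x, 0 <= psi x) ->
    (forall b : 'cV[R]_p, bmf (fun w => psi (dirsq b (D w)))) ->
  2 ^+ p * Ex P (fun w => psi (dirsq a (D w))) =
  Ex P (fun w => \sum_(e : signs) psi (nsq a / p%:R * dirsq (sign_vector e) (D w))).
Proof.
move=> mpsi psi0 bpsi.
have E e w : psi (nsq a / p%:R * dirsq (sign_vector e) (D w)) =
    psi (dirsq (Num.sqrt (nsq a / p%:R) *: sign_vector e) (D w)).
  by rewrite dirsqZ sqr_sqrtr// divr_ge0// nsq_ge0.
rewrite Ex_sum; last by move=> e _; under eq_fun do rewrite E; exact: bpsi.
rewrite -card_signs mulr_natl -sumr_const; apply: eq_bigr => e _.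
by rewrite (Ex_dirsq_norm mpsi psi0 (nsq_scaled_sign a e)); apply: eq_Ex => w; rewrite E.
Qed.

Lemma Ex_dirsq (a : 'cV[R]_p) :
  Ex P (fun w => dirsq a (D w)) = no_tie * nsq a / p%:R.
Proof.
(* The averaging requires a test function nonnegative on the whole line; on values of [dirsq] the
   absolute value is the identity. *)
have mabs : measurable_fun [set: R] (fun x : R => `|x|) by exact: measurableT_comp.
have := sign_average (psi := fun x => `|x|) a mabs (fun x => normr_ge0 x).
have bn b : bmf (fun w => `|dirsq b (D w)|).
  by under eq_fun do rewrite ger0_norm ?dirsq_ge0//; exact: bmf_dirsq.
move=> /(_ bn) h.
have h2 : 2 ^+ p * Ex P (fun w => dirsq a (D w)) =
    Ex P (fun w => (2 ^+ p * (nsq a / p%:R)) * (nsq (D w) / nsq (D w))).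
  transitivity (2 ^+ p * Ex P (fun w => `|dirsq a (D w)|)).
    by congr (_ * _); apply: eq_Ex => w; rewrite ger0_norm ?dirsq_ge0.
  rewrite h; apply: eq_Ex => w.
  rewrite (eq_bigr (fun e => nsq a / p%:R / nsq (D w) * dot (sign_vector e) (D w) ^+ 2)); last first.
    move=> e _; rewrite ger0_norm; first by rewrite /dirsq; ring.
    by rewrite mulr_ge0 ?dirsq_ge0 ?divr_ge0 ?nsq_ge0.
  by rewrite -mulr_sumr sum_sign_sqr; ring.
rewrite ExZ -/no_tie in h2; last exact: bmf_nonzero.
have p2 : 2 ^+ p != 0 :> R by rewrite expf_neq0.
apply: (mulfI p2); rewrite h2; ring.
Qed.

Lemma expR_12V : expR (12^-1) <= 2 :> R.
Proof.
have h : expR (12^-1) * (1 - 12^-1) <= 1 :> R.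
  by rewrite -[leRHS](expRxMexpNx_1 12^-1) ler_wpM2l ?expR_ge0//; exact: (expR_ge1Dx (- _)).
have := expR_ge0 (12^-1 : R); lra.
Qed.

(** For each outcome the sign sum has parameter s = |a|^2 / (24 L |D|^2), so s |D|^2 <= 1/24 is just
    the admissible range and the average is at most exp(1/12) <= 2. *)
Lemma Ex_expR_dirsq (a : 'cV[R]_p) (L : R) : 0 < L -> nsq a <= L ->
  Ex P (fun w => expR (p%:R / (24 * L) * dirsq a (D w))) <= 2.
Proof.
move=> L0 aL; pose psi x := expR (p%:R / (24 * L) * x).
have mpsi : measurable_fun [set: R] psi.
  apply: measurableT_comp => //; apply: measurable_funM => //; exact: measurable_cst.
have bpsi b : bmf (fun w => psi (dirsq b (D w))).
  by apply: bmf_expR; apply: bmfZ; exact: bmf_dirsq.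
have := sign_average a mpsi (fun x => expR_ge0 _) bpsi; rewrite -/(psi _) => h.
have p2 : 0 < 2 ^+ p :> R by rewrite exprn_gt0.
rewrite -(ler_pM2l p2) -/(psi _) [leLHS]h -[leRHS](Ex_cst P).
apply: le_Ex; [|exact: bmf_cst|].
  apply: bmf_sum => e _; apply: bmf_expR; apply: bmfZ; apply: bmfZ; exact: bmf_dirsq.
move=> w; set s := nsq a / (24 * L) / nsq (D w).
have s0 : 0 <= s by rewrite /s divr_ge0 ?nsq_ge0// divr_ge0 ?nsq_ge0// mulr_ge0// ltW.
have sD : s * nsq (D w) <= 24^-1.
  rewrite /s; have [->|h0] := eqVneq (nsq (D w)) 0; first by rewrite mulr0 invr_ge0.
  by rewrite divfK// ler_pdivrMr ?mulr_gt0//; lra.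
rewrite (eq_bigr (fun e => expR (s * dot (sign_vector e) (D w) ^+ 2))); last first.
  move=> e _; congr expR; rewrite /dirsq /s.
  have pn0 : p%:R != 0 :> R by rewrite gt_eqF.
  have Ln0 : L != 0 by rewrite gt_eqF.
  set c := (nsq (D w))^-1; field.
  by rewrite Ln0 pn0.
apply: (le_trans (sum_sign_expR s0 sD)); rewrite ler_pM2l//.
apply: le_trans expR_12V; rewrite ler_expR; move: sD; rewrite -mulrA; lra.
Qed.

(** From x^2 <= 2 exp x at x = c [dirsq] with c = p / (24 L): the second moment is at most 4 /
    c^2. *)
Lemma Ex_dirsq_sqr (a : 'cV[R]_p) (L : R) : 0 < L -> nsq a <= L ->
  Ex P (fun w => dirsq a (D w) ^+ 2) <= (48 * 48) * L ^+ 2 / p%:R ^+ 2.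
Proof.
move=> L0 aL; set c := p%:R / (24 * L).
have c0 : 0 < c by rewrite divr_gt0// mulr_gt0.
have h : Ex P (fun w => c ^+ 2 * dirsq a (D w) ^+ 2) <= 4.
  apply: (@le_trans _ _ (Ex P (fun w => 2 * expR (c * dirsq a (D w))))).
    apply: le_Ex.
    - by apply: bmfZ; under eq_fun do rewrite expr2; apply: bmfM; exact: bmf_dirsq.
    - by apply: bmfZ; apply: bmf_expR; apply: bmfZ; exact: bmf_dirsq.
    - by move=> w; rewrite -exprMn sqr_le_expR// mulr_ge0 ?dirsq_ge0// ltW.
  rewrite ExZ; last by apply: bmf_expR; apply: bmfZ; exact: bmf_dirsq.
  by have := Ex_expR_dirsq L0 aL; rewrite -/c; lra.
rewrite ExZ in h; last by under eq_fun do rewrite expr2; apply: bmfM; exact: bmf_dirsq.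
have -> : (48 * 48) * L ^+ 2 / p%:R ^+ 2 = 4 / c ^+ 2.
  by rewrite /c; field; rewrite !gt_eqF.
by rewrite ler_pdivlMr ?exprn_gt0// mulrC.
Qed.

End Rotation_invariant_pair.

(** * Differences of elliptical observations *)

Section Spiked_root.
Context {R : realType} {p r : nat}.
Variables (A : 'M[R]_p) (U : 'M[R]_(p, r)) (dl : 'rV[R]_r) (mu L : R).
Hypothesis AA : A *m A^T = mu%:M + U *m diag_mx dl *m U^T.
Hypothesis hU : orthonormal_cols U.
Hypothesis mu0 : 0 < mu.
Hypothesis muL : mu <= L.
Hypothesis hdl : forall j, 0 <= dl 0 j <= L - mu.

Lemma dot_diag (c : 'cV[R]_r) : dot c (diag_mx dl *m c) = \sum_j dl 0 j * c j 0 ^+ 2.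
Proof. by apply: eq_bigr => j _; rewrite mul_diag_mx mxE; ring. Qed.

Lemma nsq_diag (c : 'cV[R]_r) : nsq (diag_mx dl *m c) = \sum_j dl 0 j ^+ 2 * c j 0 ^+ 2.
Proof. by rewrite nsqE; apply: eq_bigr => j _; rewrite mul_diag_mx mxE exprMn. Qed.

Lemma dot_spiked v : dot v (A *m A^T *m v) =
  mu * nsq v + \sum_j dl 0 j * (U^T *m v) j 0 ^+ 2.
Proof.
rewrite AA mulmxDl dotDr mul_scalar_mx dotZr; congr (_ + _).
by rewrite -!mulmxA dot_mulmxr dot_diag.
Qed.

Lemma nsq_trmul_spiked v : nsq (A^T *m v) = dot v (A *m A^T *m v).
Proof. by rewrite nsq_mulmx trmxK. Qed.

Lemma nsq_trmul_le v : nsq (A^T *m v) <= L * nsq v.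
Proof.
rewrite nsq_trmul_spiked dot_spiked.
have h : \sum_j dl 0 j * (U^T *m v) j 0 ^+ 2 <= (L - mu) * nsq (U^T *m v).
  rewrite nsqE mulr_sumr; apply: ler_sum => j _; apply: ler_wpM2r; first exact: sqr_ge0.
  by have /andP[] := hdl j.
have h2 : (L - mu) * nsq (U^T *m v) <= (L - mu) * nsq v.
  by rewrite ler_wpM2l ?subr_ge0// (nsq_coproj v hU) lerDl nsq_ge0.
by lra.
Qed.

Lemma spiked_root_unit : A \in unitmx.
Proof.
rewrite -unitmx_tr -unitmx_tr trmxK.
have h : A^T \in unitmx.
  rewrite -unitmx_tr -row_free_unit trmxK -kermx_eq0; apply/eqP/row_matrixP => i.
  rewrite row0; set k := row i _.
  have kA : k *m A = 0 by apply/sub_kermxP; exact: row_sub.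
  have := nsq_trmul_spiked k^T; rewrite -trmx_mul kA trmx0 nsq0 dot_spiked => e.
  have s0 : 0 <= \sum_j dl 0 j * (U^T *m k^T) j 0 ^+ 2.
    by apply: sumr_ge0 => j _; rewrite mulr_ge0 ?sqr_ge0//; have /andP[] := hdl j.
  apply: trmx_inj; rewrite trmx0; apply: nsq_eq0; apply/eqP.
  rewrite eq_le nsq_ge0 andbT -(ler_pM2l mu0) mulr0.
  by rewrite e lerDl.
by rewrite -unitmx_tr.
Qed.

(* Write [d = A^T q]: then [|d|^2 = q^T Sigma q] and [|A d|^2 = |Sigma q|^2]. *)
Lemma spiked_root_norm d :
  [/\ mu * nsq d <= nsq (A *m d) &
      nsq (A *m d) <= mu * nsq d + \sum_j dot (col j U) (A *m d) ^+ 2].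
Proof.
have Au := spiked_root_unit.
have ATu : A^T \in unitmx by rewrite unitmx_tr.
pose q := invmx A^T *m d.
have -> : d = A^T *m q by rewrite /q mulKVmx.
rewrite nsq_trmul_spiked dot_spiked mulmxA.
set c := U^T *m q; set N := nsq q.
have cs : nsq (A *m A^T *m q) = mu ^+ 2 * N + 2 * mu * (\sum_j dl 0 j * c j 0 ^+ 2)
    + \sum_j dl 0 j ^+ 2 * c j 0 ^+ 2.
  rewrite AA mulmxDl mul_scalar_mx -!mulmxA -/c nsqD nsqZ nsq_orthonormal// dotZl.
  rewrite dot_mulmxr -/c.
  by rewrite dot_diag nsq_diag /N; ring.
have us : \sum_j dot (col j U) (A *m A^T *m q) ^+ 2 =
    \sum_j (mu + dl 0 j) ^+ 2 * c j 0 ^+ 2.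
  apply: eq_bigr => j _; rewrite -exprMn; congr (_ ^+ 2).
  have -> : dot (col j U) (A *m A^T *m q) = (U^T *m (A *m A^T *m q)) j 0.
    by rewrite mxE; apply: eq_bigr => i _; rewrite !mxE.
  rewrite AA mulmxDl mulmxDr mul_scalar_mx -scalemxAr -/c -!mulmxA -/c.
  by rewrite (mulmxA U^T) hU mul1mx mxE mul_diag_mx !mxE mulrDl.
have S1 : 0 <= \sum_j dl 0 j * c j 0 ^+ 2.
  by apply: sumr_ge0 => j _; rewrite mulr_ge0 ?sqr_ge0//; have /andP[] := hdl j.
have S2 : 0 <= \sum_j dl 0 j ^+ 2 * c j 0 ^+ 2.
  by apply: sumr_ge0 => j _; rewrite mulr_ge0 ?sqr_ge0.
have S3 : \sum_j (mu + dl 0 j) ^+ 2 * c j 0 ^+ 2 >=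
    mu * (\sum_j dl 0 j * c j 0 ^+ 2) + \sum_j dl 0 j ^+ 2 * c j 0 ^+ 2.
  rewrite mulr_sumr -big_split/=; apply: ler_sum => j _.
  have /andP[d0 _] := hdl j; have c0 := sqr_ge0 (c j 0).
  rewrite mulrA -mulrDl; apply: ler_wpM2r => //.
  have := sqr_ge0 mu; have : 0 <= mu * dl 0 j by rewrite mulr_ge0// ltW.
  by rewrite sqrrD; lra.
have mS : 0 <= mu * (\sum_j dl 0 j * c j 0 ^+ 2) by rewrite mulr_ge0// ltW.
rewrite cs us; move: S1 S2 S3 mS.
set s1 := \sum_j dl 0 j * _; set s2 := \sum_j dl 0 j ^+ 2 * _; set s3 := \sum_j (_ + _) ^+ 2 * _.
by move=> S1 S2 S3 mS; split; rewrite mulrDr mulrA -expr2; lra.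
Qed.

Lemma dirsq_root_le v d : dirsq v (A *m d) <= dirsq (A^T *m v) d / mu.
Proof.
have [->|d0] := eqVneq d 0.
  by rewrite mulmx0 /dirsq !dot0r expr0n/= !mul0r.
have [h _] := spiked_root_norm d; have nd := nsq_gt0 d0.
rewrite /dirsq dot_mulmxr -mulrA ler_wpM2l ?sqr_ge0// -invfM.
by rewrite lef_pV2 ?posrE ?mulr_gt0// 1?mulrC// (lt_le_trans _ h)// mulr_gt0.
Qed.

(** Replacing |A d|^2 by mu |d|^2 has relative error (|A d|^2 - mu |d|^2) / |A d|^2, whose numerator
    lives on the [r] spike directions. The error is thus a sum of products of two [dirsq] terms, one
    order of 1/p smaller than the main term. *)
Lemma dirsq_root_ge v d : dirsq (A^T *m v) d / mu - dirsq v (A *m d) <=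
  mu ^- 2 * (dirsq (A^T *m v) d * \sum_j dirsq (A^T *m col j U) d).
Proof.
have [->|d0] := eqVneq d 0.
  by rewrite mulmx0 /dirsq !dot0r expr0n/= !mul0r subr0 mulr0.
have [h1 h2] := spiked_root_norm d; have nd := nsq_gt0 d0.
have nA : 0 < nsq (A *m d) by rewrite (lt_le_trans _ h1)// mulr_gt0.
have -> : \sum_j dirsq (A^T *m col j U) d = (\sum_j dot (col j U) (A *m d) ^+ 2) / nsq d.
  by rewrite mulr_suml; apply: eq_bigr => j _; rewrite /dirsq dot_mulmxr.
set S := \sum_j _ in h2 *.
rewrite /dirsq -dot_mulmxr; set t := dot v (A *m d) ^+ 2.
have t0 : 0 <= t by exact: sqr_ge0.
have -> : t / nsq d / mu - t / nsq (A *m d) =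
    t / (mu * nsq d) * ((nsq (A *m d) - mu * nsq d) / nsq (A *m d)).
  by field; rewrite !gt_eqF.
have -> : mu ^- 2 * (t / nsq d * (S / nsq d)) = t / (mu * nsq d) * (S / (mu * nsq d)).
  by field; rewrite !gt_eqF.
apply: ler_wpM2l; first by rewrite divr_ge0// mulr_ge0// ltW.
apply: ler_pM; [by rewrite subr_ge0|by rewrite invr_ge0 ltW|by rewrite lerBlDl|].
by rewrite lef_pV2 ?posrE ?mulr_gt0.
Qed.

End Spiked_root.

Section Spiked_pair.
Context {d : measure_display} {T : measurableType d} {R : realType}.
Variable P : probability T R.
Context {p r : nat}.
Hypothesis p_gt0 : (0 < p)%N.
Variables Z1 Z2 : T -> 'cV[R]_p.
Hypothesis mZ1 : forall i, measurable_fun [set: T] (fun w => Z1 w i 0).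
Hypothesis mZ2 : forall i, measurable_fun [set: T] (fun w => Z2 w i 0).
Hypothesis rot : forall (O1 O2 : 'M[R]_p), orthonormal_cols O1 -> orthonormal_cols O2 ->
  forall phi : 'cV[R]_p -> R, measurable_fun [set: borel_type p] (phi : borel_type p -> R) ->
    (forall v, 0 <= phi v) ->
  Ex P (fun w => phi (Z1 w - Z2 w)) = Ex P (fun w => phi (O1 *m Z1 w - O2 *m Z2 w)).
Variables (A : 'M[R]_p) (U : 'M[R]_(p, r)) (dl : 'rV[R]_r) (mu L : R).
Hypothesis AA : A *m A^T = mu%:M + U *m diag_mx dl *m U^T.
Hypothesis hU : orthonormal_cols U.
Hypothesis mu0 : 0 < mu.
Hypothesis muL : mu <= L.
Hypothesis hdl : forall j, 0 <= dl 0 j <= L - mu.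
Variable v : 'cV[R]_p.
Hypothesis v2 : nsq v <= 2.

Let D w := Z1 w - Z2 w.
Let mD i : measurable_fun [set: T] (fun w => D w i 0).
Proof. exact: measurable_subv. Qed.
Let mAD i : measurable_fun [set: T] (fun w => (A *m D w) i 0).
Proof. exact: measurable_mulmx. Qed.
Let L0 : 0 < L. Proof. exact: lt_le_trans muL. Qed.
Let p0 : 0 < p%:R :> R. Proof. by rewrite ltr0n. Qed.

(** Here 48 L = 24 (2 L), and 2 L bounds |A^T v|^2 when |v|^2 <= 2; at this scale the exponential
    moment is at most 2. *)
Definition scaled_dirsq w := p%:R * mu / (48 * L) * dirsq v (A *m D w).

Lemma bmf_scaled_dirsq : bmf scaled_dirsq.
Proof. by apply: bmfZ; exact: bmf_dirsq. Qed.

Lemma scaled_dirsq_ge0 w : 0 <= scaled_dirsq w.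
Proof.
by rewrite mulr_ge0 ?dirsq_ge0// divr_ge0 ?mulr_ge0// ltW.
Qed.

Let av : nsq (A^T *m v) <= 2 * L.
Proof.
apply: (le_trans (nsq_trmul_le AA hU muL hdl v)).
by rewrite mulrC ler_wpM2r// ltW.
Qed.

Let L2 : 0 < 2 * L. Proof. by rewrite mulr_gt0. Qed.

Lemma Ex_expR_scaled : Ex P (fun w => expR (scaled_dirsq w)) <= 2.
Proof.
apply: le_trans (Ex_expR_dirsq p_gt0 mZ1 mZ2 rot L2 av).
apply: le_Ex.
- by apply: bmf_expR; exact: bmf_scaled_dirsq.
- by apply: bmf_expR; apply: bmfZ; exact: bmf_dirsq.
move=> w; rewrite ler_expR /scaled_dirsq -/(D w).
have := dirsq_root_le AA hU mu0 hdl v (D w) => h.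
have -> : p%:R / (24 * (2 * L)) * dirsq (A^T *m v) (D w) =
   p%:R * mu / (48 * L) * (dirsq (A^T *m v) (D w) / mu).
  by field; rewrite !gt_eqF.
by rewrite ler_wpM2l// divr_ge0 ?mulr_ge0// ltW.
Qed.

(** For y >= 0 and |t| <= 1/2 one has y^2 exp|t y| <= 8 exp(y/2) exp(y/2) = 8 exp y. The quadratic
    bound on exp then gives mean at most 1 + t m + 16 t^2, the 16 being 8 times the exponential
    moment bound 2. *)
Lemma mgf_scaled (t : R) : `|t| <= 2^-1 ->
  Ex P (fun w => expR (t * (scaled_dirsq w - Ex P scaled_dirsq))) <= expR (16 * t ^+ 2).
Proof.
move=> t2; set m := Ex P scaled_dirsq.
have by_ := bmf_scaled_dirsq.
have bt : bmf (fun w => expR (t * scaled_dirsq w)) by apply: bmf_expR; exact: bmfZ.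
have be : bmf (fun w => expR (scaled_dirsq w)) by exact: bmf_expR.
have h : Ex P (fun w => expR (t * scaled_dirsq w)) <= expR (t * m + 16 * t ^+ 2).
  apply: le_trans (expR_ge1Dx _).
  apply: (@le_trans _ _ (Ex P (fun w => 1 + t * scaled_dirsq w + 8 * t ^+ 2 * expR (scaled_dirsq w)))).
    apply: le_Ex => //.
      apply: bmfD; last exact: bmfZ.
      by apply: bmfD; [exact: bmf_cst|exact: bmfZ].
    move=> w; have y0 := scaled_dirsq_ge0 w; set y := scaled_dirsq w in y0 *.
    apply: (le_trans (expR_le_quadratic _)); rewrite lerD2l exprMn.
    rewrite [leRHS](_ : _ = t ^+ 2 * (8 * expR y)); last by ring.
    rewrite -[leLHS]mulrA ler_wpM2l ?sqr_ge0//.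
    have -> : expR y = expR (y / 2) * expR (y / 2) by rewrite -expRD -splitr.
    have h2 : y ^+ 2 <= 8 * expR (y / 2).
      by have := sqr_le_expR (x := y / 2); rewrite divr_ge0// => /(_ isT); rewrite exprMn; lra.
    have h3 : expR `|t * y| <= expR (y / 2).
      by rewrite ler_expR normrM (ger0_norm y0) mulrC ler_wpM2l.
    rewrite mulrA.
    by apply: ler_pM; rewrite ?sqr_ge0 ?expR_ge0.
  rewrite ExD; [|by apply: bmfD; [exact: bmf_cst|exact: bmfZ]|exact: bmfZ].
  rewrite ExD; [|exact: bmf_cst|exact: bmfZ].
  rewrite Ex_cst (ExZ P t by_) (ExZ P _ be) -/m -addrA lerD2l lerD2l.
  have := ler_wpM2l (sqr_ge0 t) Ex_expR_scaled; lra.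
rewrite (_ : (fun w => _) = (fun w => expR (- (t * m)) * expR (t * scaled_dirsq w))); last first.
  by apply/funext => w; rewrite -expRD; congr expR; ring.
rewrite ExZ// -(ler_pM2l (expR_gt0 (t * m))) mulrA expRxMexpNx_1 mul1r.
by rewrite -expRD.
Qed.

(** The mean with mu |D|^2 in place of |A D|^2 is exact, and the error has a sign. Its products are
    split into half sums of squares, and each second moment is at most 48^2 (2 L)^2 / p^2; 48 * 192
    is 48^2 times 4. *)
Lemma mean_dirsq :
  `|p%:R * mu * Ex P (fun w => dirsq v (A *m D w))
    - no_tie P Z1 Z2 * dot v (A *m A^T *m v)| <= (48 * 192) * r%:R * L ^+ 2 / (mu * p%:R).
Proof.
have bv : bmf (fun w => dirsq v (A *m D w)) by exact: bmf_dirsq.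
have ba : bmf (fun w => dirsq (A^T *m v) (D w)) by exact: bmf_dirsq.
have bj j : bmf (fun w => dirsq (A^T *m col j U) (D w)) by exact: bmf_dirsq.
have e1 : no_tie P Z1 Z2 * dot v (A *m A^T *m v) =
    p%:R * Ex P (fun w => dirsq (A^T *m v) (D w)).
  rewrite (Ex_dirsq p_gt0 mZ1 mZ2 rot) nsq_trmul_spiked.
  by rewrite [RHS]mulrC divfK// gt_eqF.
have e2 : p%:R * mu * Ex P (fun w => dirsq v (A *m D w)) - no_tie P Z1 Z2 * dot v (A *m A^T *m v) =
   - (p%:R * mu * Ex P (fun w => dirsq (A^T *m v) (D w) * mu^-1 - dirsq v (A *m D w))).
  rewrite e1 ExB//; last by under eq_fun do rewrite mulrC; exact: bmfZ.
  under [X in _ = - (_ * (X - _))]eq_Ex do rewrite mulrC.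
  by rewrite ExZ//; field; rewrite gt_eqF.
have bd : bmf (fun w => dirsq (A^T *m v) (D w) * mu^-1 - dirsq v (A *m D w)).
  by apply: bmfB => //; under eq_fun do rewrite mulrC; exact: bmfZ.
rewrite e2 normrN ger0_norm; last first.
  rewrite mulr_ge0 ?mulr_ge0 ?(ltW mu0)//; apply: Ex_ge0 => w.
  by rewrite subr_ge0; exact: (dirsq_root_le AA hU mu0 hdl).
have uj j : nsq (A^T *m col j U) <= 2 * L.
  apply: (le_trans (nsq_trmul_le AA hU muL hdl _)).
  by rewrite nsq_colE hU mxE eqxx mulr1; have := ltW L0; lra.
have b : Ex P (fun w => dirsq (A^T *m v) (D w) * mu^-1 - dirsq v (A *m D w)) <=
   mu ^- 2 * (r%:R * ((48 * 48) * (2 * L) ^+ 2 / p%:R ^+ 2)).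
  apply: (@le_trans _ _ (Ex P (fun w => mu ^- 2 *
      \sum_j (2^-1 * dirsq (A^T *m v) (D w) ^+ 2 + 2^-1 * dirsq (A^T *m col j U) (D w) ^+ 2)))).
    apply: le_Ex => //.
      apply: bmfZ; apply: bmf_sum => j _; under eq_fun do rewrite !expr2.
      by apply: bmfD; apply: bmfZ; exact: bmfM.
    move=> w; apply: (le_trans (dirsq_root_ge AA hU mu0 hdl v (D w))).
    rewrite ler_wpM2l ?invr_ge0 ?sqr_ge0// mulr_sumr; apply: ler_sum => j _.
    have := sqr_ge0 (dirsq (A^T *m v) (D w) - dirsq (A^T *m col j U) (D w)).
    by rewrite sqrrB; lra.
  have bq (a : 'cV[R]_p) : bmf (fun w => dirsq a (D w) ^+ 2).
    by under eq_fun do rewrite expr2; apply: bmfM; exact: bmf_dirsq.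
  have bb j : bmf (fun w => 2^-1 * dirsq (A^T *m v) (D w) ^+ 2 + 2^-1 * dirsq (A^T *m col j U) (D w) ^+ 2).
    by apply: bmfD; exact: bmfZ.
  rewrite ExZ; last by apply: bmf_sum => j _; exact: bb.
  rewrite ler_wpM2l ?invr_ge0 ?sqr_ge0// Ex_sum; last by move=> j _; exact: bb.
  apply: (@le_trans _ _ (\sum_(j < r) (48 * 48) * (2 * L) ^+ 2 / p%:R ^+ 2)); last first.
    by rewrite sumr_const card_ord -[leLHS]mulr_natl.
  apply: ler_sum => j _; rewrite ExD; [|exact: bmfZ|exact: bmfZ].
  rewrite !ExZ//.
  have := Ex_dirsq_sqr p_gt0 mZ1 mZ2 rot L2 av.
  have := Ex_dirsq_sqr p_gt0 mZ1 mZ2 rot L2 (uj j).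
  by rewrite -/D; lra.
apply: (le_trans (ler_wpM2l _ b)); first by rewrite mulr_ge0// ltW.
rewrite le_eqVlt; apply/orP; left; apply/eqP; field.
by rewrite !gt_eqF.
Qed.

End Spiked_pair.

(** * Radial parts of the sample *)

Lemma borel_preimage_mulmx (R : realType) p q (M : 'M[R]_(q, p)) (B : set 'cV[R]_q) :
  borel_cV B -> borel_cV ((fun x : 'cV[R]_p => M *m x) @^-1` B).
Proof.
move=> mB; apply: (@random_matrix_borel R q _ (borel_type p)) => // i.
by apply: (@measurable_mulmx R p _ (borel_type p) id) => j; exact: measurable_borel_coord.
Qed.

Lemma measurable_phi_sub (R : realType) p d (T : measurableType d) (phi : 'cV[R]_p -> R)
    (Z1 Z2 : T -> 'cV[R]_p) :
    measurable_fun [set: borel_type p] (phi : borel_type p -> R) ->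
    (forall i, measurable_fun [set: T] (fun w => Z1 w i 0)) ->
    (forall i, measurable_fun [set: T] (fun w => Z2 w i 0)) ->
  measurable_fun [set: T] (fun w => phi (Z1 w - Z2 w)).
Proof.
move=> mphi m1 m2.
have m : measurable_fun [set: T] ((fun w => Z1 w - Z2 w) : T -> borel_type p).
  by apply: measurable_to_borel; exact: measurable_subv.
exact: (measurableT_comp mphi m).
Qed.

Section Elliptical.
Context {d : measure_display} {T : measurableType d} {R : realType}.
Variable P : probability T R.
Context {K n p : nat}.
Variables (A : 'M[R]_p) (rho : 'I_K -> 'I_n -> T -> R) (u : 'I_K -> 'I_n -> T -> 'cV[R]_p).
Hypothesis hx : elliptical_sample P A rho u.
Hypothesis Au : A \in unitmx.

Definition radial (ki : 'I_K * 'I_n) w : 'cV[R]_p := rho ki.1 ki.2 w *: u ki.1 ki.2 w.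

Let X (ki : 'I_K * 'I_n) := elliptical_obs A rho u ki.1 ki.2.

Lemma elliptical_radial ki w : X ki w = A *m radial ki w.
Proof. by rewrite /X /elliptical_obs scalemxAr. Qed.

Lemma measurable_radial ki i : measurable_fun [set: T] (fun w => radial ki w i 0).
Proof.
rewrite /radial; under eq_fun do rewrite mxE; apply: measurable_funM.
  exact: (es_radius_measurable hx).
by have [mu _ _] := es_uniform hx ki.1 ki.2; exact: mu.
Qed.

Lemma measurable_elliptical ki i : measurable_fun [set: T] (fun w => X ki w i 0).
Proof.
under eq_fun do rewrite elliptical_radial.
by apply: measurable_mulmx; exact: measurable_radial.
Qed.

(** Independence of direction and radius upgrades the invariance of the law of [u] to that of the
    pair (u, rho), of which the radial part is a function. *)
Lemma radial_rotation ki (O : 'M[R]_p) B : orthonormal_cols O -> borel_cV B ->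
  P (radial ki @^-1` B) = P ((fun w => O *m radial ki w) @^-1` B).
Proof.
move=> hO mB.
have [mu _ rot] := es_uniform hx ki.1 ki.2.
have mrho := es_radius_measurable hx ki.1 ki.2.
have ind := es_radius_indep hx ki.1 ki.2.
have mOu i : measurable_fun [set: T] (fun w => (O *m u ki.1 ki.2 w) i 0).
  by apply: measurable_mulmx => j; exact: mu.
have mR : measurable (radial ki @^-1` B).
  by apply: random_matrix_borel => // i; exact: measurable_radial.
have mOR : measurable ((fun w => O *m radial ki w) @^-1` B).
  by apply: random_matrix_borel => // i; apply: measurable_mulmx; exact: measurable_radial.
rewrite -[LHS]fineK; last exact: fin_num_measure.
rewrite -[RHS]fineK; last exact: fin_num_measure.
congr EFin; rewrite -!Ex_indic//.
pose F (z : borel_type p * R) : R := \1_B (z.2 *: (z.1 : 'cV[R]_p)).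
have -> : Ex P (\1_(radial ki @^-1` B)) = Ex P (fun w => F (u ki.1 ki.2 w, rho ki.1 ki.2 w)).
  by apply: eq_Ex => w; rewrite !indicE /radial; congr (_%:R); apply/idP/idP; rewrite !inE.
have -> : Ex P (\1_((fun w => O *m radial ki w) @^-1` B)) =
    Ex P (fun w => F (O *m u ki.1 ki.2 w, rho ki.1 ki.2 w)).
  apply: eq_Ex => w; rewrite /F /= scalemxAr !indicE.
  have -> // : (w \in (fun w => O *m radial ki w) @^-1` B) = (O *m (rho ki.1 ki.2 w *: u ki.1 ki.2 w) \in B).
  by apply/idP/idP; rewrite !inE.
have m1 : measurable_fun [set: T] (u ki.1 ki.2 : T -> borel_type p).
  by apply: measurable_to_borel => i; exact: mu.
have m2 : measurable_fun [set: T] ((fun w => O *m u ki.1 ki.2 w) : T -> borel_type p).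
  exact: measurable_to_borel.
apply: (joint_law_eq m1 m2 mrho mrho).
- move=> A1 C mA1 mC; rewrite ind//.
  have e : (fun w => O *m u ki.1 ki.2 w) @^-1` A1 =
      u ki.1 ki.2 @^-1` ((fun x : 'cV[R]_p => O *m x) @^-1` A1) by [].
  rewrite e ind//; last exact: borel_preimage_mulmx.
  by rewrite -e (rot _ hO _ mA1).
- have mF : measurable_fun [set: borel_type p * R]
      ((fun z : borel_type p * R => z.2 *: (z.1 : 'cV[R]_p)) : _ -> borel_type p).
    apply: measurable_to_borel => i.
    rewrite (_ : (fun w => _) = fun z : borel_type p * R => z.2 * (z.1 : 'cV[R]_p) i 0); last first.
      by apply/funext => z; rewrite mxE.
    apply: measurable_funM; first exact: measurable_snd.
    exact: (measurableT_comp (measurable_borel_coord i) measurable_fst).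
  have mI : measurable_fun [set: borel_type p] (\1_B : borel_type p -> R).
    exact: measurable_indic.
  exact: (measurableT_comp mI mF).
- by move=> z; rewrite /F indicE ler0n.
Qed.

(** Independence is assumed for the observations; invertibility of [A] turns events about radial
    parts into events about observations. *)
Lemma radial_indep ki kj B C : ki != kj -> borel_cV B -> borel_cV C ->
  P (radial ki @^-1` B `&` radial kj @^-1` C) =
  (P (radial ki @^-1` B) * P (radial kj @^-1` C))%E.
Proof.
move=> ij mB mC.
have e k (S : set 'cV[R]_p) : radial k @^-1` S =
    X k @^-1` ((fun x : 'cV[R]_p => invmx A *m x) @^-1` S).
  by apply/seteqP; split => w; rewrite /= elliptical_radial mulKmx.
rewrite !e; apply: pair_indep => //.
- exact: (es_indep hx).
- exact: borel_preimage_mulmx.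
- exact: borel_preimage_mulmx.
Qed.

Lemma radial_pair_rotation ki kj : ki != kj ->
  forall (O1 O2 : 'M[R]_p), orthonormal_cols O1 -> orthonormal_cols O2 ->
  forall phi : 'cV[R]_p -> R, measurable_fun [set: borel_type p] (phi : borel_type p -> R) ->
    (forall v, 0 <= phi v) ->
  Ex P (fun w => phi (radial ki w - radial kj w)) =
  Ex P (fun w => phi (O1 *m radial ki w - O2 *m radial kj w)).
Proof.
move=> ij O1 O2 hO1 hO2 phi mphi phi0.
pose F (z : borel_type p * borel_type p) : R := phi ((z.1 : 'cV[R]_p) - z.2).
have mr k := measurable_to_borel (measurable_radial k).
have mOr (Q : 'M[R]_p) k : measurable_fun [set: T] ((fun w => Q *m radial k w) : T -> borel_type p).
  by apply: measurable_to_borel; apply: measurable_mulmx; exact: measurable_radial.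
apply: (joint_law_eq (F := F) (mr ki) (mOr O1 ki) (mr kj) (mOr O2 kj)).
- move=> B C mB mC; rewrite radial_indep//.
  have e k (Q : 'M[R]_p) (S : set 'cV[R]_p) : (fun w => Q *m radial k w) @^-1` S =
    radial k @^-1` ((fun x : 'cV[R]_p => Q *m x) @^-1` S) by [].
  rewrite !e radial_indep//; try exact: borel_preimage_mulmx.
  by rewrite -!e -!radial_rotation.
- apply: measurable_phi_sub => // i.
    exact: (measurableT_comp (measurable_borel_coord i) measurable_fst).
  exact: (measurableT_comp (measurable_borel_coord i) measurable_snd).
- by move=> z; exact: phi0.
Qed.

Lemma radial_neq0 ki : {ae P, forall w, radial ki w <> 0}.
Proof.
have [_ u1 _] := es_uniform hx ki.1 ki.2.
have r0 := es_radius_pos hx ki.1 ki.2.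
apply: filterS2 u1 r0 => w /= uw rw /eqP; rewrite /radial scaler_eq0 gt_eqF//= => /eqP u0.
by move: uw => /eqP; rewrite u0 frobenius_cV0 eq_sym oner_eq0.
Qed.

End Elliptical.

(** * Exponential moments of U-statistics *)

Lemma uniq_flatten_pairs (I : eqType) (l : seq (I * I)) :
    uniq l -> (forall x, x \in l -> x.1 != x.2) ->
    (forall x y a, x \in l -> y \in l -> a \in [:: x.1; x.2] -> a \in [:: y.1; y.2] -> x = y) ->
  uniq (flatten [seq [:: x.1; x.2] | x <- l]).
Proof.
elim: l => // x l IH /= /andP[xl ul] h1 h2.
rewrite IH//; last 2 first.
- by move=> y yl; apply: h1; rewrite inE yl orbT.
- by move=> y z a yl zl; apply: h2; rewrite inE ?yl ?zl orbT.
have nin a : a \in [:: x.1; x.2] -> a \notin flatten [seq [:: y.1; y.2] | y <- l].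
  move=> ax; apply/negP => /flatten_mapP[y yl ay].
  move: xl; rewrite (h2 x y a) ?yl//; first exact: mem_head.
  by rewrite inE yl orbT.
rewrite inE negb_or h1 ?mem_head//= !nin ?inE ?eqxx ?orbT//.
Qed.

Section Matchings.
Context {K n : nat}.
Local Notation I := ('I_K * 'I_n)%type.

(* For fixed [s], the pairs [i < j] with [i + j = s] modulo [n] are disjoint, and
   every pair belongs to exactly one such class. *)
Definition matching (s : nat) : seq (I * I) :=
  [seq ((t.1, t.2.1), (t.1, t.2.2)) | t : 'I_K * ('I_n * 'I_n) <- enum {: 'I_K * ('I_n * 'I_n)} &
    (t.2.1 < t.2.2)%N && ((t.2.1 + t.2.2) %% n == s)%N].

Lemma mem_matching s x : x \in matching s ->
  [/\ x.1.1 = x.2.1, (x.1.2 < x.2.2)%N & ((x.1.2 + x.2.2) %% n = s)%N].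
Proof.
move=> /mapP[t]; rewrite mem_filter => /andP[/andP[h1 /eqP h2] _] ->.
by split.
Qed.

Lemma matching_uniq s : uniq (flatten [seq [:: x.1; x.2] | x <- matching s]).
Proof.
apply: uniq_flatten_pairs.
- rewrite map_inj_uniq; first by apply: filter_uniq; exact: enum_uniq.
  by move=> [k [i j]] [k' [i' j']] /= [-> -> _ ->].
- move=> x /mem_matching[_ lt _]; apply/eqP => e.
  by move: lt; rewrite e ltnn.
- move=> [[k1 i1] [k2 j1]] [[k3 i2] [k4 j2]] [k a] /mem_matching/= [<- l1 s1].
  move=> /mem_matching/= [<- l2 s2].
  have inj (b c e : 'I_n) : ((b + c) %% n = (b + e) %% n)%N -> c = e.
    move=> /eqP; rewrite eqn_modDl !modn_small// => /eqP h; exact: val_inj.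
  (* Four ways to share an index. If it is the smaller entry of one pair and the larger of the
     other, the congruence identifies the other two entries as well, which contradicts the
     orderings. *)
  rewrite !inE !xpair_eqE => /orP[] /andP[/eqP -> /eqP ->] /orP[] /andP[/eqP -> /eqP e].
  + by rewrite -e in l2 s2 *; rewrite (inj i1 j1 j2)// s1 s2.
  + rewrite -e in l2 s2; have e2 : j1 = i2 by apply: (inj i1); rewrite s1 -s2 addnC.
    by have := ltn_trans l2 l1; rewrite e2 ltnn.
  + rewrite -e in l2 s2; have e2 : i1 = j2 by apply: (inj j1); rewrite addnC s1 -s2.
    by have := ltn_trans l1 l2; rewrite e2 ltnn.
  + rewrite -e in l2 s2 *; have -> : i1 = i2 by apply: (inj j1); rewrite addnC s1 -s2 addnC.
    by [].
Qed.

Lemma size_matching s : (size (matching s) <= K * n)%N.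
Proof.
have h : (size (flatten [seq [:: x.1; x.2] | x <- matching s]) <= K * n)%N.
  have /card_uniqP <- := matching_uniq s.
  by apply: leq_trans (max_card _) _; rewrite card_prod !card_ord.
apply: leq_trans h; rewrite size_flatten /shape -map_comp.
by elim: (matching s) => //= x l IH; rewrite ltnS (leq_trans IH)// leqnSn.
Qed.

Lemma sum_matching (R : nmodType) (F : I * I -> R) : (0 < n)%N ->
  \sum_(k < K) \sum_(i < n) \sum_(j < n | (i < j)%N) F ((k, i), (k, j)) =
  \sum_(s < n) \sum_(x <- matching s) F x.
Proof.
move=> n0.
rewrite (eq_bigr (fun k => \sum_(q : 'I_n * 'I_n | (q.1 < q.2)%N) F ((k, q.1), (k, q.2)))); last first.
  by move=> k _; rewrite pair_big_dep.
rewrite pair_big_dep/=.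
rewrite (partition_big (fun t : 'I_K * ('I_n * 'I_n) => Ordinal (ltn_pmod (t.2.1 + t.2.2)%N n0)) predT)//=.
apply: eq_bigr => s _; rewrite /matching big_map big_filter big_enum_cond/=.
by apply: eq_bigl => -[k [i j]].
Qed.

End Matchings.

Section Jensen.
Context {R : realType}.

(** Jensen's inequality from the tangent line of exp at the mean, whose linear terms sum to 0. *)
Lemma expR_mean_le n (f : 'I_n -> R) : (0 < n)%N ->
  expR (n%:R^-1 * \sum_i f i) <= n%:R^-1 * \sum_i expR (f i).
Proof.
move=> n0; set m := n%:R^-1 * _.
have nn : n%:R != 0 :> R by rewrite pnatr_eq0 -lt0n.
have h : \sum_i (expR m * (1 + (f i - m))) <= \sum_i expR (f i).
  apply: ler_sum => i _.
  have -> : expR (f i) = expR m * expR (f i - m) by rewrite -expRD addrCA subrr addr0.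
  by rewrite ler_wpM2l ?expR_ge0// expR_ge1Dx.
rewrite mulrC ler_pdivlMr ?ltr0n//; apply: le_trans h.
rewrite -mulr_sumr big_split/= big_split/= !sumr_const card_ord.
rewrite le_eqVlt; apply/orP; left; apply/eqP; congr (_ * _).
by rewrite -[- m *+ n]mulr_natr /m mulNr mulrAC mulVf// mul1r subrr addr0.
Qed.

End Jensen.

Section Chernoff.
Context {d : measure_display} {T : measurableType d} {R : realType}.
Variable P : probability T R.
Context {K n p : nat}.
Local Notation I := ('I_K * 'I_n)%type.
Variable X : I -> T -> 'cV[R]_p.
Hypothesis mX : forall i a, measurable_fun [set: T] (fun w => X i w a 0).
Hypothesis indX : mutually_independent P X.
Hypothesis n_gt0 : (0 < n)%N.
Variable psi : I * I -> 'cV[R]_p -> R.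
Hypothesis bpsi : forall x, bmf (psi x : borel_type p -> R).
Variable b : R.
Hypothesis mgf : forall x t, x.1 != x.2 -> `|t| <= 2^-1 ->
  Ex P (fun w => expR (t * psi x (X x.1 w - X x.2 w))) <= expR (b * t ^+ 2).
Hypothesis b0 : 0 <= b.

(** The factor 1/n averages over the [n] matchings, each a sum of at most K n independent terms; it
    is not the normalization by the number of pairs. *)
Definition ustat w : R := n%:R^-1 *
  \sum_(k < K) \sum_(i < n) \sum_(j < n | (i < j)%N)
    psi ((k, i), (k, j)) (X (k, i) w - X (k, j) w).

Let bmf_psi x : bmf (fun w => psi x (X x.1 w - X x.2 w)).
Proof.
have [mp [M hM]] := bpsi x; split; last by exists M.
have m : measurable_fun [set: T] ((fun w => X x.1 w - X x.2 w) : T -> borel_type p).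
  apply: measurable_to_borel => a; under eq_fun do rewrite !mxE.
  by apply: measurable_funB.
exact: (measurableT_comp mp m).
Qed.

Lemma bmf_ustat : bmf ustat.
Proof.
apply: bmfZ; apply: bmf_sum => k _; apply: bmf_sum => i _; apply: bmf_sum => j _.
exact: (bmf_psi ((k, i), (k, j))).
Qed.

Lemma mgf_ustat t : `|t| <= 2^-1 ->
  Ex P (fun w => expR (t * ustat w)) <= expR (b * t ^+ 2 * (K * n)%:R).
Proof.
move=> t2.
pose G s w := t * \sum_(x <- @matching K n s) psi x (X x.1 w - X x.2 w).
have bG s : bmf (G s) by apply: bmfZ; apply: bmf_sum => x _; exact: bmf_psi.
have n0 : 0 < n%:R :> R by rewrite ltr0n.
apply: (@le_trans _ _ (Ex P (fun w => n%:R^-1 * \sum_(s < n) expR (G s w)))).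
  apply: le_Ex.
  - by apply: bmf_expR; apply: bmfZ; exact: bmf_ustat.
  - by apply: bmfZ; apply: bmf_sum => s _; exact: bmf_expR.
  - move=> w; rewrite /ustat (sum_matching (fun x => psi x (X x.1 w - X x.2 w)))//.
    by rewrite mulrCA mulr_sumr; exact: expR_mean_le.
rewrite ExZ; last by apply: bmf_sum => s _; exact: bmf_expR.
rewrite mulrC ler_pdivrMr// Ex_sum; last by move=> s _; exact: bmf_expR.
apply: (@le_trans _ _ (\sum_(s < n) expR (b * t ^+ 2 * (K * n)%:R))); last first.
  by rewrite sumr_const card_ord -[leLHS]mulr_natr.
apply: ler_sum => s _.
pose phi (x : I * I) (v : 'cV[R]_p) := expR (t * psi x v).
have -> : Ex P (fun w => expR (G s w)) =
    Ex P (fun w => \prod_(x <- @matching K n s) phi x (X x.1 w - X x.2 w)).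
  by apply: eq_Ex => w; rewrite /G mulr_sumr expR_sum.
rewrite (Ex_prod_pairs mX indX); [|by move=> x; apply: bmf_expR; exact: bmfZ|
  by move=> x v; exact: expR_ge0|exact: matching_uniq].
apply: (@le_trans _ _ (\prod_(x <- @matching K n s) expR (b * t ^+ 2))).
  rewrite big_seq [leRHS]big_seq; apply: ler_prod => x xs.
  apply/andP; split; first by apply: Ex_ge0 => w; exact: expR_ge0.
  apply: mgf => //; apply/eqP => e.
  by have [_ lt _] := mem_matching xs; rewrite e ltnn in lt.
rewrite big_const_seq count_predT.
have -> : iter (size (@matching K n s)) ( *%R (expR (b * t ^+ 2))) 1 =
    expR (b * t ^+ 2) ^+ size (@matching K n s).
  by elim: (size _) => [|k IH]; rewrite ?expr0// iterS IH [RHS]exprS.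
rewrite -expRM_natr ler_expR; apply: ler_wpM2l; first by rewrite mulr_ge0 ?sqr_ge0.
rewrite ler_nat.
exact: size_matching.
Qed.

(** Chernoff on both sides, parametrized by the exponent [t]: at level 2 b t K n the exponents
    combine to - 2 b t^2 K n + b t^2 K n. *)
Lemma ustat_deviation t : 0 < t -> t <= 2^-1 ->
  (P [set w | (2 * b * t * (K * n)%:R <= `|ustat w|)%R] <=
   (2 * expR (- (b * t ^+ 2 * (K * n)%:R)))%:E)%E.
Proof.
move=> t0 t2; set a := 2 * b * t * _; set N := (K * n)%:R.
pose f w := expR (- (t * a)) * (expR (t * ustat w) + expR (- t * ustat w)).
have be c : bmf (fun w => expR (c * ustat w)).
  by apply: bmf_expR; apply: bmfZ; exact: bmf_ustat.
have bf : bmf f by apply: bmfZ; apply: bmfD; exact: be.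
have mA : measurable [set w | (a <= `|ustat w|)%R].
  have [mu _] := bmf_ustat.
  have mc : measurable_fun [set: T] (fun=> a : R) by exact: measurable_cst.
  have mn : measurable_fun [set: T] (fun w => `|ustat w|) by exact: measurableT_comp.
  by have := measurable_fun_ler mc mn measurableT (Logic.I : measurable [set true]); rewrite setTI.
apply: (le_trans (prob_le_Ex P mA bf _ _)).
- by move=> w; rewrite mulr_ge0 ?addr_ge0 ?expR_ge0.
- move=> w /= aw; rewrite /f mulrDr -!expRD.
  have [u0|u0] := leP 0 (ustat w).
    apply: (@le_trans _ _ (expR (- (t * a) + t * ustat w))); last by rewrite lerDl expR_ge0.
    rewrite -[leLHS]expR0 ler_expR addrC subr_ge0 ler_pM2l//.
    by rewrite ger0_norm in aw.
  apply: (@le_trans _ _ (expR (- (t * a) + - t * ustat w))); last by rewrite lerDr expR_ge0.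
  rewrite -[leLHS]expR0 ler_expR addrC subr_ge0 mulNr -mulrN ler_pM2l//.
  by rewrite ltr0_norm in aw.
rewrite lee_fin ExZ; last by apply: bmfD; exact: be.
rewrite ExD//.
have h1 := @mgf_ustat t; have h2 := @mgf_ustat (- t).
rewrite normrN sqrrN (gtr0_norm t0) in h1 h2.
apply: (@le_trans _ _ (expR (- (t * a)) * (2 * expR (b * t ^+ 2 * N)))).
  rewrite ler_wpM2l ?expR_ge0//; have := h1 t2; have := h2 t2; rewrite -/N; lra.
rewrite mulrCA ler_pM2l// -expRD ler_expR le_eqVlt; apply/orP; left; apply/eqP.
by rewrite /a -/N; ring.
Qed.

End Chernoff.

(** * Concentration of the averaged Kendall matrix *)

Section Mean_kendall.
Context {R : realType}.

Lemma dot_scale_sub p (a g : R) (M S : 'M[R]_p) (v : 'cV[R]_p) :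
  dot v ((a *: M - g *: S) *m v) = a * dot v (M *m v) - g * dot v (S *m v).
Proof. by rewrite mulmxBl dotBr -!scalemxAl !dotZr. Qed.

Lemma trmx_scale_sub p (a g : R) (M S : 'M[R]_p) :
  M^T = M -> S^T = S -> (a *: M - g *: S)^T = a *: M - g *: S.
Proof. by move=> hM hS; rewrite linearB/= !linearZ/= hM hS. Qed.

Definition mean_kendall {K n p : nat} (x : 'I_K -> 'I_n -> 'cV[R]_p) : 'M[R]_p :=
  K%:R^-1 *: \sum_(k < K) kendall (x k).

Lemma dot_outer p (v y : 'cV[R]_p) : dot v (y *m y^T *m v) = dot v y ^+ 2.
Proof.
rewrite -mulmxA; have -> : y^T *m v = (dot y v)%:M by rewrite [LHS]mx11_scalar -dotE.
by rewrite mul_mx_scalar dotZr dotC expr2.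
Qed.

Lemma dot_kendall n p (x : 'I_n -> 'cV[R]_p) v : dot v (kendall x *m v) =
  2 / (n%:R * (n%:R - 1)) * \sum_(i < n) \sum_(j < n | (i < j)%N) dirsq v (x i - x j).
Proof.
rewrite /kendall -scalemxAl dotZr; congr (_ * _).
rewrite mulmx_suml dot_sumr; apply: eq_bigr => i _.
rewrite mulmx_suml dot_sumr; apply: eq_bigr => j _.
by rewrite -scalemxAl dotZr dot_outer frobenius_cV mulrC.
Qed.

Lemma kendall_tr n p (x : 'I_n -> 'cV[R]_p) : (kendall x)^T = kendall x.
Proof.
rewrite /kendall linearZ/= linear_sum/=; congr (_ *: _).
apply: eq_bigr => i _; rewrite linear_sum/=; apply: eq_bigr => j _.
by rewrite linearZ/= trmx_mul trmxK.
Qed.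

Lemma mean_kendall_tr K n p (x : 'I_K -> 'I_n -> 'cV[R]_p) :
  (mean_kendall x)^T = mean_kendall x.
Proof.
rewrite /mean_kendall linearZ/= linear_sum/=; congr (_ *: _).
by apply: eq_bigr => k _; rewrite kendall_tr.
Qed.

Lemma dot_mean_kendall K n p (x : 'I_K -> 'I_n -> 'cV[R]_p) v :
  dot v (mean_kendall x *m v) = 2 / (K%:R * (n%:R * (n%:R - 1))) *
    \sum_(k < K) \sum_(i < n) \sum_(j < n | (i < j)%N) dirsq v (x k i - x k j).
Proof.
rewrite /mean_kendall -scalemxAl dotZr mulmx_suml dot_sumr.
rewrite (eq_bigr _ (fun k _ => dot_kendall (x k) v)) -mulr_sumr mulrA; congr (_ * _).
by rewrite [in RHS]invfM; ring.
Qed.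

Lemma div_pred_le2 (x : R) : 2 <= x -> x / (x - 1) <= 2.
Proof. by move=> x2; rewrite ler_pdivrMr; lra. Qed.

Lemma sum_pairs n (c : R) :
  \sum_(i < n) \sum_(j < n | (i < j)%N) c = n%:R * (n%:R - 1) / 2 * c.
Proof.
elim: n => [|n IH]; first by rewrite big_ord0 !mul0r.
rewrite big_ord_recr/= (big_pred0 _ _ _ (P := fun j : 'I_n.+1 => (n < j)%N)); last first.
  by move=> j; rewrite ltnNge -ltnS ltn_ord.
rewrite addr0 (eq_bigr (fun i : 'I_n => \sum_(j < n | (i < j)%N) c + c)); last first.
  move=> i _; rewrite big_mkcond big_ord_recr/= -big_mkcond/=.
  by rewrite ltn_ord.
by rewrite big_split/= IH sumr_const card_ord -[c *+ n]mulr_natl -(natr1 n); field.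
Qed.

End Mean_kendall.

Section Concentration.
Context {d : measure_display} {T : measurableType d} {R : realType}.
Variable P : probability T R.
Context {K n p r : nat}.
Variables (A : 'M[R]_p) (rho : 'I_K -> 'I_n -> T -> R) (u : 'I_K -> 'I_n -> T -> 'cV[R]_p).
Hypothesis hx : elliptical_sample P A rho u.
Variables (U : 'M[R]_(p, r)) (dl : 'rV[R]_r) (mu L : R).
Hypothesis AA : A *m A^T = mu%:M + U *m diag_mx dl *m U^T.
Hypothesis hU : orthonormal_cols U.
Hypothesis mu0 : 0 < mu.
Hypothesis muL : mu <= L.
Hypothesis hdl : forall j, 0 <= dl 0 j <= L - mu.
Hypothesis p_gt0 : (0 < p)%N.
Hypothesis n_gt1 : (1 < n)%N.
Hypothesis K_gt0 : (0 < K)%N.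
Hypothesis hKn : (16 * p <= K * n)%N.

Local Notation I := ('I_K * 'I_n)%type.

Let X (ki : I) := elliptical_obs A rho u ki.1 ki.2.
Let Z (ki : I) := radial rho u ki.
Let Au : A \in unitmx := spiked_root_unit AA mu0 hdl.
Let n0 : (0 < n)%N := ltnW n_gt1.
Let L0 : 0 < L. Proof. exact: lt_le_trans muL. Qed.
Let pR : 0 < p%:R :> R. Proof. by rewrite ltr0n. Qed.
Let KR : 0 < K%:R :> R. Proof. by rewrite ltr0n. Qed.
Let nR : 2 <= n%:R :> R. Proof. by rewrite ler_nat. Qed.

Let nR0 : n%:R != 0 :> R. Proof. by rewrite gt_eqF//; have := nR; lra. Qed.
Let nR1 : n%:R - 1 != 0 :> R. Proof. by rewrite gt_eqF//; have := nR; lra. Qed.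
Let KR0 : K%:R != 0 :> R. Proof. by rewrite gt_eqF. Qed.
Let LR0 : L != 0. Proof. by rewrite gt_eqF. Qed.

Let mX ki a : measurable_fun [set: T] (fun w => X ki w a 0).
Proof. exact: measurable_elliptical hx _ _. Qed.

Let mZ ki a : measurable_fun [set: T] (fun w => Z ki w a 0).
Proof. exact: measurable_radial hx _ _. Qed.

Let XZ ki kj w : X ki w - X kj w = A *m (Z ki w - Z kj w).
Proof. by rewrite mulmxBr -!elliptical_radial. Qed.

Let wt : R := 2 / (K%:R * (n%:R * (n%:R - 1))).

Let wt0 : 0 < wt.
Proof.
have n1 : 0 < n%:R - 1 :> R by have := nR; lra.
by rewrite divr_gt0// mulr_gt0// mulr_gt0// ltr0n.
Qed.

Let avg (F : I * I -> R) := wt *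
  \sum_(k < K) \sum_(i < n) \sum_(j < n | (i < j)%N) F ((k, i), (k, j)).

Let avg_cst c : avg (fun=> c) = c.
Proof.
rewrite /avg (eq_bigr (fun=> n%:R * (n%:R - 1) / 2 * c)); last by move=> k _; exact: sum_pairs.
rewrite sumr_const card_ord -[_ *+ K]mulr_natl /wt; field.
by rewrite ?nR0 ?nR1 ?KR0 ?LR0.
Qed.

Let le_avg F G : (forall x : I * I, x.1 != x.2 -> F x <= G x) -> avg F <= avg G.
Proof.
move=> FG; rewrite ler_wpM2l ?(ltW wt0)//; apply: ler_sum => k _.
apply: ler_sum => i _; apply: ler_sum => j ij; apply: FG => /=.
by apply/eqP => -[e]; rewrite e ltnn in ij.
Qed.

Let avgZ c F : c * avg F = avg (fun x => c * F x).
Proof.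
rewrite /avg mulrCA mulr_sumr; congr (_ * _); apply: eq_bigr => k _.
rewrite mulr_sumr; apply: eq_bigr => i _; rewrite mulr_sumr.
by apply: eq_bigr => j _.
Qed.

Let avgB F G : avg F - avg G = avg (fun x => F x - G x).
Proof.
rewrite /avg -mulrBr -sumrB; congr (_ * _); apply: eq_bigr => k _.
by rewrite -sumrB; apply: eq_bigr => i _; rewrite -sumrB.
Qed.

Let norm_avg F : `|avg F| <= avg (fun x => `|F x|).
Proof.
rewrite /avg normrM gtr0_norm// ler_pM2l//.
apply: (le_trans (ler_norm_sum _ _ _)); apply: ler_sum => k _.
apply: (le_trans (ler_norm_sum _ _ _)); apply: ler_sum => i _.
exact: ler_norm_sum.
Qed.

(** Each pair contributes its own no-tie probability to the mean, so the scale [g] of the signal is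
    their average. *)
Let gam : R := avg (fun x => no_tie P (Z x.1) (Z x.2)).

Let gam_bound : 2^-1 <= gam <= 1.
Proof.
rewrite -{1}(avg_cst 2^-1) -{2}(avg_cst 1) /gam; apply/andP; split; apply: le_avg => x x12.
  exact: (no_tie_ge (mZ x.1) (mZ x.2) (radial_pair_rotation hx Au x12) (radial_neq0 hx x.1)).
exact: (no_tie_le1 P (mZ x.1) (mZ x.2)).
Qed.

Let c0 : R := p%:R * mu / (48 * L).

Section Fixed_direction.
Variable v : 'cV[R]_p.
Hypothesis v2 : nsq v <= 2.

Let psi (x : I * I) (y : 'cV[R]_p) : R :=
  c0 * dirsq v y - Ex P (fun w => c0 * dirsq v (X x.1 w - X x.2 w)).

Let bpsi x : bmf (psi x : borel_type p -> R).
Proof.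
apply: bmfB; last exact: bmf_cst.
by apply: bmfZ; apply: (@bmf_dirsq R p _ (borel_type p)) => i; exact: measurable_borel_coord.
Qed.

Let mgf x t : x.1 != x.2 -> `|t| <= 2^-1 ->
  Ex P (fun w => expR (t * psi x (X x.1 w - X x.2 w))) <= expR (16 * t ^+ 2).
Proof.
move=> x12 t2.
have e : scaled_dirsq (Z x.1) (Z x.2) A mu L v =
    (fun w => c0 * dirsq v (X x.1 w - X x.2 w)).
  by apply/funext => w; rewrite XZ.
have := mgf_scaled p_gt0 (mZ x.1) (mZ x.2) (radial_pair_rotation hx Au x12)
  AA hU mu0 muL hdl v2 t2.
by rewrite e.
Qed.

Let bdirsq (x : I * I) : bmf (fun w => dirsq v (X x.1 w - X x.2 w)).
Proof. by apply: bmf_dirsq; apply: measurable_subv; exact: mX. Qed.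

Definition direction_stat := @ustat d T R K n p X psi.

Lemma direction_stat_measurable : measurable_fun [set: T] direction_stat.
Proof. by have [] := bmf_ustat mX bpsi. Qed.

Lemma direction_stat_tail t : 0 < t -> t <= 2^-1 ->
  (P [set w | (2 * 16 * t * (K * n)%:R <= `|direction_stat w|)%R] <=
   (2 * expR (- (16 * t ^+ 2 * (K * n)%:R)))%:E)%E.
Proof. exact: (ustat_deviation mX (es_indep hx) n0 bpsi mgf). Qed.

Lemma direction_stat_bound w t :
    `|direction_stat w| <= 32 * t * (K * n)%:R -> 0 <= t ->
  `|dot v ((p%:R * mu *: mean_kendall (fun k i => elliptical_obs A rho u k i w)
      - gam *: (A *m A^T)) *m v)| <= 48 * 128 * L * t + 48 * 192 * r%:R * L ^+ 2 / (mu * p%:R).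
Proof.
move=> hw t0.
pose e x := Ex P (fun w => dirsq v (X x.1 w - X x.2 w)).
have E1 : dot v (mean_kendall (fun k i => elliptical_obs A rho u k i w) *m v) =
    avg (fun x => dirsq v (X x.1 w - X x.2 w)) by rewrite dot_mean_kendall.
(* Splits the form into the centred statistic, with the normalizations [c0], [wt] and 1/n undone,
   and the average of the expectations. *)
have E2 : p%:R * mu * avg (fun x => dirsq v (X x.1 w - X x.2 w)) =
    48 * L * (2 / (K%:R * (n%:R - 1))) * direction_stat w + p%:R * mu * avg e.
  have -> : direction_stat w = n%:R^-1 * (wt^-1 * (c0 * (avg (fun x => dirsq v (X x.1 w - X x.2 w)) - avg e))).
    rewrite /direction_stat /ustat; congr (_ * _).
    rewrite /avg -mulrBr [c0 * _]mulrCA mulKf ?(gt_eqF wt0)//.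
    rewrite -sumrB mulr_sumr; apply: eq_bigr => k _.
    rewrite -sumrB mulr_sumr; apply: eq_bigr => i _.
    rewrite -sumrB mulr_sumr; apply: eq_bigr => j _.
    by rewrite /psi /e (ExZ P c0 (bdirsq ((k, i), (k, j)))) mulrBr.
  rewrite /c0 /wt; field.
  by rewrite ?nR0 ?nR1 ?KR0 ?LR0.
have E3 : `|p%:R * mu * avg e - gam * dot v (A *m A^T *m v)| <= 48 * 192 * r%:R * L ^+ 2 / (mu * p%:R).
  rewrite avgZ [gam * _]mulrC avgZ avgB; apply: (le_trans (norm_avg _)).
  rewrite -[leRHS]avg_cst; apply: le_avg => x x12.
  have := mean_dirsq p_gt0 (mZ x.1) (mZ x.2) (radial_pair_rotation hx Au x12)
    AA hU mu0 muL hdl v2.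
  have -> : (fun w => dirsq v (A *m (Z x.1 w - Z x.2 w))) =
      (fun w => dirsq v (X x.1 w - X x.2 w)) by apply/funext => w'; rewrite XZ.
  by rewrite [_ * dot v _]mulrC.
rewrite dot_scale_sub E1 E2 -addrA.
apply: (le_trans (ler_normD _ _)); apply: lerD => //.
have n1 : 0 < n%:R - 1 :> R by rewrite subr_gt0 (lt_le_trans _ nR)// ltr1n.
have q0 : 0 <= 48 * L * (2 / (K%:R * (n%:R - 1))).
  by rewrite mulr_ge0// ?divr_ge0// ?mulr_ge0// ltW.
rewrite normrM ger0_norm//.
apply: (le_trans (ler_wpM2l q0 hw)).
(* With n >= 2 the quotient n / (n - 1) is at most 2, which turns 48 * 64 into 48 * 128. *)
have -> : 48 * L * (2 / (K%:R * (n%:R - 1))) * (32 * t * (K * n)%:R) =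
    48 * 64 * L * t * (n%:R / (n%:R - 1)).
  by rewrite natrM; field; rewrite ?nR0 ?nR1 ?KR0.
have -> : 48 * 128 * L * t = 48 * 64 * L * t * 2 by ring.
rewrite ler_wpM2l ?mulr_ge0// ?(ltW L0)//.
exact: div_pred_le2.
Qed.

End Fixed_direction.

Lemma mean_kendall_concentration (k1 k2 : R) :
    k1 = 48 * 256 -> k2 = 48 * 192 ->
  exists g : R, 2^-1 <= g <= 1 /\ exists B : set T, [/\ measurable B,
    (P B <= (2 * (2 ^+ (36 * p) * 3 ^+ p) * expR (- (64 * p%:R)))%:E)%E &
    forall w, ~ B w -> forall v : 'cV[R]_p,
      `|dot v ((p%:R * mu *: mean_kendall (fun k i => elliptical_obs A rho u k i w)
         - g *: (A *m A^T)) *m v)| <=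
      2 * (k1 * L * Num.sqrt (p%:R / (K * n)%:R) + k2 * r%:R * L ^+ 2 / (mu * p%:R)) * nsq v].
Proof.
move=> -> ->.
exists gam; split; first exact: gam_bound.
(* This [t] makes the tail exponent 16 t^2 K n equal to 64 p, and 16 p <= K n gives q <= 1/4, so
   that t <= 1/2 is admissible. It also turns 48 * 128 into [k1]. *)
set q := Num.sqrt _; pose t := 2 * q.
have N0 : 0 < (K * n)%:R :> R by rewrite ltr0n muln_gt0 K_gt0.
have q2 : q ^+ 2 = p%:R / (K * n)%:R by rewrite sqr_sqrtr// divr_ge0// ltW.
have q0 : 0 < q by rewrite sqrtr_gt0 divr_gt0.
have t0 : 0 < t by rewrite mulr_gt0.
have t2 : t <= 2^-1.
  have : q <= 4^-1.
    rewrite -(@ler_pXn2r _ 2) ?nnegrE ?(ltW q0)// q2 ler_pdivrMr//.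
    by move: hKn; rewrite -(ler_nat R) natrM; lra.
  by rewrite /t; lra.
pose S k := [set w | (2 * 16 * t * (K * n)%:R <= `|direction_stat (lattice_point k) w|)%R].
have mS k : measurable (S k).
  have mc : measurable_fun [set: T] (fun=> 2 * 16 * t * (K * n)%:R : R) by exact: measurable_cst.
  have mn : measurable_fun [set: T] (fun w => `|direction_stat (lattice_point k) w|).
    by apply: measurableT_comp => //; exact: direction_stat_measurable.
  by have := measurable_fun_ler mc mn measurableT (Logic.I : measurable [set true]); rewrite setTI.
exists (\bigcup_(k in [set k | k \in lattice_net p]) S k); split.
- by apply: fin_bigcup_measurable => //; exact: finite_finset.
- have bS k : bmf (\1_(S k) : T -> R) by exact: bmf_indic.
  apply: (le_trans (@prob_le_Ex _ _ _ P _ (fun w => \sum_(k in lattice_net p) \1_(S k) w) _ _ _ _)).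
  + by apply: fin_bigcup_measurable => //; exact: finite_finset.
  + by apply: bmf_sum => k _; exact: bS.
  + by move=> w; apply: sumr_ge0 => k _; rewrite indicE ler0n.
  + move=> w [k kN' Skw]; have kN : k \in lattice_net p := kN'.
    rewrite (bigD1 k kN) indicE (mem_set Skw) lerDl.
    by apply: sumr_ge0 => j _; rewrite indicE ler0n.
  rewrite lee_fin Ex_sum; last by move=> k _; exact: bS.
  apply: (@le_trans _ _ (\sum_(k in lattice_net p) 2 * expR (- (64 * p%:R)))).
    apply: ler_sum => k kN; rewrite Ex_indic// -lee_fin fineK; last exact: fin_num_measure.
    have := direction_stat_tail (nsq_lattice_net p_gt0 kN) t0 t2.
    have -> : 16 * t ^+ 2 * (K * n)%:R = 64 * p%:R.
      by rewrite /t exprMn q2; field; rewrite ?KR0 ?nR0.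
    by [].
  rewrite sumr_const -[leLHS]mulr_natr [leLHS]mulrAC ler_wpM2r ?expR_ge0//.
  by rewrite ler_wpM2l// card_lattice_net.
- move=> w Bw; apply: lattice_net_form => //.
    by apply: trmx_scale_sub; [exact: mean_kendall_tr|rewrite trmx_mul trmxK].
  move=> k kN.
  have -> : 48 * 256 * L * q = 48 * 128 * L * t by rewrite /t; ring.
  apply: direction_stat_bound; [exact: nsq_lattice_net| |exact: ltW].
  have [h|h] := leP (2 * 16 * t * (K * n)%:R) `|direction_stat (lattice_point k) w|.
    by case: Bw; exists k.
  by apply: (le_trans (ltW h)); rewrite -natrM.
Qed.

End Concentration.

(** * Two iterations *)

Section Two_steps.
Context {R : realType}.

(** Permits the rescaling of the averaged Kendall matrix by p mu, since the orthonormal factor is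
    unaffected. *)
Lemma is_qr_factorZ p r (a : R) (G Q : 'M[R]_(p, r)) :
  is_qr_factor G Q -> is_qr_factor (a *: G) Q.
Proof.
move=> [hQ [S [tS ->]]]; split => //; exists (a *: S); split; last by rewrite scalemxAr.
apply/is_trig_mxP => i j ij; rewrite !mxE.
by have /is_trig_mxP/(_ i j ij) := tS; rewrite mxE => ->; rewrite mulr0.
Qed.

Lemma shifted_power_scale p r (a k : R) (M C : 'M[R]_p) (V : 'M[R]_(p, r)) :
  a *: (M *m V - (k * \tr (M *m C)) *: V) =
  (a *: M) *m V - (k * \tr ((a *: M) *m C)) *: V.
Proof. by rewrite -!scalemxAl mxtraceZ scalerBr scalerA mulrCA. Qed.

Lemma mean_local_update K n p r (x : 'I_K -> 'I_n -> 'cV[R]_p) (V : 'M[R]_(p, r)) :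
  K%:R^-1 *: \sum_(k < K) local_update (x k) V =
  mean_kendall x *m V -
  ((p%:R - r%:R)^-1 * \tr (mean_kendall x *m coproj V)) *: V.
Proof.
rewrite /local_update big_split/= scalerDr /mean_kendall -scalemxAl mulmx_suml.
congr (_ + _); rewrite sumrN scalerN -scaler_suml scalerA; congr (- (_ *: _)).
rewrite -scalemxAl mxtraceZ mulmx_suml linear_sum/= /local_shift -mulr_sumr.
by rewrite mulrCA.
Qed.

Lemma two_steps K n p r (x : 'I_K -> 'I_n -> 'cV[R]_p) (U V1 V2 V3 : 'M[R]_(p, r))
    (S : 'M[R]_p) (D : 'rV[R]_r) (a g mu L dl e c e' : R) :
    (r < p)%N -> orthonormal_cols U -> orthonormal_cols V1 ->
    0 <= a -> 2^-1 <= g <= 1 -> 0 < dl -> (forall j, dl <= D 0 j <= L) ->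
    S = mu%:M + U *m diag_mx D *m U^T -> S^T = S ->
    (forall v : 'cV[R]_p, `|dot v ((a *: mean_kendall x - g *: S) *m v)| <= e * nsq v) ->
    0 <= e -> 0 <= c < 1 -> opnorm (V1 *m V1^T - U *m U^T) <= c ->
    e' = 2 * e + r%:R * L / (p%:R - r%:R) ->
    e' <= dl * Num.sqrt (1 - c ^+ 2) / 8 ->
    iteration_step x V1 V2 -> iteration_step x V2 V3 ->
  frobenius (V3 *m V3^T - U *m U^T) <= Num.sqrt (2 * r%:R) * (4 / dl * e').
Proof.
move=> rp hU hV1 a0 /andP[g2 g1] dl0 hD SE ST hE e0 /andP[c0 c1] hc e'E e's h12 h23.
set E := a *: mean_kendall x - g *: S in hE.
have Es : E^T = E by apply: trmx_scale_sub => //; exact: mean_kendall_tr.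
have HE : a *: mean_kendall x = g *: (mu%:M + U *m diag_mx D *m U^T) + E.
  by rewrite -SE /E addrC subrK.
have step (V V' : 'M[R]_(p, r)) : iteration_step x V V' ->
    is_qr_factor ((g *: (mu%:M + U *m diag_mx D *m U^T) + E) *m V -
     ((p%:R - r%:R)^-1 * \tr ((g *: (mu%:M + U *m diag_mx D *m U^T) + E) *m coproj V)) *: V) V'.
  move=> /(is_qr_factorZ a); by rewrite mean_local_update shifted_power_scale HE.
have pr : 0 < p%:R - r%:R :> R by rewrite subr_gt0 ltr_nat.
have rL0 : 0 <= r%:R * L.
  case: (posnP r) => [->|r0]; first by rewrite mul0r.
  have /andP[h1 h2] := hD (Ordinal r0).
  by rewrite mulr_ge0// (le_trans (ltW dl0) (le_trans h1 h2)).
have e'0 : 0 <= e' by rewrite e'E addr_ge0//; [rewrite mulr_ge0|rewrite divr_ge0// ltW].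
have g01 : 0 <= g <= 1 by rewrite g1 andbT (le_trans _ g2).
have c2 : c ^+ 2 < 1 by rewrite expr_lt1.
set s := Num.sqrt (1 - c ^+ 2) in e's *.
have s0 : 0 < s by rewrite sqrtr_gt0 subr_gt0.
have s1 : s <= 1 by rewrite -(sqrtr1 R) ler_wsqrtr// gerBl sqr_ge0.
have ds0 : 0 < dl * s by rewrite mulr_gt0.
have dsd : dl * s <= dl by rewrite ler_piMr// ltW.
pose eta1 := g * dl * s - e'.
(* From g >= 1/2 and e' <= dl s / 8; the ratio e' / eta1 is then at most (1/8) / (3/8) = 1/3. *)
have eta1_ge : 3 / 8 * (dl * s) <= eta1.
  have : 2^-1 * (dl * s) <= g * (dl * s) by rewrite ler_wpM2r// ltW.
  by rewrite /eta1 -mulrA; move: e's; lra.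
have eta1_gt0 : 0 < eta1 by apply: lt_le_trans eta1_ge; lra.
have close1 (y : 'cV[R]_r) : frobenius (coproj U *m (V1 *m y)) <= c * frobenius y.
  have -> : coproj U *m (V1 *m y) = (V1 *m V1^T - U *m U^T) *m (V1 *m y).
    rewrite /coproj !mulmxBl mul1mx; congr (_ - _).
    by rewrite -mulmxA (mulmxA V1^T) hV1 mul1mx.
  apply: (le_trans (opnorm_ub _ _)); rewrite frobenius_orthonormal//.
  by rewrite ler_wpM2r ?frobenius_ge0.
have cc : 0 <= c <= 1 by rewrite c0 ltW.
have close2 := subspace_step rp hU hV1 Es e0 hE g01 (ltW dl0) hD cc close1 e'E (erefl eta1)
  eta1_gt0 (step _ _ h12).
have hV2 : orthonormal_cols V2 by case: h12.
have hV3 : orthonormal_cols V3 by case: h23.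
have close2' (y : 'cV[R]_r) : frobenius (coproj U *m (V2 *m y)) <= 3^-1 * frobenius y.
  apply: (le_trans (close2 y)); rewrite ler_wpM2r ?frobenius_ge0//.
  by rewrite ler_pdivrMr//; lra.
have c3 : 0 <= (3^-1 : R) <= 1 by lra.
pose eta2 := g * dl * Num.sqrt (1 - 3^-1 ^+ 2) - e'.
have s3 : 3 / 4 <= Num.sqrt (1 - 3^-1 ^+ 2) :> R.
  rewrite -[leLHS]ger0_norm; last by lra.
  by rewrite -sqrtr_sqr ler_wsqrtr//; lra.
(* The expansion is at least dl / 2 times 3/4, and e' <= dl / 8 since s <= 1; this is the source of
   the final factor 4 / dl. *)
have eta2_ge : dl / 4 <= eta2.
  have h1 : 2^-1 * dl <= g * dl by rewrite ler_wpM2r// ltW.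
  have h2 : (2^-1 * dl) * (3 / 4) <= g * dl * Num.sqrt (1 - 3^-1 ^+ 2).
    by apply: ler_pM => //; rewrite mulr_ge0// ltW.
  by rewrite /eta2; lra.
have eta2_gt0 : 0 < eta2 by apply: lt_le_trans eta2_ge; rewrite divr_gt0.
have close3 := subspace_step rp hU hV2 Es e0 hE g01 (ltW dl0) hD c3 close2' e'E (erefl eta2)
  eta2_gt0 (step _ _ h23).
apply: (projection_distance hU hV3); first by rewrite mulr_ge0// divr_ge0// ltW.
move=> y; apply: (le_trans (close3 y)); rewrite ler_wpM2r ?frobenius_ge0//.
rewrite [leRHS]mulrC ler_wpM2l// -[leRHS]invf_div lef_pV2 ?posrE ?divr_gt0//.
Qed.

End Two_steps.

Section Limits.
Context {R : realType}.

Lemma eventually_ge (f : nat -> nat) (x : R) :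
  f @ \oo --> \oo -> \forall m \near \oo, x <= (f m)%:R.
Proof.
by move=> /(@cvgrnyP R) /cvgryPge.
Qed.

(** With 2 <= e and 3 <= e^2 the net has at most exp(38 p) points; the remaining exp(-26 p) is
    weakened to exp(-p) <= 1 / (1 + p). *)
Lemma net_probability_bound (p : nat) :
  2 * (2 ^+ (36 * p) * 3 ^+ p) * expR (- (64 * p%:R)) <= 2 / (1 + p%:R) :> R.
Proof.
have e2 : 2 <= expR 1 :> R by have := expR_ge1Dx (1 : R); lra.
have h2 : 2 ^+ (36 * p) <= expR (36 * p%:R) :> R.
  rewrite (_ : 36 * p%:R = (36 * p)%:R * 1); last by rewrite natrM mulr1.
  by rewrite expRM_natl lerXn2r ?nnegrE ?expR_ge0.
have h3 : 3 ^+ p <= expR (2 * p%:R) :> R.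
  rewrite (_ : 2 * p%:R = p%:R * 2); last by rewrite mulrC.
  rewrite expRM_natl lerXn2r ?nnegrE ?expR_ge0//.
  have -> : 2 = 1 + 1 :> R by [].
  rewrite expRD; nra.
rewrite -mulrA ler_wpM2l//.
apply: (@le_trans _ _ (expR (36 * p%:R) * expR (2 * p%:R) * expR (- (64 * p%:R)))).
  by rewrite ler_wpM2r ?expR_ge0// ler_pM ?exprn_ge0.
rewrite -!expRD.
apply: (@le_trans _ _ (expR (- p%:R))).
  by rewrite ler_expR; have := ler0n R p; lra.
rewrite expRN lef_pV2 ?posrE ?expR_gt0 ?expR_ge1Dx// ltr_wpDr.
Qed.

(** Monotonicity of the probability is applied to this event, so it has to be measurable; the
    entries of the iterate being random variables is used here. *)
Lemma measurable_projection_distance d (T : measurableType d) p r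
    (Q : T -> 'M[R]_(p, r)) (C : 'M[R]_p) (a : R) :
  random_matrix Q -> measurable [set w | (a < `|frobenius (Q w *m (Q w)^T - C)|)%R].
Proof.
move=> mQ.
have mf : measurable_fun [set: T] (fun w => `|frobenius (Q w *m (Q w)^T - C)|).
  apply: measurableT_comp => //.
  apply: (measurableT_comp (continuous_measurable_fun (@sqrt_continuous R))).
  apply: measurable_sum => i; apply: measurable_sum => j; apply: measurable_funX.
  rewrite (_ : (fun w => _) = fun w => (\sum_k Q w i k * Q w j k) - C i j); last first.
    by apply/funext => w; rewrite !mxE; congr (_ - _); apply: eq_bigr => k _; rewrite mxE.
  apply: measurable_funB; last exact: measurable_cst.
  by apply: measurable_sum => k; apply: measurable_funM; exact: mQ.
have mc : measurable_fun [set: T] (fun=> a : R) by exact: measurable_cst.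
by have := measurable_fun_ltr mc mf measurableT (Logic.I : measurable [set true]); rewrite setTI.
Qed.

Lemma sorted_tuple_bounds r (lam : r.-tuple R) j : sorted >=%R lam ->
  last 0 lam <= tnth lam j <= head 0 lam.
Proof.
move=> hs.
have tr : transitive (>=%R : rel R) by move=> y x z /= h1 h2; exact: le_trans h2 h1.
have h := sorted_leq_nth tr (fun x => lexx x) 0 hs.
have r0 : (0 < r)%N by apply: leq_ltn_trans (ltn_ord j).
rewrite (tnth_nth 0) -nth0 -nth_last size_tuple.
by apply/andP; split; apply: h; rewrite ?inE ?size_tuple//; case: (r) j r0 => // k j _; rewrite /= -ltnS.
Qed.

End Limits.

Section Rates.
Context {R : realType}.

(* With [rate ^ 2 = r p ln p / (K n)], the growth conditions give
   [1 / p <= C4 rate ^ 2] and [rate ^ 2 <= r / (C5 K)]. *)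
Lemma rate_bounds (r K n p : nat) (C4 C5 C6 alpha mu L k1 k2 : R) :
    (0 < r)%N -> 0 < k1 -> 0 < k2 -> 0 < C4 -> 0 < C5 -> 0 < C6 -> alpha < 2^-1 ->
    1 <= K%:R :> R -> 2 <= n%:R :> R -> expR 1 <= p%:R :> R -> (2 * r)%:R <= p%:R :> R ->
    K%:R * n%:R <= C4 * p%:R ^+ 2 * ln p%:R ->
    C5 * p%:R * ln p%:R <= n%:R ->
    0 < mu -> 0 < L -> L / mu <= C6 * p%:R `^ alpha ->
  let rate := Num.sqrt (r%:R * p%:R * ln p%:R / (K%:R * n%:R)) in
  let e := 2 * (k1 * L * Num.sqrt (p%:R / (K * n)%:R)
             + k2 * r%:R * L ^+ 2 / (mu * p%:R)) in
  2 * e + r%:R * L / (p%:R - r%:R) <=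
    (4 * (k1 * L + k2 * r%:R * L * C6 * Num.sqrt C4) + 2 * r%:R * L * Num.sqrt C4) * rate
  /\ rate ^+ 2 <= r%:R / C5 / K%:R.
Proof.
move=> r0 k10 k20 C40 C50 C60 a2 K1 n2 pe p2r hKn hn mu0 L0 hL rate e.
have e1 : 2 <= expR 1 :> R by have := expR_ge1Dx (1 : R); lra.
have pR1 : 1 <= p%:R :> R by lra.
have pR0 : 0 < p%:R :> R by lra.
have K0 : 0 < K%:R :> R by lra.
have n0 : 0 < n%:R :> R by lra.
have rR : 1 <= r%:R :> R by rewrite ler1n.
have lnp : 1 <= ln p%:R :> R.
  by rewrite -[leLHS]expRK ler_ln ?posrE ?expR_gt0.
have lnp0 : 0 < ln p%:R :> R by lra.
have Kn0 : 0 < K%:R * n%:R :> R by rewrite mulr_gt0.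
have rp : r%:R * p%:R * ln p%:R >= p%:R :> R.
  have h1 : p%:R <= r%:R * p%:R :> R by rewrite ler_peMl// ltW.
  by apply: (le_trans h1); rewrite ler_peMr// mulr_ge0.
have rate2 : rate ^+ 2 = r%:R * p%:R * ln p%:R / (K%:R * n%:R).
  by rewrite sqr_sqrtr// divr_ge0// ltW// (lt_le_trans _ rp).
have rate0 : 0 <= rate by exact: sqrtr_ge0.
set q := Num.sqrt (p%:R / (K * n)%:R) in e *.
have qr : q <= rate by rewrite /q /rate natrM ler_wsqrtr// ler_pM2r ?invr_gt0.
have hs : (Num.sqrt p%:R)^-1 <= Num.sqrt C4 * rate.
  rewrite -(@ler_pXn2r _ 2) ?nnegrE ?invr_ge0 ?mulr_ge0 ?sqrtr_ge0//.
  rewrite exprVn exprMn rate2 !sqr_sqrtr ?(ltW C40) ?ler0n//.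
  rewrite mulrA ler_pdivlMr// mulrC ler_pdivrMr//.
  apply: (le_trans hKn); rewrite -subr_ge0.
  have -> : C4 * (r%:R * p%:R * ln p%:R) * p%:R - C4 * p%:R ^+ 2 * ln p%:R =
    C4 * p%:R ^+ 2 * ln p%:R * (r%:R - 1) by ring.
  by rewrite mulr_ge0 ?subr_ge0// mulr_ge0 ?(ltW lnp0)// mulr_ge0 ?sqr_ge0// ltW.
have sp0 : 0 < Num.sqrt p%:R :> R by rewrite sqrtr_gt0.
have sp1 : 1 <= Num.sqrt p%:R :> R by rewrite -{1}(sqrtr1 R) ler_wsqrtr.
have spp : Num.sqrt p%:R ^+ 2 = p%:R :> R by rewrite sqr_sqrtr.
have ip : p%:R^-1 = (Num.sqrt p%:R)^-1 * (Num.sqrt p%:R)^-1 :> R.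
  by rewrite -invfM -expr2 spp.
have is1 : (Num.sqrt p%:R)^-1 <= 1 :> R by rewrite invf_le1.
have b1 : k2 * r%:R * L ^+ 2 / (mu * p%:R) <=
    k2 * r%:R * L * C6 * Num.sqrt C4 * rate.
  have -> : k2 * r%:R * L ^+ 2 / (mu * p%:R) = k2 * r%:R * L * (L / mu * p%:R^-1).
    by field; rewrite !gt_eqF.
  have -> : k2 * r%:R * L * C6 * Num.sqrt C4 * rate =
      k2 * r%:R * L * (C6 * (Num.sqrt C4 * rate)) by ring.
  apply: ler_wpM2l; first by rewrite !mulr_ge0 ?(ltW L0) ?(ltW k20).
  (* Here alpha < 1/2 enters: L / (mu p) is at most C6 / sqrt p, which the growth condition bounds
     by the rate. *)
  have pa : p%:R `^ alpha <= Num.sqrt p%:R :> R.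
    by rewrite -powR12_sqrt ?ler0n// ler_powR// ltW.
  apply: (@le_trans _ _ (C6 * Num.sqrt p%:R * p%:R^-1)).
    by rewrite ler_wpM2r ?invr_ge0// (le_trans hL)// ler_wpM2l// ltW.
  by rewrite -mulrA ler_wpM2l ?(ltW C60)// ip mulrA mulfV ?gt_eqF// mul1r.
have b2 : r%:R * L / (p%:R - r%:R) <= 2 * r%:R * L * Num.sqrt C4 * rate.
  have h2 : p%:R / 2 <= p%:R - r%:R :> R by move: p2r; rewrite natrM; lra.
  have h3 : (p%:R - r%:R)^-1 <= (p%:R / 2)^-1 :> R.
    by rewrite lef_pV2 ?posrE//; lra.
  apply: (@le_trans _ _ (r%:R * L * (2 * (Num.sqrt p%:R)^-1))).
    rewrite ler_wpM2l ?mulr_ge0 ?(ltW L0)//; apply: (le_trans h3).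
    by rewrite invf_div ler_wpM2l// ip ler_piMl// invr_ge0 ltW.
  have -> : 2 * r%:R * L * Num.sqrt C4 * rate = r%:R * L * (2 * (Num.sqrt C4 * rate)) by ring.
  by rewrite ler_wpM2l ?mulr_ge0 ?(ltW L0)// ler_wpM2l.
have b3 : k1 * L * q <= k1 * L * rate.
  by rewrite ler_wpM2l// mulr_ge0 ?(ltW L0)// ltW.
split.
  rewrite /e; move: b1 b2 b3.
  set x1 := _ / (mu * p%:R); set x2 := _ / (p%:R - r%:R); set x3 := _ * q; set x4 := _ * rate.
  rewrite /x4; lra.
rewrite rate2 ler_pdivrMr//.
have -> : r%:R / C5 / K%:R * (K%:R * n%:R) = r%:R / C5 * n%:R by field; rewrite !gt_eqF.
have -> : r%:R * p%:R * ln p%:R = r%:R / C5 * (C5 * p%:R * ln p%:R).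
  by field; rewrite gt_eqF.
by apply: ler_wpM2l => //; rewrite divr_ge0// ltW.
Qed.

End Rates.

(** * Assembly: the deterministic two-step bound off the exceptional event *)

Theorem corollary3p14 (R : realType)
  (* constants *)
  (r : nat) (lam : r.-tuple R) (C4 C5 C6 d alpha c : R)
  (hr : (0 < r)%N) (hC4 : 0 < C4) (hC5 : 0 < C5) (hC6 : 0 < C6) (hd : 0 < d)
  (halpha : 0 < alpha < 2^-1) (hc : c < 1)
  (* an arbitrary regime in which K, n and p tend to infinity *)
  (K n p : nat -> nat)
  (hK : K @ \oo --> \oo) (hn : n @ \oo --> \oo) (hp : p @ \oo --> \oo)
  (disp : nat -> measure_display) (T : forall m, measurableType (disp m))
  (P : forall m, probability (T m) R)
  (* elliptical data *)
  (A : forall m, 'M[R]_(p m))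
  (rho : forall m, 'I_(K m) -> 'I_(n m) -> T m -> R)
  (u : forall m, 'I_(K m) -> 'I_(n m) -> T m -> 'cV[R]_(p m))
  (hx : forall m, elliptical_sample (P m) (A m) (@rho m) (@u m))
  (mu : nat -> R) (U : forall m, 'M[R]_(p m, r))
  (hSigma : forall m, spiked_scatter (A m *m (A m)^T) lam (mu m) (U m))
  (* growth and eigenvalue conditions *)
  (hKn : \forall m \near \oo,
     (K m)%:R * (n m)%:R <= C4 * (p m)%:R ^+ 2 * ln (p m)%:R)
  (hnp : \forall m \near \oo, C5 * (p m)%:R * ln (p m)%:R <= (n m)%:R)
  (hgap : \forall m \near \oo, mu m + d <= last 0 lam)
  (hcond : \forall m \near \oo,
     0 < mu m /\ head 0 lam / mu m <= C6 * (p m)%:R `^ alpha)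
  (* the initial estimator and two iterations *)
  (U1 U2 U3 : forall m, T m -> 'M[R]_(p m, r))
  (hU1 : forall m, random_matrix (@U1 m))
  (hU2 : forall m, random_matrix (@U2 m))
  (hU3 : forall m, random_matrix (@U3 m))
  (hU1_orth : forall m w, orthonormal_cols (U1 m w))
  (hU1_close : forall m w,
     opnorm (U1 m w *m (U1 m w)^T - U m *m (U m)^T) <= c)
  (hstep1 : forall m w,
     iteration_step (fun k i => elliptical_obs (A m) (@rho m) (@u m) k i w)
       (U1 m w) (U2 m w))
  (hstep2 : forall m w,
     iteration_step (fun k i => elliptical_obs (A m) (@rho m) (@u m) k i w)
       (U2 m w) (U3 m w)) :
  is_Op P
    (fun m w => frobenius (U3 m w *m (U3 m w)^T - U m *m (U m)^T))
    (fun m => Num.sqrt (r%:R * (p m)%:R * ln (p m)%:R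
                        / ((K m)%:R * (n m)%:R))).
Proof.
set L := head 0 lam.
have lamb j : last 0 lam <= tnth lam j <= L.
  exact: sorted_tuple_bounds (ss_sorted (hSigma 0%N)).
have c0 : 0 <= c.
  exact: le_trans (opnorm_ge0 _) (hU1_close 0%N point).
have c2 : c ^+ 2 < 1 by rewrite expr_lt1.
pose s := Num.sqrt (1 - c ^+ 2).
have s0 : 0 < s by rewrite sqrtr_gt0 subr_gt0.
pose rate m : R := Num.sqrt (r%:R * (p m)%:R * ln (p m)%:R / ((K m)%:R * (n m)%:R)).
have [k1 k1E] : exists k1 : R, k1 = 48 * 256 by eexists.
have [k2 k2E] : exists k2 : R, k2 = 48 * 192 by eexists.
have k10 : 0 < k1 by rewrite k1E; apply: mulr_gt0; exact: ltr0Sn.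
have k20 : 0 < k2 by rewrite k2E; apply: mulr_gt0; exact: ltr0Sn.
pose C := 4 * (k1 * L + k2 * r%:R * L * C6 * Num.sqrt C4) + 2 * r%:R * L * Num.sqrt C4.
have L0 : 0 < L.
  have /andP[h1 h2] := lamb (Ordinal hr).
  by apply: lt_le_trans (le_trans h1 h2); exact: le_lt_trans (ss_bulk_ge0 (hSigma 0%N)) (ss_bulk_lt (hSigma 0%N)).
have C0 : 0 < C.
  have h1 : 0 < k1 * L by rewrite mulr_gt0.
  have h2 : 0 <= k2 * r%:R * L * C6 * Num.sqrt C4.
    by rewrite !mulr_ge0 ?sqrtr_ge0 ?(ltW L0) ?(ltW hC6) ?(ltW k20).
  have h3 : 0 <= 2 * r%:R * L * Num.sqrt C4.
    by rewrite !mulr_ge0 ?sqrtr_ge0 ?(ltW L0).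
  by apply: ltr_pwDl => //; apply: mulr_gt0 => //; exact: ltr_pwDl.
(* This constant depends neither on [eps] nor on [c]; both only decide how large [m] has to be. *)
move=> eps eps0; exists (Num.sqrt (2 * r%:R) * (4 / d * C)).
  apply: mulr_gt0; first by rewrite sqrtr_gt0 mulr_gt0// ltr0n.
  by apply: mulr_gt0 => //; exact: divr_gt0.
near=> m.
have [mu0 hL] : 0 < mu m /\ L / mu m <= C6 * (p m)%:R `^ alpha by near: m.
have hg : mu m + d <= last 0 lam by near: m.
have hKn' : (K m)%:R * (n m)%:R <= C4 * (p m)%:R ^+ 2 * ln (p m)%:R by near: m.
have hnp' : C5 * (p m)%:R * ln (p m)%:R <= (n m)%:R by near: m.
have K1 : 1 <= (K m)%:R :> R by near: m; exact: eventually_ge.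
have n2 : 2 <= (n m)%:R :> R by near: m; exact: eventually_ge.
have pe : expR 1 <= (p m)%:R :> R by near: m; exact: eventually_ge.
have p2r : (2 * r)%:R <= (p m)%:R :> R by near: m; exact: eventually_ge.
(* This threshold brings 2 / (1 + p) below [eps]. The two that follow, on K, give 16 p <= K n and
   make the perturbation C rate at most d s / 8, as the first step requires. *)
have p_eps : 2 / eps <= (p m)%:R :> R by near: m; exact: eventually_ge.
have K5 : 16 / C5 <= (K m)%:R :> R by near: m; exact: eventually_ge.
have Krate : r%:R / C5 * (8 * C / (d * s)) ^+ 2 <= (K m)%:R :> R by near: m; exact: eventually_ge.
have [erate rate2] := rate_bounds hr k10 k20 hC4 hC5 hC6 (proj2 (andP halpha)) K1 n2 pe p2r hKn' hnp' mu0 L0 hL.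
rewrite -/(rate m) -/C in erate rate2.
have ds0 : 0 < d * s by rewrite mulr_gt0.
have rate_small : C * rate m <= d * s / 8.
  have q0 : 0 < 8 * C / (d * s) by rewrite divr_gt0// mulr_gt0.
  have Km0 : 0 < (K m)%:R :> R by exact: lt_le_trans ltr01 K1.
  have h : rate m <= (8 * C / (d * s))^-1.
    rewrite -(@ler_pXn2r _ 2) ?nnegrE ?sqrtr_ge0 ?invr_ge0 ?(ltW q0)//.
    apply: (le_trans rate2); rewrite exprVn ler_pdivrMr// [leRHS]mulrC ler_pdivlMr ?exprn_gt0//.
  rewrite mulrC; apply: (le_trans (ler_wpM2r (ltW C0) h)).
  by rewrite le_eqVlt; apply/orP; left; apply/eqP; field; rewrite !gt_eqF.
have p0 : (0 < p m)%N by rewrite -(ltr_nat R); apply: lt_le_trans (expR_gt0 1) pe.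
have n1 : (1 < n m)%N by rewrite -(ler_nat R).
have K0 : (0 < K m)%N by rewrite -(ler_nat R).
have lnp : 1 <= ln (p m)%:R :> R.
  by rewrite -[leLHS]expRK ler_ln ?posrE ?expR_gt0// ltr0n.
have h16 : (16 * p m <= K m * n m)%N.
  rewrite -(ler_nat R) !natrM.
  have h1 : C5 * (p m)%:R <= (n m)%:R by apply: le_trans hnp'; rewrite ler_peMr// mulr_ge0// ltW.
  apply: (@le_trans _ _ (16 / C5 * (C5 * (p m)%:R))).
    by rewrite mulrA divfK// gt_eqF.
  by apply: ler_pM => //; rewrite ?divr_ge0 ?mulr_ge0// ltW.
have [rp spec _ _ _ hUm _] := hSigma m.
pose S := A m *m (A m)^T.
have ST : S^T = S by rewrite /S trmx_mul trmxK.
have SE := spiked_decomposition ST (hSigma m).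
have muL : mu m <= L.
  have /andP[h1 h2] := lamb (Ordinal hr).
  by apply: le_trans (le_trans h1 h2); apply: le_trans hg; rewrite lerDl ltW.
have dl1 j : 0 <= (\row_j (tnth lam j - mu m)) 0 j <= L - mu m.
  have /andP[h1 h2] := lamb j; rewrite mxE lerD2r h2 andbT subr_ge0.
  by apply: le_trans h1; apply: le_trans hg; rewrite lerDl ltW.
have dl2 j : d <= (\row_j (tnth lam j - mu m)) 0 j <= L.
  have /andP[h1 h2] := lamb j; rewrite mxE lerBrDl (le_trans hg h1)/=.
  by apply: le_trans h2; rewrite gerBl ltW.
have [g [gb [B [mB PB hB]]]] := mean_kendall_concentration (hx m) SE hUm mu0 muL dl1 p0 n1 K0 h16 k1E k2E.
(* The bad event lies in [B], since off [B] the two-step estimate holds for each outcome. *)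
apply: (@le_trans _ _ (P m B)); last first.
  apply: (le_trans PB); rewrite lee_fin; apply: (le_trans (net_probability_bound _)).
  rewrite ler_pdivrMr ?ltr_wpDr//.
  have : 2 <= (p m)%:R * eps by rewrite -ler_pdivrMr.
  by move: eps0; lra.
apply: le_measure; rewrite ?inE//; first exact: measurable_projection_distance.
move=> w /= hw; apply: contrapT => nB; move: hw; apply/negP; rewrite -leNgt.
rewrite ger0_norm ?frobenius_ge0//.
have e0 : 0 <= 2 * (k1 * L * Num.sqrt ((p m)%:R / (K m * n m)%:R)
    + k2 * r%:R * L ^+ 2 / (mu m * (p m)%:R)).
  rewrite mulr_ge0// addr_ge0//.
    by rewrite mulr_ge0 ?sqrtr_ge0// mulr_ge0 ?(ltW L0)// ltW.
  by rewrite divr_ge0// mulr_ge0 ?sqr_ge0 ?(ltW mu0)// mulr_ge0// ltW.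
have pm0 : 0 <= (p m)%:R * mu m by rewrite mulr_ge0// ltW.
have c01 : 0 <= c < 1 by rewrite c0.
have := two_steps rp hUm (hU1_orth m w) pm0 gb hd dl2 SE ST (hB w nB) e0 c01 (hU1_close m w)
  erefl (le_trans erate rate_small) (hstep1 m w) (hstep2 m w).
move=> /le_trans; apply.
rewrite -/(rate m) -[leRHS]mulrA; apply: ler_wpM2l; first exact: sqrtr_ge0.
by rewrite -[leRHS]mulrA; apply: ler_wpM2l => //; rewrite divr_ge0// ltW.
Unshelve. all: by end_near.
Qed.
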